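(* Let $1\le m<\infty$, $\kappa\ge 0$, $0<\alpha_j<1$ for $1\le j\le m$, $\alpha=\min_{1\le j\le m}\alpha_j$, $0<T<\infty$, and let $A,B_1,\dots,B_m$ be operators in the Hilbert space $\mathbf H$ as described in the context. Let $u$ be the solution of $$u'(t)+Au(t)+\sum_{j=1}^m\int_0^t\beta_j(t-s)B_ju(s)\,ds=f(t),\quad t>0,\qquad u(0)=u_0,\qquad \beta_j(t)=\frac{e^{-\kappa t}t^{\alpha_j-1}}{\Gamma(\alpha_j)},$$ and put $g(t)=e^{\kappa t}f(t)$. Suppose that for some positive constant $C$ $$\|Au_0-g(0)\|+\|g(t)\|\le C,\qquad \|E'(t)(Au_0-g(0))\|+\|g'(t)\|+t\|g''(t)\|\le Ct^{\alpha-1},\qquad 0<t\le T,$$ where $E(t)=\exp(-At)$. Then there is a positive constant $C$, independent of $t$, such that $$\|u'(t)\|+\|Au(t)\|\le Ce^{-\kappa t}\|u_0\|,\qquad 0<t\le T.$$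
   Context: $\mathbf H$ is a Hilbert space with inner product $(\cdot,\cdot)$ and norm $\|\cdot\|$ (in the setting considered, $\mathbf H=L_2(\Omega)$ with $\Omega\subseteq\mathbb R^d$ a Lipschitz domain). $A$ is a self-adjoint positive-definite linear operator, not necessarily bounded, with compact inverse, defined on a dense subspace $D(A)\subset\mathbf H$. Set $\|w\|_q=\|A^{q/2}w\|=(A^qw,w)^{1/2}$. Each $B_j$ ($1\le j\le m$) is a self-adjoint linear operator in $\mathbf H$ with $D(B_j)\supset D(A)$, and $A$ dominates $B_j$ in the sense that $|(B_jw,v)|\le C\|w\|_q\|v\|_\vartheta$ for $\vartheta=0,1,2$ and $\vartheta+q=2$. $E(t)=\exp(-At)$ is the analytic semigroup generated by $-A$, and primes denote derivatives in $t$. $C$ denotes a generic positive constant, not necessarily the same at each occurrence.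
   Formalization: Adds the hypothesis that if u_0 = 0 then f = 0 on (0,T]; without it the estimate fails (u_0 = 0, f = e^{-κt}φ with φ an eigenvector of A), and when u_0 = 0 the estimate itself forces f = 0 there. *)

(* Defs.v *)
From Stdlib Require Import Reals RList List.
From Coquelicot Require Import Coquelicot.
Open Scope R_scope.

(* Real scalars.  A complex Hilbert space is a real one for Re (.,.), and every
   notion below is inherited by the underlying real space. *)
Record Hilbert : Type := {
  hilb_carrier :> CompleteNormedModule R_AbsRing;
  inner : hilb_carrier -> hilb_carrier -> R;
  inner_sym : forall x y, inner x y = inner y x;
  inner_plus : forall x y z, inner (plus x y) z = inner x z + inner y z;
  inner_scal : forall (a : R) x y, inner (scal a x) y = a * inner x y;
  inner_norm : forall x, inner x x = norm x ^ 2
}.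
Arguments inner {h} x y.

(* Only the values of [op_fun] on [dom] are meaningful. *)
Record operator (H : Hilbert) : Type := {
  dom : H -> Prop;
  op_fun :> H -> H;
  dom_zero : dom zero;
  dom_plus : forall x y, dom x -> dom y -> dom (plus x y);
  dom_scal : forall (a : R) x, dom x -> dom (scal a x);
  op_plus : forall x y, dom x -> dom y ->
    op_fun (plus x y) = plus (op_fun x) (op_fun y);
  op_scal : forall (a : R) x, dom x -> op_fun (scal a x) = scal a (op_fun x)
}.
Arguments dom {H} o x.
Arguments op_fun {H} o x.

Definition densely_defined {H : Hilbert} (L : operator H) : Prop :=
  forall (x : H) (eps : R), 0 < eps ->
    exists y : H, dom L y /\ norm (minus y x) < eps.

(* The right-hand side says that (v, z) lies in the graph of the adjoint. *)
Definition self_adjoint {H : Hilbert} (L : operator H) : Prop :=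
  densely_defined L /\
  forall v z : H,
    (dom L v /\ L v = z) <->
    (forall w : H, dom L w -> inner (L w) v = inner w z).

Definition positive_definite {H : Hilbert} (L : operator H) : Prop :=
  forall w : H, dom L w -> w <> zero -> 0 < inner (L w) w.

Definition compact_map {H : Hilbert} (K : H -> H) : Prop :=
  forall (x : nat -> H) (M : R), (forall n, norm (x n) <= M) ->
    exists (phi : nat -> nat) (y : H),
      (forall n, (phi n < phi (S n))%nat) /\
      filterlim (fun n => K (x (phi n))) eventually (locally y).

Definition has_compact_inverse {H : Hilbert} (L : operator H) : Prop :=
  exists Linv : H -> H,
    (forall y, dom L (Linv y) /\ L (Linv y) = y) /\
    (forall x, dom L x -> Linv (L x) = x) /\
    compact_map Linv.

(* ||w||_q = ||A^{q/2} w|| for integer q: with x = A^k w, this is ||x|| if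
   q = 2k, and ||A^{1/2} x|| = (A x, x)^{1/2} if q = 2k+1. *)
Definition norm_q {H : Hilbert} (A : operator H) (q : nat) (w : H) : R :=
  let x := Nat.iter (Nat.div2 q) (op_fun A) w in
  if Nat.even q then norm x else sqrt (inner (A x) x).

(* It is enough to ask for v in D(A), which is dense in D(A^{theta/2}). *)
Definition dominates {H : Hilbert} (A B : operator H) : Prop :=
  exists C : R, forall theta q : nat, (theta + q = 2)%nat ->
    forall w v : H, dom A w -> dom A v ->
      Rabs (inner (B w) v) <= C * norm_q A q w * norm_q A theta v.

(* E is the strongly continuous semigroup with generator -A.  For self-adjoint
   positive-definite A it exists, is unique and is analytic. *)
Record exp_semigroup {H : Hilbert} (A : operator H) (E : R -> H -> H) : Prop := {
  sg_linear : forall t, 0 <= t -> is_linear (E t);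
  sg_zero : forall x, E 0 x = x;
  sg_add : forall s t x, 0 <= s -> 0 <= t -> E (s + t) x = E s (E t x);
  sg_cont : forall x, filterlim (fun t => E t x) (at_right 0) (locally x);
  sg_generator : forall x y : H,
    (dom A x /\ A x = y) <->
    filterlim (fun h => scal (/ h) (minus (E h x) x)) (at_right 0)
      (locally (opp y))
}.

Definition Gamma (a : R) : R :=
  RInt_gen (fun s => Rpower s (a - 1) * exp (- s))
    (at_right 0) (Rbar_locally p_infty).

Definition beta (kappa a t : R) : R :=
  exp (- kappa * t) * Rpower t (a - 1) / Gamma a.

Definition memory {H : Hilbert} (kappa a : R) (B : operator H) (u : R -> H)
    (t : R) : R -> H :=
  fun s => scal (beta kappa a (t - s)) (B (u s)).

(* Classical solution with derivative u1.  The memory integrals are improper: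
   the kernel is singular at s = t, and B (u s) may be unbounded as s -> 0. *)
Record is_solution {H : Hilbert} (A : operator H) (m : nat) (B : nat -> operator H)
    (kappa : R) (alpha : nat -> R) (f : R -> H) (u0 : H) (u u1 : R -> H) : Prop := {
  sol_init : u 0 = u0;
  sol_cont0 : filterlim u (at_right 0) (locally u0);
  sol_dom : forall t, 0 < t -> dom A (u t);
  sol_derive : forall t, 0 < t -> is_derive u t (u1 t);
  sol_memory : forall t j, 0 < t -> (1 <= j <= m)%nat ->
    ex_RInt_gen (memory kappa (alpha j) (B j) u t) (at_right 0) (at_left t);
  sol_eq : forall t, 0 < t ->
    plus (plus (u1 t) (A (u t)))
      (sum_n_m (fun j =>
         RInt_gen (memory kappa (alpha j) (B j) u t) (at_right 0) (at_left t))
       1 m)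
    = f t
}.

Definition alpha_min (alpha : nat -> R) (m : nat) : R :=
  MinRlist (map alpha (seq 1 m)).

(* Main.v *)
Require Import Defs.
From Stdlib Require Import Reals.
From Coquelicot Require Import Coquelicot.
From Stdlib Require Import Lra Lia Psatz RList List.
From Stdlib Require Import ClassicalEpsilon.
Open Scope R_scope.

(* Replace [u] by [V t = exp (- lam t) u t - u0], which shifts [kappa] to [kappa + lam];
   for [lam] large the memory operator [K] has norm, and form bound relative to [A], at
   most 1/2.  With [S] the inverse of [A], the equation tested against [S v] involves
   only the continuous function [V] and the bounded operators [B_j S], so that it can be
   integrated in time.  Its primitive [U] (with [U' = V]) is a strong solution: by
   contraction [phi + K phi = F - V - lam U], [F] the integrated source, has a continuous solution,
   and [S phi = U] by uniqueness, hence [phi = A U].  The energy identity for second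
   differences of [U] bounds them by the integral of the second differences of [F], i.e.
   by the total variation of the source; so [V] is Lipschitz and [u'] is bounded.  The
   contraction estimate for differences of [phi] then makes [A U] Lipschitz, which bounds
   [A V] and [A u].  If [u0 = 0] the source vanishes and so do all these bounds. *)

(** * Inner product and calculus of Hilbert-valued functions *)

(** The solution is classical only for [t > 0], and [B j (u s)] may be unbounded as [s -> 0], so the
    equation can be neither paired with [A u] nor differentiated down to [t = 0]. Moreover the
    source, extended by zero to negative times, jumps at [0], and its derivative may grow like
    [t ^ (alpha - 1)] there. It has bounded variation and not more. A difference of such a function
    has a time integral of the order of the step, and the energy estimate asks for nothing but this
    integral: hence its use on differences. Extending the unknown by zero to the past allows
    differences without boundary terms, and the memory operator commutes with them because its
    delays do not depend on time. The substitution [s = t - T * r ^ (1 / alpha)] turns each tested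
    memory integral into the Riemann integral of a continuous function over [[0, 1]]. The bound
    [1 / 2] serves twice: it makes the memory operator a contraction, and it leaves half of the
    coercive term in the energy identity. The constant of the theorem has to be independent of [t]
    only; for [u0 <> zero] it is a bound on the left side divided by [norm u0]. *)

Section InnerProduct.

Context {H : Hilbert}.
Implicit Types x y z v : H.

Lemma inner_plus_r x y z : inner x (plus y z) = inner x y + inner x z.
Proof. now rewrite inner_sym, inner_plus, (inner_sym _ y), (inner_sym _ z). Qed.

Lemma inner_scal_r (a : R) x y : inner x (scal a y) = a * inner x y.
Proof. now rewrite inner_sym, inner_scal, (inner_sym _ y). Qed.

Lemma inner_opp x y : inner (opp x) y = - inner x y.
Proof.
  replace (opp x) with (scal (opp (one : R_AbsRing)) x) by exact (scal_opp_one x).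
  rewrite inner_scal. unfold opp, one; simpl. ring.
Qed.

Lemma inner_opp_r x y : inner x (opp y) = - inner x y.
Proof. now rewrite inner_sym, inner_opp, inner_sym. Qed.

Lemma inner_minus x y z : inner (minus x y) z = inner x z - inner y z.
Proof. unfold minus. rewrite inner_plus, inner_opp. ring. Qed.

Lemma inner_minus_r x y z : inner z (minus x y) = inner z x - inner z y.
Proof. now rewrite inner_sym, inner_minus, !(inner_sym _ z). Qed.

Lemma inner_zero x : inner zero x = 0.
Proof.
  replace (zero : H) with (scal (zero : R_AbsRing) (zero : H)) by exact (scal_zero_l _).
  rewrite inner_scal. unfold zero at 1; simpl. ring.
Qed.

Lemma inner_zero_r x : inner x zero = 0.
Proof. rewrite inner_sym. apply inner_zero. Qed.

Lemma inner_self_zero x : inner x x = 0 -> x = zero.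
Proof.
  rewrite inner_norm. intros h. apply (@norm_eq_zero R_AbsRing H).
  destruct (Req_dec (norm x) 0) as [e|e]; [exact e|].
  exfalso. apply (pow_nonzero _ 2 e h).
Qed.

Lemma eq_of_minus_zero x y : minus x y = zero -> x = y.
Proof.
  intros e. apply (plus_reg_r (opp y)).
  exact (eq_trans e (eq_sym (plus_opp_r y))).
Qed.

Lemma inner_ext x y : (forall v, inner x v = inner y v) -> x = y.
Proof.
  intros h.
  apply eq_of_minus_zero, inner_self_zero. rewrite inner_minus, h. ring.
Qed.

Lemma cauchy_schwarz x y : Rabs (inner x y) <= norm x * norm y.
Proof.
  destruct (Req_dec (norm y) 0) as [e|e].
  - apply (@norm_eq_zero R_AbsRing H) in e. subst y. rewrite inner_zero_r, Rabs_R0.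
    apply Rmult_le_pos; apply norm_ge_0.
  - assert (hy : 0 < norm y) by (pose proof (norm_ge_0 y); lra).
    assert (hx := norm_ge_0 x).
    apply Rsqr_incr_0; [|apply Rabs_pos|now apply Rmult_le_pos, Rlt_le].
    rewrite <- Rsqr_abs.
    (* The minimiser of the norm of [x + t y] over real [t]. *)
    set (t := - inner x y / (norm y ^ 2)).
    assert (h : 0 <= inner (plus x (scal t y)) (plus x (scal t y))).
    { rewrite inner_norm. apply pow2_ge_0. }
    rewrite inner_plus, !inner_plus_r, inner_scal, inner_scal_r, inner_scal,
      inner_scal_r, (inner_sym _ y x), !inner_norm in h.
    replace (norm x ^ 2 + t * inner x y + (t * inner x y + t * (t * norm y ^ 2)))
      with (norm x ^ 2 - inner x y ^ 2 / norm y ^ 2) in h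
      by (unfold t; field; lra).
    assert (h2 : 0 <= (norm x ^ 2 - inner x y ^ 2 / norm y ^ 2) * norm y ^ 2).
    { apply Rmult_le_pos; [exact h|apply pow2_ge_0]. }
    replace ((norm x ^ 2 - inner x y ^ 2 / norm y ^ 2) * norm y ^ 2)
      with (norm x ^ 2 * norm y ^ 2 - inner x y ^ 2) in h2 by (field; lra).
    unfold Rsqr. nra.
Qed.

Lemma inner_le_norm x y : inner x y <= norm x * norm y.
Proof. apply Rle_trans with (2 := cauchy_schwarz x y). apply Rle_abs. Qed.

Lemma norm_le_of_inner x (M : R) : 0 <= M ->
  (forall v, inner x v <= M * norm v) -> norm x <= M.
Proof.
  intros hM h. specialize (h x). rewrite inner_norm in h.
  pose proof (norm_ge_0 x). nra.
Qed.

Lemma hnorm_triangle x y : norm (plus x y) <= norm x + norm y.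
Proof. exact (@norm_triangle R_AbsRing H x y). Qed.

Lemma hnorm_opp x : norm (opp x) = norm x.
Proof. exact (@norm_opp R_AbsRing H x). Qed.

Lemma hnorm_zero : norm (zero : H) = 0.
Proof. exact (@norm_zero R_AbsRing H). Qed.

Lemma hnorm_ge_0 x : 0 <= norm x.
Proof. exact (@norm_ge_0 R_AbsRing H x). Qed.

Lemma hnorm_scal (a : R) x : norm (scal a x) = Rabs a * norm x.
Proof.
  apply Rsqr_inj.
  - apply hnorm_ge_0.
  - apply Rmult_le_pos; [apply Rabs_pos|apply hnorm_ge_0].
  - pose proof (inner_norm _ (scal a x)) as h.
    rewrite inner_scal, inner_scal_r, inner_norm in h.
    rewrite Rsqr_mult, <- Rsqr_abs. unfold Rsqr. lra.
Qed.

Lemma hnorm_minus_le x y : norm (minus x y) <= norm x + norm y.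
Proof. unfold minus. rewrite <- (hnorm_opp y). apply hnorm_triangle. Qed.

Lemma hnorm_sub x y : norm x <= norm (minus x y) + norm y.
Proof.
  assert (e : x = plus (minus x y) y).
  { apply inner_ext. intros v. rewrite inner_plus, inner_minus. ring. }
  rewrite e at 1. apply hnorm_triangle.
Qed.

End InnerProduct.

Ltac inner_simpl :=
  rewrite ?inner_plus, ?inner_plus_r, ?inner_minus, ?inner_minus_r, ?inner_opp,
    ?inner_opp_r, ?inner_scal, ?inner_scal_r, ?inner_zero, ?inner_zero_r.

(* Unification picks various canonical paths to the same vector operations;
   [inner_simpl] only sees the one that elaboration chooses for [H] itself. *)
Ltac fold_vector_ops :=
  match goal with
  | |- context [@inner ?H _ _] =>
    repeat match goal with
    | |- context [@minus ?G ?x ?y] => progress change (@minus G x y)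
        with (@minus (CompleteNormedModule.AbelianGroup R_AbsRing (hilb_carrier H)) x y)
    | |- context [@opp ?G ?x] => progress change (@opp G x)
        with (@opp (CompleteNormedModule.AbelianGroup R_AbsRing (hilb_carrier H)) x)
    | |- context [@plus ?G ?x ?y] => progress change (@plus G x y)
        with (@plus (CompleteNormedModule.AbelianMonoid R_AbsRing (hilb_carrier H)) x y)
    | |- context [@zero ?G] => progress change (@zero G)
        with (@zero (CompleteNormedModule.AbelianMonoid R_AbsRing (hilb_carrier H)))
    | |- context [@scal ?K ?G ?a ?x] => progress change (@scal K G a x)
        with (@scal R_Ring (CompleteNormedModule.ModuleSpace R_AbsRing (hilb_carrier H)) a x)
    end
  end.

(* Linear identities between vectors are checked against every test vector. *)
Ltac vector_ring :=
  apply inner_ext; intro; fold_vector_ops; repeat progress inner_simpl; ring.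

Lemma hnorm_compat1 {H : Hilbert} (x y : H) (eps : R) : norm (minus y x) < eps -> ball x eps y.
Proof. exact (@norm_compat1 R_AbsRing H x y eps). Qed.

Section Calculus.

Context {T : UniformSpace} {V : NormedModule R_AbsRing}.

Lemma continuous_norm_minus (f : T -> V) (x : T) (eps : R) :
  continuous f x -> 0 < eps -> locally x (fun y => norm (minus (f y) (f x)) < eps).
Proof.
  intros h he.
  assert (p : 0 < eps / @norm_factor _ V).
  { apply Rdiv_lt_0_compat; [exact he|apply norm_factor_gt_0]. }
  assert (q := h (ball (f x) (mkposreal _ p)) (locally_ball _ _)).
  unfold filtermap in q. revert q. apply filter_imp. intros y hy. apply norm_compat2 in hy. simpl in hy.
  replace eps with (@norm_factor _ V * (eps / @norm_factor _ V)); [exact hy|].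
  field. apply Rgt_not_eq, norm_factor_gt_0.
Qed.

Lemma continuous_of_norm_minus (f : T -> V) (x : T) :
  (forall eps : R, 0 < eps -> locally x (fun y => norm (minus (f y) (f x)) <= eps)) ->
  continuous f x.
Proof.
  intros h. apply filterlim_locally. intros eps.
  assert (p : 0 < eps / 2) by (destruct eps; simpl; lra).
  generalize (h _ p). apply filter_imp. intros y hy. apply norm_compat1.
  destruct eps; simpl in *; lra.
Qed.

End Calculus.

Lemma hcontinuous_norm_minus {T : UniformSpace} {H : Hilbert} (f : T -> H) (x : T) (eps : R) :
  continuous f x -> 0 < eps -> locally x (fun y => norm (minus (f y) (f x)) < eps).
Proof. exact (continuous_norm_minus f x eps). Qed.

Lemma hcontinuous_of_norm_minus {T : UniformSpace} {H : Hilbert} (f : T -> H) (x : T) :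
  (forall eps : R, 0 < eps -> locally x (fun y => norm (minus (f y) (f x)) <= eps)) ->
  continuous f x.
Proof. exact (continuous_of_norm_minus f x). Qed.

Lemma hlocally_norm_minus {H : Hilbert} (x : H) (eps : R) :
  0 < eps -> locally x (fun y => norm (minus y x) < eps).
Proof.
  intros he. apply (hcontinuous_norm_minus (fun y => y)); [apply continuous_id|exact he].
Qed.

Lemma is_derive_iff {V : NormedModule R_AbsRing} (f : R -> V) (x : R) (l : V) :
  is_derive f x l <->
  (forall eps : R, 0 < eps -> locally x (fun y =>
     norm (minus (minus (f y) (f x)) (scal (y - x) l)) <= eps * Rabs (y - x))).
Proof.
  split.
  - intros [_ h] eps he.
    exact (h x (fun P hP => hP) (mkposreal eps he)).
  - intros h. split; [apply is_linear_scal_l|].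
    intros z hz eps.
    rewrite <- (is_filter_lim_locally_unique _ _ hz).
    exact (h eps (cond_pos eps)).
Qed.

Lemma continuous_of_is_derive {V : NormedModule R_AbsRing} (f : R -> V) (x : R) (l : V) :
  is_derive f x l -> continuous f x.
Proof. intros h. apply @ex_derive_continuous. now exists l. Qed.

(** Polarization: the inner product is a quarter of a difference of squared norms, and the norm is
    continuous. *)
Lemma continuous_inner {T : UniformSpace} {H : Hilbert} (f g : T -> H) (x : T) :
  continuous f x -> continuous g x -> continuous (fun t => inner (f t) (g t)) x.
Proof.
  intros hf hg.
  apply continuous_ext with (fun t =>
    / 4 * (norm (plus (f t) (g t)) * norm (plus (f t) (g t)) -
           norm (minus (f t) (g t)) * norm (minus (f t) (g t)))).
  { intros t. pose proof (inner_norm _ (plus (f t) (g t))) as h1.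
    pose proof (inner_norm _ (minus (f t) (g t))) as h2.
    revert h1 h2. repeat progress inner_simpl.
    rewrite (inner_sym _ (g t) (f t)). intros h1 h2. lra. }
  assert (hn : forall h : T -> H, continuous h x -> continuous (fun t => norm (h t)) x).
  { intros h hh.
    exact (continuous_comp h (fun y : H => norm y) x hh (@filterlim_norm R_AbsRing H (h x))). }
  apply (continuous_mult (fun _ => / 4)); [apply continuous_const|].
  apply (@continuous_minus _ R_AbsRing R_NormedModule); apply @continuous_mult; apply hn.
  all: try now apply (@continuous_plus _ R_AbsRing H).
  all: now apply (@continuous_minus _ R_AbsRing H).
Qed.

Lemma is_derive_inner {H : Hilbert} (f g : R -> H) (x : R) (df dg : H) :
  is_derive f x df -> is_derive g x dg ->
  is_derive (fun t => inner (f t) (g t)) x (inner df (g x) + inner (f x) dg).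
Proof.
  intros hf hg.
  assert (cg := continuous_of_is_derive _ _ _ hg).
  pose proof (norm_ge_0 (g x)) as p1. pose proof (norm_ge_0 (f x)) as p2.
  pose proof (norm_ge_0 df) as p3.
  apply is_derive_iff. intros eps he.
  (* The three error terms below carry the factors [norm (g y) <= norm (g x) + 1], [norm (f x)] and
     [norm df]; with tolerance [eps / K] for each they add up to [eps]. *)
  set (K := norm (g x) + 1 + norm (f x) + norm df).
  assert (hK : 0 < K) by (unfold K; lra).
  assert (he1 : 0 < eps / K) by now apply Rdiv_lt_0_compat.
  generalize (filter_and _ _ (filter_and _ _
    (proj1 (is_derive_iff _ _ _) hf _ he1) (proj1 (is_derive_iff _ _ _) hg _ he1))
    (filter_and _ _ (continuous_norm_minus _ _ _ cg he1)
                    (continuous_norm_minus _ _ _ cg Rlt_0_1))).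
  apply filter_imp. intros y [[h1 h2] [h3 h4]].
  set (rf := minus (minus (f y) (f x)) (scal (y - x) df)) in *.
  set (rg := minus (minus (g y) (g x)) (scal (y - x) dg)) in *.
  change (Rabs (inner (f y) (g y) - inner (f x) (g x) -
    (y - x) * (inner df (g x) + inner (f x) dg)) <= eps * Rabs (y - x)).
  replace (inner (f y) (g y) - inner (f x) (g x) -
    (y - x) * (inner df (g x) + inner (f x) dg))
    with (inner rf (g y) + inner (f x) rg + (y - x) * inner df (minus (g y) (g x))).
  2:{ unfold rf, rg. repeat progress inner_simpl. ring. }
  assert (h5 : norm (g y) <= norm (g x) + 1).
  { eapply Rle_trans; [apply (hnorm_sub (g y) (g x))|].
    rewrite Rplus_comm. apply Rplus_le_compat_l, Rlt_le, h4. }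
  apply Rle_trans with (Rabs (inner rf (g y)) + Rabs (inner (f x) rg) +
     Rabs ((y - x) * inner df (minus (g y) (g x)))).
  { eapply Rle_trans; [apply Rabs_triang|].
    apply Rplus_le_compat_r, Rabs_triang. }
  rewrite Rabs_mult.
  pose proof (cauchy_schwarz rf (g y)). pose proof (cauchy_schwarz (f x) rg).
  pose proof (cauchy_schwarz df (minus (g y) (g x))).
  pose proof (Rabs_pos (y - x)) as h6.
  set (d := eps / K) in *. set (w := Rabs (y - x)) in *.
  assert (q1 : norm rf * norm (g y) <= d * w * (norm (g x) + 1)).
  { apply Rmult_le_compat; auto using norm_ge_0. }
  assert (q2 : norm (f x) * norm rg <= norm (f x) * (d * w)).
  { apply Rmult_le_compat_l; auto. }
  assert (q3 : w * Rabs (inner df (minus (g y) (g x))) <= w * (norm df * d)).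
  { apply Rmult_le_compat_l; auto. eapply Rle_trans; [eassumption|].
    apply Rmult_le_compat_l; auto. apply Rlt_le, h3. }
  replace (eps * w) with (d * K * w) by (unfold d; field; lra).
  unfold K. nra.
Qed.

(** Pairing with [v] commutes with every Riemann sum by linearity and passes to the limit by
    continuity. Vector integrals are handled through scalar ones in this way. *)
Lemma is_RInt_inner {H : Hilbert} (f : R -> H) (a b : R) (l v : H) :
  is_RInt f a b l -> is_RInt (fun t => inner (f t) v) a b (inner l v).
Proof.
  intros h. unfold is_RInt in *.
  apply filterlim_ext with
    (fun ptd => inner (scal (sign (b - a)) (Riemann_sum f ptd)) v).
  { intros ptd. rewrite inner_scal. unfold scal; simpl. unfold mult; simpl. f_equal.
    revert ptd. apply SF_cons_ind.
    - intros x0. apply inner_zero.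
    - intros h0 s IH. rewrite !Riemann_sum_cons, inner_plus, IH, inner_scal. reflexivity. }
  apply (filterlim_comp _ _ _ _ (fun x : H => inner x v) _ _ _ h).
  apply (continuous_inner (fun x => x) (fun _ => v)).
  - apply continuous_id.
  - apply continuous_const.
Qed.

Lemma ex_RInt_inner {H : Hilbert} (f : R -> H) (a b : R) (v : H) :
  ex_RInt f a b -> ex_RInt (fun t => inner (f t) v) a b.
Proof. intros [l h]. exists (inner l v). now apply is_RInt_inner. Qed.

Lemma RInt_inner {H : Hilbert} (f : R -> H) (a b : R) (v : H) :
  ex_RInt f a b -> RInt (fun t => inner (f t) v) a b = inner (RInt f a b) v.
Proof. intros h. apply is_RInt_unique, is_RInt_inner, RInt_correct, h. Qed.

Lemma is_RInt_gen_inner {H : Hilbert} (f : R -> H) (Fa Fb : (R -> Prop) -> Prop)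
    {FFa : Filter Fa} {FFb : Filter Fb} (l v : H) :
  is_RInt_gen f Fa Fb l -> is_RInt_gen (fun t => inner (f t) v) Fa Fb (inner l v).
Proof.
  intros h P hP.
  assert (c : continuous (fun x : H => inner x v) l).
  { apply (continuous_inner (fun x => x) (fun _ => v)).
    - apply continuous_id.
    - apply continuous_const. }
  specialize (h _ (c _ hP)). unfold filtermapi in *. revert h.
  apply filter_imp. intros ab [y [h1 h2]]. exists (inner y v). split; [|exact h2].
  now apply is_RInt_inner.
Qed.


(** Backward rather than forward: functions that vanish at negative times keep doing so, and up to
    time [T] only values up to [T] enter. *)
Definition dif {H : Hilbert} (h : R) (f : R -> H) (t : R) : H := minus (f t) (f (t - h)).

Lemma continuous_shift {U : UniformSpace} (h : R) (f : R -> U) (t : R) :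
  (forall s, continuous f s) -> continuous (fun s => f (s - h)) t.
Proof.
  intros hf. apply (continuous_comp (fun s => s - h) f); [|apply hf].
  apply (@continuous_minus _ R_AbsRing R_NormedModule);
    [apply continuous_id|apply continuous_const].
Qed.

Lemma continuous_dif {H : Hilbert} (h : R) (f : R -> H) (t : R) :
  (forall s, continuous f s) -> continuous (dif h f) t.
Proof.
  intros hf. apply (@continuous_minus _ R_AbsRing H); [apply hf|].
  now apply continuous_shift.
Qed.

Lemma is_derive_shift {V : NormedModule R_AbsRing} (h : R) (f df : R -> V) (t : R) :
  (forall s, is_derive f s (df s)) -> is_derive (fun s => f (s - h)) t (df (t - h)).
Proof.
  intros hf. rewrite <- (@scal_one R_Ring V (df (t - h))).
  apply (is_derive_comp f (fun s => s - h)); [apply hf|].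
  change (is_derive (fun s : R => s - h) t 1). auto_derive; [easy|ring].
Qed.

Lemma is_derive_dif {H : Hilbert} (h : R) (f df : R -> H) (t : R) :
  (forall s, is_derive f s (df s)) -> is_derive (dif h f) t (dif h df t).
Proof.
  intros hf. apply (@is_derive_minus R_AbsRing H); [apply hf|].
  now apply (@is_derive_shift H).
Qed.

(** Only backward quotients with small steps at the single point [t] are used, so the bound is
    available at the endpoint [T] as well. *)
Lemma Rabs_derive_le (g : R -> R) (t h0 C l : R) :
  is_derive g t l -> 0 < h0 ->
  (forall h, 0 < h < h0 -> Rabs (g t - g (t - h)) <= C * h) -> Rabs l <= C.
Proof.
  intros hd h0pos hC. apply le_epsilon. intros eps he.
  destruct (proj1 (is_derive_iff (V := R_NormedModule) _ _ _) hd eps he) as [d hdl].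
  set (h := Rmin d h0 / 2).
  assert (hm : 0 < Rmin d h0) by (apply Rmin_pos; [apply cond_pos|exact h0pos]).
  pose proof (Rmin_l d h0). pose proof (Rmin_r d h0).
  assert (hh : 0 < h) by (unfold h; lra).
  assert (b : ball t d (t - h)).
  { change (Rabs (t - h - t) < d). rewrite Rabs_left; unfold h; lra. }
  specialize (hdl _ b). specialize (hC h ltac:(unfold h in *; lra)).
  change (Rabs (g (t - h) - g t - (t - h - t) * l) <= eps * Rabs (t - h - t)) in hdl.
  replace (Rabs (t - h - t)) with h in hdl by (rewrite Rabs_left; lra).
  assert (q : h * Rabs l <= (C + eps) * h).
  { rewrite <- (Rabs_pos_eq h) at 1 by lra. rewrite <- Rabs_mult.
    replace (h * l) with ((g t - g (t - h)) + (g (t - h) - g t - (t - h - t) * l)) by ring.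
    eapply Rle_trans; [apply Rabs_triang|]. lra. }
  nra.
Qed.

Lemma is_derive_inner_l {H : Hilbert} (f : R -> H) (x : R) (l v : H) :
  is_derive f x l -> is_derive (fun t => inner (f t) v) x (inner l v).
Proof.
  intros hf. replace (inner l v) with (inner l v + inner (f x) zero)
    by (rewrite inner_zero_r; ring).
  apply (is_derive_inner f (fun _ => v)); [exact hf|apply (@is_derive_const R_AbsRing H)].
Qed.

(** Testing against the derivative [l] itself reduces the vector bound to the scalar one. *)
Lemma norm_derive_le {H : Hilbert} (g : R -> H) (t h0 C : R) (l : H) :
  is_derive g t l -> 0 < h0 -> 0 <= C ->
  (forall h, 0 < h < h0 -> norm (dif h g t) <= C * h) -> norm l <= C.
Proof.
  intros hd h0pos C0 hC.
  assert (h : Rabs (inner l l) <= C * norm l).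
  { apply (Rabs_derive_le (fun s => inner (g s) l) t h0); [now apply is_derive_inner_l|exact h0pos|].
    intros h hh. rewrite <- inner_minus.
    eapply Rle_trans; [apply cauchy_schwarz|].
    specialize (hC h hh). unfold dif in hC. pose proof (hnorm_ge_0 l). nra. }
  rewrite inner_norm, Rabs_pos_eq in h by apply pow2_ge_0.
  pose proof (hnorm_ge_0 l). nra.
Qed.

Lemma is_derive_scal_fun {H : Hilbert} (a : R -> R) (f : R -> H) (x da : R) (df : H) :
  is_derive a x da -> is_derive f x df ->
  is_derive (fun t => scal (a t) (f t)) x (plus (scal da (f x)) (scal (a x) df)).
Proof.
  intros ha hf.
  assert (e := @filterdiff_scal_fct R_AbsRing (AbsRing_NormedModule R_AbsRing) H x a f _ _ Rmult_comm ha hf).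
  refine (filterdiff_ext_lin _ _ _ e _). intros y.
  change (plus (scal (y * da) (f x)) (scal (a x) (scal y df)) =
    scal y (plus (scal da (f x)) (scal (a x) df))).
  vector_ring.
Qed.

(** * Convolution with a delayed kernel *)

Lemma ex_RInt_cont {V : CompleteNormedModule R_AbsRing} (f : R -> V) (a b : R) :
  (forall t, continuous f t) -> ex_RInt f a b.
Proof. intros h. apply ex_RInt_continuous. auto. Qed.

Lemma continuous_bounded_above (f : R -> R) (a b : R) :
  (forall t, continuous f t) -> a <= b ->
  exists M, 0 <= M /\ forall t, a <= t <= b -> f t <= M.
Proof.
  intros h hab.
  destruct (continuity_ab_maj f a b hab) as [x [hx _]].
  { intros c _. apply continuity_pt_filterlim, h. }
  exists (Rmax 0 (f x)). split; [apply Rmax_l|].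
  intros t ht. eapply Rle_trans; [now apply hx|apply Rmax_r].
Qed.

Lemma continuous_Rabs (t : R) : continuous Rabs t.
Proof. exact (@filterlim_norm R_AbsRing R_NormedModule t). Qed.

Lemma continuous_affine (a b t : R) : continuous (fun t => a + b * t) t.
Proof.
  apply (@continuous_plus _ R_AbsRing R_NormedModule); [apply continuous_const|].
  apply (continuous_mult (fun _ => b)); [apply continuous_const|apply continuous_id].
Qed.

Lemma continuous_Rmin_const (T t : R) : continuous (fun t => Rmin t T) t.
Proof.
  assert (e : forall t, / 2 * (T + 1 * t - Rabs (- T + 1 * t)) = Rmin t T).
  { intros s. unfold Rmin. destruct (Rle_dec s T).
    - rewrite Rabs_left1 by lra. field.
    - rewrite Rabs_pos_eq by lra. field. }
  apply (continuous_ext _ _ _ e).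
  apply (continuous_mult (fun _ => / 2)); [apply continuous_const|].
  apply (@continuous_minus _ R_AbsRing R_NormedModule); [apply continuous_affine|].
  apply (continuous_comp (fun t => - T + 1 * t) Rabs);
    [apply continuous_affine|apply continuous_Rabs].
Qed.

Lemma continuous_Rmax_const (T t : R) : continuous (fun t => Rmax t T) t.
Proof.
  assert (e : forall t, / 2 * (T + 1 * t + Rabs (- T + 1 * t)) = Rmax t T).
  { intros s. unfold Rmax. destruct (Rle_dec s T).
    - rewrite Rabs_left1 by lra. field.
    - rewrite Rabs_pos_eq by lra. field. }
  apply (continuous_ext _ _ _ e).
  apply (continuous_mult (fun _ => / 2)); [apply continuous_const|].
  apply (@continuous_plus _ R_AbsRing R_NormedModule); [apply continuous_affine|].
  apply (continuous_comp (fun t => - T + 1 * t) Rabs);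
    [apply continuous_affine|apply continuous_Rabs].
Qed.

(** A causal convolution as a superposition of delays [p r] with weights [k r]. The interval of
    integration does not move with [t], and continuous [k] and [p] suffice to represent a weakly
    singular kernel (see [lag] and [kern]). *)
Definition conv {V : CompleteNormedModule R_AbsRing} (k p : R -> R) (psi : R -> V)
    (t : R) : V :=
  RInt (fun r => scal (k r) (psi (t - p r))) 0 1.

Definition rconv (k p : R -> R) (psi : R -> R) (t : R) : R :=
  RInt (fun r => k r * psi (t - p r)) 0 1.

Section Convolution.

Context {V : CompleteNormedModule R_AbsRing}.
Variables k p : R -> R.
Hypothesis k_cont : forall r, continuous k r.
Hypothesis p_cont : forall r, continuous p r.
Hypothesis p_nonneg : forall r, 0 <= p r.

Lemma continuous_lag (psi : R -> V) (t r : R) :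
  (forall s, continuous psi s) -> continuous (fun r => psi (t - p r)) r.
Proof.
  intros h. apply (continuous_comp (fun r => t - p r) psi); [|apply h].
  apply (@continuous_minus _ R_AbsRing R_NormedModule).
  - apply continuous_const.
  - apply p_cont.
Qed.

Lemma ex_conv (psi : R -> V) (t a b : R) : (forall s, continuous psi s) ->
  ex_RInt (fun r => scal (k r) (psi (t - p r))) a b.
Proof.
  intros h. apply ex_RInt_cont. intros r.
  apply (@continuous_scal _ R_AbsRing V).
  - apply k_cont.
  - now apply continuous_lag.
Qed.

Lemma ex_RInt_abs_kernel a b : ex_RInt (fun r => Rabs (k r)) a b.
Proof.
  apply @ex_RInt_cont. intros r.
  exact (continuous_comp k (fun y => norm y) r (k_cont r)
    (@filterlim_norm R_AbsRing R_NormedModule (k r))).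
Qed.

Lemma kernel_mass_nonneg : 0 <= RInt (fun r => Rabs (k r)) 0 1.
Proof.
  apply RInt_ge_0; [lra|apply ex_RInt_abs_kernel|]. intros. apply Rabs_pos.
Qed.

Lemma conv_minus (f g : R -> V) (t : R) :
  (forall s, continuous f s) -> (forall s, continuous g s) ->
  conv k p (fun s => minus (f s) (g s)) t = minus (conv k p f t) (conv k p g t).
Proof.
  intros hf hg. apply is_RInt_unique. unfold conv.
  eapply is_RInt_ext.
  2: exact (is_RInt_minus _ _ 0 1 _ _ (RInt_correct _ _ _ (ex_conv f t 0 1 hf))
             (RInt_correct _ _ _ (ex_conv g t 0 1 hg))).
  intros r _. unfold minus. simpl.
  rewrite (@scal_distr_l R_Ring V). now rewrite (@scal_opp_r R_Ring V).
Qed.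

Lemma conv_norm_le (psi : R -> V) (t M : R) : (forall s, continuous psi s) ->
  (forall s, s <= t -> norm (psi s) <= M) ->
  norm (conv k p psi t) <= RInt (fun r => Rabs (k r)) 0 1 * M.
Proof.
  intros hc h.
  refine (norm_RInt_le _ (fun r => M * Rabs (k r)) 0 1 _ _ Rle_0_1 _
    (RInt_correct _ _ _ (ex_conv psi t 0 1 hc)) _).
  - intros r _. eapply Rle_trans; [apply (@norm_scal R_AbsRing V)|].
    rewrite Rmult_comm. apply Rmult_le_compat_r; [apply Rabs_pos|].
    apply h. specialize (p_nonneg r). lra.
  - rewrite Rmult_comm.
    apply (is_RInt_scal (V := R_NormedModule)), (RInt_correct (V := R_CompleteNormedModule)), ex_RInt_abs_kernel.
Qed.

Lemma continuous_conv (psi : R -> V) (t : R) :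
  (forall s, continuous psi s) -> continuous (conv k p psi) t.
Proof.
  intros hc. apply (@continuous_of_norm_minus R_UniformSpace V (conv k p psi) t). intros eps he.
  set (n := RInt (fun r => Rabs (k r)) 0 1).
  assert (hn : 0 <= n) by apply kernel_mass_nonneg.
  destruct (continuous_bounded_above p 0 1 p_cont Rle_0_1) as [P [hP hp]].
  assert (he' : 0 < eps / (n + 1)) by (apply Rdiv_lt_0_compat; lra).
  (* All delayed times [y - p r] with [y] at distance less than [1] from [t] lie in this compact
     interval, since [P] bounds the delays. *)
  destruct (@unifcont_normed_1d R_AbsRing V psi (t - 1 - P) (t + 1)
    (fun x _ => hc x) (mkposreal _ he')) as [d hd].
  assert (hd' : 0 < Rmin d 1) by (apply Rmin_pos; [apply cond_pos|lra]).
  exists (mkposreal _ hd'). intros y hy.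
  change (Rabs (y - t) < Rmin d 1) in hy.
  assert (hy1 : Rabs (y - t) < d) by (eapply Rlt_le_trans; [exact hy|apply Rmin_l]).
  assert (hy2 : Rabs (y - t) < 1) by (eapply Rlt_le_trans; [exact hy|apply Rmin_r]).
  apply Rabs_def2 in hy2.
  assert (i := is_RInt_minus _ _ 0 1 _ _ (RInt_correct _ _ _ (ex_conv psi y 0 1 hc))
             (RInt_correct _ _ _ (ex_conv psi t 0 1 hc))).
  apply Rle_trans with (eps / (n + 1) * n).
  2:{ replace eps with (eps / (n + 1) * (n + 1)) at 2 by (field; lra).
      apply Rmult_le_compat_l; lra. }
  refine (norm_RInt_le _ (fun r => eps / (n + 1) * Rabs (k r)) 0 1 _ _ Rle_0_1 _ i _).
  - intros r hr. simpl. unfold minus.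
    rewrite <- (@scal_opp_r R_Ring V), <- (@scal_distr_l R_Ring V).
    eapply Rle_trans; [apply (@norm_scal R_AbsRing V)|].
    rewrite Rmult_comm. apply Rmult_le_compat_r; [apply Rabs_pos|].
    pose proof (hp r hr). pose proof (p_nonneg r).
    refine (Rlt_le _ _ (hd (t - p r) (y - p r) _ _ _)); try lra.
    change (Rabs (y - p r - (t - p r)) < d).
    now replace (y - p r - (t - p r)) with (y - t) by ring.
  - apply (is_RInt_scal (V := R_NormedModule)), (RInt_correct (V := R_CompleteNormedModule)), ex_RInt_abs_kernel.
Qed.

(** Differentiation under the integral sign. The real-valued case suffices because convolutions are
    differentiated only for scalar functions, obtained by pairing. *)
Lemma is_derive_rconv (Phi psi : R -> R) (t : R) :
  (forall s, is_derive Phi s (psi s)) -> (forall s, continuous psi s) ->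
  is_derive (rconv k p Phi) t (rconv k p psi t).
Proof.
  intros hd hc.
  assert (hP : forall s, continuous Phi s).
  { intros s. exact (continuous_of_is_derive _ _ _ (hd s)). }
  assert (hlag : forall (f : R -> R) u v, (forall s, continuous f s) ->
            continuous (fun z : R * R => f (fst z - p (snd z))) (u, v)).
  { intros f u v hf. apply (continuous_comp (fun z : R * R => fst z - p (snd z)) f).
    2: apply hf.
    apply (@continuous_minus _ R_AbsRing R_NormedModule).
    - apply continuous_fst.
    - apply (continuous_comp snd p); [apply continuous_snd|apply p_cont]. }
  assert (hD : forall u v, is_derive (fun z => k v * Phi (z - p v)) u (k v * psi (u - p v))).
  { intros u v. apply is_derive_scal.
    rewrite <- (Rmult_1_l (psi (u - p v))).
    apply (is_derive_comp Phi (fun z => z - p v)); [apply hd|].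
    auto_derive; [easy|ring]. }
  unfold rconv.
  replace (RInt (fun r => k r * psi (t - p r)) 0 1)
    with (RInt (fun r => Derive (fun u => k r * Phi (u - p r)) t) 0 1).
  2:{ apply RInt_ext. intros r _. apply is_derive_unique, hD. }
  apply (is_derive_RInt_param (fun u r => k r * Phi (u - p r))).
  - apply filter_forall. intros u r _. eexists. apply hD.
  - intros r _. apply continuity_2d_pt_ext with (fun u v => k v * psi (u - p v)).
    { intros u v. symmetry. apply is_derive_unique, hD. }
    apply continuity_2d_pt_filterlim.
    apply (continuous_mult (fun z : R * R => k (snd z)) (fun z : R * R => psi (fst z - p (snd z)))).
    + apply (continuous_comp snd k); [apply continuous_snd|apply k_cont].
    + now apply hlag.
  - apply filter_forall. intros u. apply @ex_RInt_cont. intros r.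
    apply (continuous_mult k); [apply k_cont|].
    apply (continuous_comp (fun r => u - p r) Phi); [|apply hP].
    apply (@continuous_minus _ R_AbsRing R_NormedModule); [apply continuous_const|apply p_cont].
Qed.

End Convolution.

Section RealConvolution.

Variables k p : R -> R.
Hypothesis k_cont : forall r, continuous k r.
Hypothesis p_cont : forall r, continuous p r.
Hypothesis p_nonneg : forall r, 0 <= p r.

Lemma ex_rconv (psi : R -> R) (t a b : R) : (forall s, continuous psi s) ->
  ex_RInt (fun r => k r * psi (t - p r)) a b.
Proof. exact (@ex_conv R_CompleteNormedModule k p k_cont p_cont psi t a b). Qed.

Lemma rconv_abs_le (psi : R -> R) (t M : R) : (forall s, continuous psi s) ->
  (forall s, s <= t -> Rabs (psi s) <= M) ->
  Rabs (rconv k p psi t) <= RInt (fun r => Rabs (k r)) 0 1 * M.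
Proof. exact (@conv_norm_le R_CompleteNormedModule k p k_cont p_cont p_nonneg psi t M). Qed.

Lemma rconv_minus (f g : R -> R) (t : R) :
  (forall s, continuous f s) -> (forall s, continuous g s) ->
  rconv k p (fun s => f s - g s) t = rconv k p f t - rconv k p g t.
Proof. exact (@conv_minus R_CompleteNormedModule k p k_cont p_cont f g t). Qed.

Lemma continuous_rconv (psi : R -> R) (t : R) :
  (forall s, continuous psi s) -> continuous (rconv k p psi) t.
Proof. exact (@continuous_conv R_CompleteNormedModule k p k_cont p_cont p_nonneg psi t). Qed.

End RealConvolution.

Lemma ex_RInt_cont_R (f : R -> R) (a b : R) : (forall t, continuous f t) -> ex_RInt f a b.
Proof. exact (@ex_RInt_cont R_CompleteNormedModule f a b). Qed.

Lemma RInt_correct_R (f : R -> R) (a b : R) : ex_RInt f a b -> is_RInt f a b (RInt f a b).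
Proof. exact (@RInt_correct R_CompleteNormedModule f a b). Qed.

Lemma RInt_Chasles_R (f : R -> R) (a b c : R) : (forall t, continuous f t) ->
  RInt f a b + RInt f b c = RInt f a c.
Proof.
  intros h. apply (@RInt_Chasles R_CompleteNormedModule); now apply ex_RInt_cont_R.
Qed.

Lemma RInt_const_R (a b c : R) : RInt (fun _ => c) a b = (b - a) * c.
Proof. exact (@RInt_const R_CompleteNormedModule a b c). Qed.

(** * The Volterra equation and its energy estimate *)

Lemma sum_1_S {G : AbelianMonoid} (a : nat -> G) (m : nat) :
  sum_n_m a 1 (S m) = plus (sum_n_m a 1 m) (a (S m)).
Proof. apply sum_n_Sm. lia. Qed.

Lemma sum_1_0 {G : AbelianMonoid} (a : nat -> G) : sum_n_m a 1 0 = zero.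
Proof. apply sum_n_m_zero. lia. Qed.

Lemma sum_1_le (a b : nat -> R) (m : nat) :
  (forall j, (1 <= j <= m)%nat -> a j <= b j) -> sum_n_m a 1 m <= sum_n_m b 1 m.
Proof.
  induction m as [|m IH]; intros h.
  - rewrite !sum_1_0. apply Rle_refl.
  - rewrite !sum_1_S. apply Rplus_le_compat.
    + apply IH. intros j hj. apply h. lia.
    + apply h. lia.
Qed.

Lemma inner_sum_1 {H : Hilbert} (a : nat -> H) (m : nat) (v : H) :
  inner (sum_n_m a 1 m) v = sum_n_m (fun j => inner (a j) v) 1 m.
Proof.
  induction m as [|m IH].
  - rewrite !sum_1_0. apply inner_zero.
  - rewrite !sum_1_S, inner_plus, IH. reflexivity.
Qed.

Lemma sum_1_mult_r (a : nat -> R) (m : nat) (c : R) :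
  sum_n_m (fun j => a j * c) 1 m = sum_n_m a 1 m * c.
Proof.
  induction m as [|m IH].
  - rewrite !sum_1_0. unfold zero; simpl. ring.
  - rewrite !sum_1_S, IH. unfold plus; simpl. ring.
Qed.

Lemma sum_1_minus (a b : nat -> R) (m : nat) :
  sum_n_m (fun j => a j - b j) 1 m = sum_n_m a 1 m - sum_n_m b 1 m.
Proof.
  induction m as [|m IH].
  - rewrite !sum_1_0. unfold zero; simpl. ring.
  - rewrite !sum_1_S, IH. unfold plus; simpl. ring.
Qed.

Lemma continuous_sum_1 {T : UniformSpace} {V : NormedModule R_AbsRing}
    (f : nat -> T -> V) (m : nat) (x : T) :
  (forall j, (1 <= j <= m)%nat -> continuous (f j) x) ->
  continuous (fun t => sum_n_m (fun j => f j t) 1 m) x.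
Proof.
  induction m as [|m IH]; intros h.
  - apply continuous_ext with (fun _ => zero).
    + intros t. now rewrite sum_1_0.
    + apply continuous_const.
  - apply continuous_ext with (fun t => plus (sum_n_m (fun j => f j t) 1 m) (f (S m) t)).
    + intros t. now rewrite sum_1_S.
    + apply (@continuous_plus _ R_AbsRing V).
      * apply IH. intros j hj. apply h. lia.
      * apply h. lia.
Qed.

Lemma is_derive_sum_1 {V : NormedModule R_AbsRing} (f : nat -> R -> V) (df : nat -> V)
    (m : nat) (x : R) :
  (forall j, (1 <= j <= m)%nat -> is_derive (f j) x (df j)) ->
  is_derive (fun t => sum_n_m (fun j => f j t) 1 m) x (sum_n_m df 1 m).
Proof.
  induction m as [|m IH]; intros h.
  - rewrite sum_1_0. apply is_derive_ext with (fun _ => zero).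
    + intros t. now rewrite sum_1_0.
    + apply is_derive_const.
  - rewrite sum_1_S.
    apply is_derive_ext with (fun t => plus (sum_n_m (fun j => f j t) 1 m) (f (S m) t)).
    + intros t. now rewrite sum_1_S.
    + apply (@is_derive_plus R_AbsRing V).
      * apply IH. intros j hj. apply h. lia.
      * apply h. lia.
Qed.

Lemma sum_1_minus_H {H : Hilbert} (a b : nat -> H) (m : nat) :
  sum_n_m (fun j => minus (a j) (b j)) 1 m = minus (sum_n_m a 1 m) (sum_n_m b 1 m).
Proof.
  apply inner_ext. intros v.
  etransitivity; [apply inner_sum_1|].
  rewrite inner_minus, !inner_sum_1, <- sum_1_minus.
  apply sum_n_m_ext. intros j. apply inner_minus.
Qed.

Lemma is_RInt_sum_1 (f : nat -> R -> R) (l : nat -> R) (a b : R) (m : nat) :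
  (forall j, (1 <= j <= m)%nat -> is_RInt (f j) a b (l j)) ->
  is_RInt (fun t => sum_n_m (fun j => f j t) 1 m) a b (sum_n_m l 1 m).
Proof.
  induction m as [|m IH]; intros h.
  - rewrite sum_1_0. apply is_RInt_ext with (fun _ => 0).
    + intros t _. now rewrite sum_1_0.
    + replace (zero : R) with (scal (b - a) 0) by (unfold scal, zero; simpl; unfold mult; simpl; ring).
      apply (@is_RInt_const R_NormedModule).
  - rewrite sum_1_S.
    apply is_RInt_ext with (fun t => plus (sum_n_m (fun j => f j t) 1 m) (f (S m) t)).
    + intros t _. now rewrite sum_1_S.
    + apply (@is_RInt_plus R_NormedModule).
      * apply IH. intros j hj. apply h. lia.
      * apply h. lia.
Qed.

(** Closes the contraction arguments below, in which an a priori bound [M] is halved at each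
    step. *)
Lemma le_of_geometric (x a M : R) :
  (forall n : nat, x <= a + M * (1 / 2) ^ n) -> x <= a.
Proof.
  intros h.
  assert (l : is_lim_seq (fun n => a + M * (1 / 2) ^ n) (a + M * 0)).
  { apply is_lim_seq_plus'; [apply is_lim_seq_const|].
    apply is_lim_seq_mult'; [apply is_lim_seq_const|].
    apply is_lim_seq_geom. rewrite Rabs_pos_eq; lra. }
  apply (is_lim_seq_le (fun _ => x) _ (Finite x) (Finite (a + M * 0))) in l; auto.
  - simpl in l. lra.
  - apply is_lim_seq_const.
Qed.

(** [S] plays the inverse of [A], and [Q j] the product of [B j] and [S]. [Q_form] is domination
    with both exponents equal to [1], since [inner x (S x)] is the square of [||S x||_1]. [small]
    bounds [volterra] by [1 / 2] in two senses: in the supremum norm through [Q_norm], and as a form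
    relative to [inner x (S x)] through [Q_form]. *)
Section VolterraOperator.

Context {H : Hilbert}.
Variable S : H -> H.
Variable m : nat.
Variable Q : nat -> H -> H.
Variables k p : nat -> R -> R.
Variable c : nat -> R.
Hypothesis S_linear : is_linear S.
Hypothesis S_sym : forall x y, inner (S x) y = inner x (S y).
Hypothesis S_pos : forall x, 0 <= inner x (S x).
Hypothesis k_cont : forall j, (1 <= j <= m)%nat -> forall r, continuous (k j) r.
Hypothesis p_cont : forall j, (1 <= j <= m)%nat -> forall r, continuous (p j) r.
Hypothesis p_nonneg : forall j, (1 <= j <= m)%nat -> forall r, 0 <= p j r.
Hypothesis c_nonneg : forall j, (1 <= j <= m)%nat -> 0 <= c j.
Hypothesis Q_linear : forall j, (1 <= j <= m)%nat -> is_linear (Q j).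
Hypothesis Q_norm : forall j, (1 <= j <= m)%nat -> forall x, norm (Q j x) <= c j * norm x.
Hypothesis Q_sym : forall j, (1 <= j <= m)%nat ->
  forall x y, inner (Q j x) (S y) = inner (S x) (Q j y).
Hypothesis Q_form : forall j, (1 <= j <= m)%nat -> forall x y,
  Rabs (inner (Q j x) (S y)) <= c j * sqrt (inner x (S x)) * sqrt (inner y (S y)).
Hypothesis small :
  sum_n_m (fun j => c j * RInt (fun r => Rabs (k j r)) 0 1) 1 m <= 1 / 2.

Definition volterra (psi : R -> H) (t : R) : H :=
  sum_n_m (fun j => conv (k j) (p j) (fun s => Q j (psi s)) t) 1 m.

Lemma continuous_is_linear {T : UniformSpace} (L : H -> H) (f : T -> H) (x : T) :
  is_linear L -> continuous f x -> continuous (fun t => L (f t)) x.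
Proof.
  intros hL hf. apply (continuous_comp f L x hf).
  now apply (@linear_cont R_AbsRing H H).
Qed.

Lemma is_linear_minus (L : H -> H) x y : is_linear L -> L (minus x y) = minus (L x) (L y).
Proof.
  intros [hp hs _]. unfold minus. rewrite hp. f_equal.
  rewrite <- (@scal_opp_one R_Ring H), hs. apply (@scal_opp_one R_Ring H).
Qed.

Lemma continuous_volterra (psi : R -> H) (t : R) :
  (forall s, continuous psi s) -> continuous (volterra psi) t.
Proof.
  intros h. apply @continuous_sum_1. intros j hj.
  apply continuous_conv; auto. intros s. apply continuous_is_linear; auto.
Qed.

Lemma volterra_minus (f g : R -> H) (t : R) :
  (forall s, continuous f s) -> (forall s, continuous g s) ->
  volterra (fun s => minus (f s) (g s)) t = minus (volterra f t) (volterra g t).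
Proof.
  intros hf hg. unfold volterra. rewrite <- sum_1_minus_H.
  apply sum_n_m_ext_loc. intros j hj.
  etransitivity.
  2: apply conv_minus; auto; intros s; apply continuous_is_linear; auto.
  apply RInt_ext. intros r _. now rewrite is_linear_minus by auto.
Qed.

(** Causality: only the past of [t] enters, so that all estimates can be restricted to times up to
    [T]. *)
Lemma volterra_norm_le (psi : R -> H) (t M : R) :
  (forall s, continuous psi s) -> (forall s, s <= t -> norm (psi s) <= M) ->
  norm (volterra psi t) <= 1 / 2 * M.
Proof.
  intros hc h.
  assert (hM : 0 <= M).
  { eapply Rle_trans; [apply (hnorm_ge_0 (psi t))|]. apply h, Rle_refl. }
  eapply Rle_trans; [apply (@norm_sum_n_m R_AbsRing H)|].
  apply Rle_trans with (sum_n_m (fun j => c j * RInt (fun r => Rabs (k j r)) 0 1 * M) 1 m).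
  2: rewrite sum_1_mult_r; now apply Rmult_le_compat_r.
  apply sum_1_le. intros j hj.
  replace (c j * RInt (fun r => Rabs (k j r)) 0 1 * M)
    with (RInt (fun r => Rabs (k j r)) 0 1 * (c j * M)) by ring.
  apply (@conv_norm_le H); auto.
  - intros s. apply continuous_is_linear; auto.
  - intros s hs. eapply Rle_trans; [now apply Q_norm|].
    apply Rmult_le_compat_l; auto.
Qed.

(** By [Q_sym] the right side depends on [psi] only through [S psi]. With [U] in place of [S psi] it
    keeps a meaning even when [U] is not known to lie in the range of [S]. *)
Lemma inner_volterra (psi : R -> H) (t : R) (v : H) : (forall s, continuous psi s) ->
  inner (volterra psi t) (S v) =
  sum_n_m (fun j => rconv (k j) (p j)
    (fun s => inner (S (psi s)) (Q j v)) t) 1 m.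
Proof.
  intros hc. unfold volterra. rewrite inner_sum_1.
  apply sum_n_m_ext_loc. intros j hj. unfold conv.
  rewrite <- RInt_inner.
  - apply RInt_ext. intros r _. now rewrite inner_scal, Q_sym.
  - apply (@ex_conv H (k j) (p j) (k_cont j hj) (p_cont j hj) (fun s => Q j (psi s))).
    intros s. apply continuous_is_linear; auto.
Qed.

(** Picard iteration from [zero] for the contraction that sends [phi] to [G - volterra phi].
    Consecutive iterates differ by at most [M / 2 ^ n] on the whole line, so no weight in time is
    needed. *)
Lemma volterra_fixpoint (G : R -> H) (M : R) :
  (forall t, continuous G t) -> (forall t, norm (G t) <= M) ->
  exists phi : R -> H, (forall t, continuous phi t) /\
    (forall t, norm (phi t) <= 2 * M) /\
    (forall t, phi t = minus (G t) (volterra phi t)).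
Proof.
  intros hG hM.
  set (it := fix it n := match n with
    | O => fun _ => zero
    | Datatypes.S n => fun t => minus (G t) (volterra (it n) t) end : R -> H).
  assert (ic : forall n t, continuous (it n) t).
  { induction n as [|n IH]; intros t; simpl.
    - apply (@continuous_const R_UniformSpace H).
    - apply (@continuous_minus _ R_AbsRing H); auto. apply continuous_volterra, IH. }
  assert (istep : forall n t, norm (minus (it (Datatypes.S n) t) (it n t)) <= M * (1 / 2) ^ n).
  { induction n as [|n IH]; intros t.
    - replace (minus (it 1%nat t) (it O t)) with (minus (G t) (volterra (it O) t))
        by (simpl; vector_ring).
      assert (z : norm (volterra (it O) t) <= 1 / 2 * 0).
      { apply volterra_norm_le; auto. intros s _. simpl. rewrite hnorm_zero. lra. }
      eapply Rle_trans; [apply hnorm_minus_le|]. specialize (hM t). rewrite pow_O. lra.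
    - change (it (Datatypes.S (Datatypes.S n)) t)
        with (minus (G t) (volterra (it (Datatypes.S n)) t)).
      change (it (Datatypes.S n) t) with (minus (G t) (volterra (it n) t)).
      replace (minus (minus (G t) (volterra (it (Datatypes.S n)) t))
                 (minus (G t) (volterra (it n) t)))
        with (opp (minus (volterra (it (Datatypes.S n)) t) (volterra (it n) t)))
        by vector_ring.
      rewrite hnorm_opp, <- volterra_minus by auto.
      replace (M * (1 / 2) ^ Datatypes.S n) with (1 / 2 * (M * (1 / 2) ^ n)) by (simpl; ring).
      apply volterra_norm_le.
      + intros s. apply (@continuous_minus _ R_AbsRing H); auto.
      + intros s _. apply IH. }
  assert (M0 : 0 <= M) by (eapply Rle_trans; [apply (hnorm_ge_0 (G 0))|apply hM]).
  (* The right side is the exact partial sum of the geometric series with [d] terms; keeping the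
     factor [1 - (1 / 2) ^ d] is what lets the induction on [d] close. *)
  assert (iclose : forall d n t, norm (minus (it (n + d)%nat t) (it n t)) <= 2 * M * (1 / 2) ^ n * (1 - (1 / 2) ^ d)).
  { induction d as [|d IH]; intros n t.
    - rewrite Nat.add_0_r. replace (minus (it n t) (it n t)) with (zero : H) by vector_ring.
      rewrite hnorm_zero. simpl. lra.
    - rewrite Nat.add_succ_r.
      replace (minus (it (Datatypes.S (n + d)) t) (it n t))
        with (plus (minus (it (Datatypes.S (n + d)) t) (it (n + d)%nat t))
                (minus (it (n + d)%nat t) (it n t))) by vector_ring.
      eapply Rle_trans; [apply hnorm_triangle|].
      eapply Rle_trans; [exact (Rplus_le_compat _ _ _ _ (istep (n + d)%nat t) (IH n t))|].
      rewrite pow_add, <- tech_pow_Rmult. lra. }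
  assert (hcl : forall n d t, norm (minus (it (n + d)%nat t) (it n t)) <= 2 * M * (1 / 2) ^ n).
  { intros n d t. eapply Rle_trans; [apply iclose|].
    assert (0 <= (1 / 2) ^ d) by (apply pow_le; lra).
    assert (0 <= 2 * M * (1 / 2) ^ n) by (apply Rmult_le_pos; [lra|apply pow_le; lra]).
    nra. }
  assert (hsmall : forall (C eps : R), 0 < eps -> exists n : nat, C * (1 / 2) ^ n < eps).
  { intros C eps he.
    assert (l : is_lim_seq (fun n => C * (1 / 2) ^ n) (C * 0)).
    { apply is_lim_seq_mult'; [apply is_lim_seq_const|].
      apply is_lim_seq_geom. rewrite Rabs_pos_eq; lra. }
    rewrite Rmult_0_r in l.
    destruct (l (fun x => x < eps)) as [N hN].
    - exists (mkposreal eps he). intros y hy.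
      change (Rabs (y - 0) < eps) in hy. apply Rabs_def2 in hy. lra.
    - exists N. now apply hN. }
  assert (hlim : forall t, exists y : H, forall n, norm (minus y (it n t)) <= 2 * M * (1 / 2) ^ n).
  { intros t.
    destruct (proj1 (filterlim_locally_cauchy (U := H) (F := eventually) (fun n => it n t)))
      as [y hy].
    - intros eps. destruct (hsmall (4 * M) eps (cond_pos eps)) as [N hN].
      exists (fun n => (N <= n)%nat). split; [now exists N|].
      intros a b ha hb. apply hnorm_compat1.
      replace a with (N + (a - N))%nat by lia. replace b with (N + (b - N))%nat by lia.
      match goal with |- norm (minus ?u ?v) < _ =>
        apply Rle_lt_trans with (norm (minus (minus u (it N t)) (minus v (it N t)))) end.
      { apply Req_le, (f_equal (@norm R_AbsRing H)). vector_ring. }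
      eapply Rle_lt_trans; [apply hnorm_minus_le|].
      pose proof (hcl N (a - N)%nat t) as h1. pose proof (hcl N (b - N)%nat t) as h2.
      eapply Rle_lt_trans; [apply Rplus_le_compat; [exact h2|exact h1]|]. lra.
    - exists y. intros n. apply le_epsilon. intros eps he.
      destruct (hy _ (hlocally_norm_minus y eps he)) as [N hN].
      specialize (hN (n + N)%nat ltac:(lia)).
      replace (minus y (it n t)) with (minus (minus (it (n + N)%nat t) (it n t)) (minus (it (n + N)%nat t) y)) by vector_ring.
      eapply Rle_trans; [apply hnorm_minus_le|].
      apply Rplus_le_compat; [apply hcl|exact (Rlt_le _ _ hN)]. }
  (* The pointwise limits are selected by choice. By [hphi] the convergence is uniform in [t], and
     continuity follows by the usual splitting into three terms. *)
  set (phi := fun t => proj1_sig (constructive_indefinite_description _ (hlim t))).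
  assert (hphi : forall t n, norm (minus (phi t) (it n t)) <= 2 * M * (1 / 2) ^ n).
  { intros t. exact (proj2_sig (constructive_indefinite_description _ (hlim t))). }
  assert (hpc : forall t, continuous phi t).
  { intros t. apply (hcontinuous_of_norm_minus phi t). intros eps he.
    destruct (hsmall (2 * M) (eps / 3) ltac:(lra)) as [n hn].
    generalize (hcontinuous_norm_minus (it n) t (eps / 3) (ic n t) ltac:(lra)).
    apply filter_imp. intros y hy.
    match goal with |- norm ?z <= _ => apply Rle_trans with (norm (plus (minus (phi y) (it n y))
      (minus (minus (it n y) (it n t)) (minus (phi t) (it n t))))) end.
    { apply Req_le, (f_equal (@norm R_AbsRing H)). vector_ring. }
    eapply Rle_trans; [apply hnorm_triangle|].
    eapply Rle_trans; [apply Rplus_le_compat_l, hnorm_minus_le|].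
    pose proof (hphi y n). pose proof (hphi t n).
    apply Rlt_le in hy.
    replace eps with (eps / 3 + (eps / 3 + eps / 3)) by lra.
    repeat apply Rplus_le_compat; [lra|exact hy|lra]. }
  exists phi. split; [exact hpc|]. split.
  - intros t. eapply Rle_trans; [apply (hnorm_sub (phi t) (it O t))|].
    eapply Rle_trans; [apply Rplus_le_compat_r, hphi|].
    change (it O t) with (zero : H). rewrite hnorm_zero, pow_O. lra.
  - intros t.
    assert (e : norm (minus (phi t) (minus (G t) (volterra phi t))) <= 0).
    { apply le_of_geometric with (3 * M). intros n.
      replace (minus (phi t) (minus (G t) (volterra phi t)))
        with (plus (minus (phi t) (it (Datatypes.S n) t)) (minus (volterra phi t) (volterra (it n) t)))
        by (simpl; vector_ring).
      eapply Rle_trans; [apply hnorm_triangle|].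
      rewrite <- volterra_minus by auto.
      assert (q : norm (volterra (fun s => minus (phi s) (it n s)) t) <= 1 / 2 * (2 * M * (1 / 2) ^ n)).
      { apply volterra_norm_le.
        - intros s. apply (@continuous_minus _ R_AbsRing H); auto.
        - intros s _. apply hphi. }
      specialize (hphi t (Datatypes.S n)). simpl pow in hphi.
      assert (0 <= M * (1 / 2) ^ n) by (apply Rmult_le_pos; [lra|apply pow_le; lra]).
      lra. }
    assert (z : minus (phi t) (minus (G t) (volterra phi t)) = zero).
    { apply (@norm_eq_zero R_AbsRing H). apply Rle_antisym; [exact e|apply hnorm_ge_0]. }
    exact (eq_of_minus_zero _ _ z).
Qed.

(** The crude bound [M] only starts an iteration: writing [psi] as
    [(psi + volterra psi) - volterra psi] halves its share at every step, and [2 * N] is the fixed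
    point of [x = N + x / 2]. *)
Lemma volterra_stable (psi : R -> H) (T N M : R) :
  (forall t, continuous psi t) -> (forall t, t <= T -> norm (psi t) <= M) ->
  (forall t, t <= T -> norm (plus (psi t) (volterra psi t)) <= N) ->
  forall t, t <= T -> norm (psi t) <= 2 * N.
Proof.
  intros hc hM hN.
  assert (step : forall n t, t <= T -> norm (psi t) <= 2 * N + M * (1 / 2) ^ n).
  { assert (N0 : 0 <= N).
    { exact (Rle_trans _ _ _ (hnorm_ge_0 _) (hN T (Rle_refl T))). }
    induction n as [|n IH]; intros t ht.
    - rewrite pow_O. specialize (hM t ht). lra.
    - replace (psi t) with (minus (plus (psi t) (volterra psi t)) (volterra psi t))
        by vector_ring.
      eapply Rle_trans; [apply hnorm_minus_le|].
      eapply Rle_trans; [apply Rplus_le_compat; [now apply hN|]|].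
      + apply volterra_norm_le with (M := 2 * N + M * (1 / 2) ^ n); auto.
        intros s hs. apply IH. lra.
      + rewrite <- tech_pow_Rmult. lra. }
  intros t ht. apply le_of_geometric with M. auto.
Qed.

(** Formally [X] solves the homogeneous equation with the adjoints of the [Q j]. These have the same
    norm bounds, so the same halving applies; testing against [v] spares their construction. *)
Lemma weak_volterra_unique (X : R -> H) (T M : R) :
  (forall t, continuous X t) -> (forall t, t <= T -> norm (X t) <= M) ->
  (forall t v, t <= T -> inner (X t) v +
     sum_n_m (fun j => rconv (k j) (p j)
       (fun s => inner (X s) (Q j v)) t) 1 m = 0) ->
  forall t, t <= T -> X t = zero.
Proof.
  intros hc hM hX.
  assert (step : forall n t, t <= T -> norm (X t) <= M * (1 / 2) ^ n).
  { induction n as [|n IH]; intros t ht.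
    - rewrite pow_O, Rmult_1_r. auto.
    - assert (M0 : 0 <= M * (1 / 2) ^ n).
      { exact (Rle_trans _ _ _ (hnorm_ge_0 _) (IH T (Rle_refl T))). }
      rewrite <- tech_pow_Rmult.
      apply norm_le_of_inner; [lra|]. intros v.
      specialize (hX t v ht).
      set (b := fun j => rconv (k j) (p j)
        (fun s => inner (X s) (Q j v)) t) in hX.
      assert (hb : Rabs (sum_n_m b 1 m) <= sum_n_m (fun j => Rabs (b j)) 1 m)
        by exact (@norm_sum_n_m R_AbsRing R_NormedModule b 1 m).
      assert (hb2 : sum_n_m (fun j => Rabs (b j)) 1 m <=
        sum_n_m (fun j => c j * RInt (fun r => Rabs (k j r)) 0 1 *
          (M * (1 / 2) ^ n * norm v)) 1 m).
      { apply sum_1_le. intros j hj.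
        replace (c j * RInt (fun r => Rabs (k j r)) 0 1 * (M * (1 / 2) ^ n * norm v))
          with (RInt (fun r => Rabs (k j r)) 0 1 * (M * (1 / 2) ^ n * (c j * norm v))) by ring.
        refine (rconv_abs_le (k j) (p j) (k_cont j hj) (p_cont j hj) (p_nonneg j hj)
          (fun s => inner (X s) (Q j v)) t (M * (1 / 2) ^ n * (c j * norm v)) _ _).
        - intros s. apply (continuous_inner X (fun _ => Q j v)); [apply hc|].
          apply continuous_const.
        - intros s hs. eapply Rle_trans; [apply cauchy_schwarz|].
          apply Rmult_le_compat; [apply hnorm_ge_0|apply hnorm_ge_0| |now apply Q_norm].
          apply IH. lra. }
      rewrite sum_1_mult_r in hb2.
      assert (hv : 0 <= M * (1 / 2) ^ n * norm v) by (apply Rmult_le_pos; auto using hnorm_ge_0).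
      assert (hs := Rmult_le_compat_r _ _ _ hv small).
      pose proof (Rle_abs (- sum_n_m b 1 m)) as hab. rewrite Rabs_Ropp in hab. lra. }
  intros t ht. apply (@norm_eq_zero R_AbsRing H). apply Rle_antisym; [|apply hnorm_ge_0].
  apply le_of_geometric with M. intros n. specialize (step n t ht). rewrite Rplus_0_l. exact step.
Qed.

(** * Form bound of the memory operator and the energy estimate *)

Lemma conv_form (psi : R -> H) (j : nat) (t : R) : (1 <= j <= m)%nat ->
  (forall s, continuous psi s) -> (forall s, s <= 0 -> S (psi s) = zero) -> 0 <= t ->
  - (c j * RInt (fun r => Rabs (k j r)) 0 1 * RInt (fun s => inner (psi s) (S (psi s))) 0 t)
  <= RInt (fun s => inner (conv (k j) (p j) (fun s => Q j (psi s)) s) (S (psi s))) 0 t.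
Proof.
  intros hj hc h0 ht.
  set (a := fun s => inner (psi s) (S (psi s))).
  (* No exchange of the integrals over [s] and [r] is made: the convolution of the primitive [A] is
     a primitive of the convolution of [a]. *)
  set (A := fun u => RInt a 0 u).
  set (n := RInt (fun r => Rabs (k j r)) 0 1).
  set (ka := fun r => Rabs (k j r)).
  assert (cSpsi : forall s, continuous (fun s => S (psi s)) s)
    by (intros s; now apply continuous_is_linear).
  assert (ca : forall s, continuous a s) by (intros s; apply continuous_inner; auto).
  assert (cka : forall r, continuous ka r).
  { intros r. exact (continuous_comp (k j) (fun y => norm y) r (k_cont j hj r)
      (@filterlim_norm R_AbsRing R_NormedModule (k j r))). }
  assert (hn : 0 <= n) by (apply kernel_mass_nonneg; auto).
  assert (dA : forall s, is_derive A s (a s)).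
  { intros s. apply (is_derive_RInt a A 0 s); [|apply ca].
    apply filter_forall. intros u. apply RInt_correct_R.
    now apply ex_RInt_cont_R. }
  assert (a_pos : forall s, 0 <= a s) by (intros s; apply S_pos).
  assert (hA0 : forall u, u <= 0 -> A u = 0).
  { intros u hu. unfold A. rewrite <- (@opp_RInt_swap R_CompleteNormedModule).
    2: now apply ex_RInt_cont_R.
    rewrite (RInt_ext a (fun _ => 0)).
    - rewrite RInt_const_R. unfold opp; simpl. ring.
    - intros s hs. rewrite Rmin_left, Rmax_right in hs by lra.
      unfold a. rewrite h0 by lra. apply inner_zero_r. }
  assert (hAmono : forall u, u <= t -> 0 <= A u <= A t).
  { assert (mono : forall u v, 0 <= u -> u <= v -> A u <= A v).
    { intros u v hu huv. unfold A.
      rewrite <- (@RInt_Chasles R_CompleteNormedModule a 0 u v);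
        try now apply ex_RInt_cont_R.
      assert (0 <= RInt a u v).
      { apply RInt_ge_0; auto. now apply ex_RInt_cont_R. }
      unfold plus; simpl. lra. }
    intros u hu. destruct (Rle_or_lt u 0) as [l|l].
    - pose proof (mono 0 t ltac:(lra) ht) as h. rewrite (hA0 0) in h by lra.
      rewrite (hA0 u l). lra.
    - pose proof (mono 0 u ltac:(lra) ltac:(lra)) as h. rewrite (hA0 0) in h by lra.
      split; [exact h|apply mono; lra]. }
  (* [b] is the lower bound of the integrand that comes from [Q_form] and [2 x y <= x ^ 2 + y ^ 2],
     where [x ^ 2] is [a] at the delayed time and [y ^ 2] is [a s]. [B] is a primitive of it. *)
  set (B := fun s => - (c j / 2) * (rconv ka (p j) A s + n * A s)).
  set (b := fun s => - (c j / 2) * (rconv ka (p j) a s + n * a s)).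
  assert (dB : forall s, is_derive B s (b s)).
  { intros s. apply is_derive_scal. apply (@is_derive_plus R_AbsRing R_NormedModule).
    - apply is_derive_rconv; auto.
    - apply is_derive_scal, dA. }
  assert (cb : forall s, continuous b s).
  { intros s. apply (continuous_mult (fun _ => - (c j / 2))); [apply continuous_const|].
    apply (@continuous_plus _ R_AbsRing R_NormedModule).
    - apply continuous_rconv; auto.
    - apply (continuous_mult (fun _ => n)); [apply continuous_const|apply ca]. }
  apply Rle_trans with (RInt b 0 t).
  - rewrite (is_RInt_unique b 0 t _ (is_RInt_derive B b 0 t (fun s _ => dB s) (fun s _ => cb s))).
    assert (z : rconv ka (p j) A 0 = 0).
    { unfold rconv. rewrite (RInt_ext _ (fun _ => 0)).
      - rewrite RInt_const_R. ring.
      - intros r _. rewrite hA0.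
        + apply Rmult_0_r.
        + specialize (p_nonneg j hj r). lra. }
    unfold B, minus, plus, opp; simpl. rewrite z, (hA0 0) by lra.
    (* [A] is nondecreasing and vanishes in the past, so a delay only lowers it: the delayed half of
       [b] costs no more than the other half. *)
    assert (h : Rabs (rconv ka (p j) A t)
                <= RInt (fun r => Rabs (ka r)) 0 1 * A t).
    { refine (rconv_abs_le ka (p j) cka (p_cont j hj) (p_nonneg j hj) A t (A t) _ _).
      - intros s. exact (continuous_of_is_derive _ _ _ (dA s)).
      - intros s hs. rewrite Rabs_pos_eq; now apply hAmono. }
    replace (RInt (fun r => Rabs (ka r)) 0 1) with n in h.
    2:{ apply RInt_ext. intros r _. unfold ka. now rewrite Rabs_Rabsolu. }
    pose proof (Rle_abs (rconv ka (p j) A t)).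
    pose proof (c_nonneg j hj). fold (A t). nra.
  - apply RInt_le; [exact ht| | |].
    + now apply ex_RInt_cont_R.
    + apply ex_RInt_cont_R. intros s. apply continuous_inner; auto.
      apply (@continuous_conv H); auto. intros u. apply continuous_is_linear; auto.
    + intros s _. unfold conv at 1. rewrite <- RInt_inner.
      2:{ apply (@ex_conv H (k j) (p j) (k_cont j hj) (p_cont j hj) (fun s => Q j (psi s))).
          intros u. apply continuous_is_linear; auto. }
      assert (e : is_RInt (fun r => - (c j / 2) * (ka r * a (s - p j r) + a s * ka r)) 0 1 (b s)).
      { unfold b. apply (@is_RInt_scal R_NormedModule). apply (@is_RInt_plus R_NormedModule).
        - apply RInt_correct_R, (ex_rconv ka (p j)); auto.
        - rewrite Rmult_comm. apply (@is_RInt_scal R_NormedModule).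
          apply RInt_correct_R. apply ex_RInt_abs_kernel; auto. }
      rewrite <- (is_RInt_unique _ _ _ _ e).
      apply RInt_le; [lra|now exists (b s)| |].
      * apply ex_RInt_inner, (@ex_conv H (k j) (p j) (k_cont j hj) (p_cont j hj) (fun s => Q j (psi s))).
        intros u. apply continuous_is_linear; auto.
      * intros r _. rewrite inner_scal.
        pose proof (Q_form j hj (psi (s - p j r)) (psi s)) as q.
        fold (a (s - p j r)) in q. fold (a s) in q.
        pose proof (a_pos (s - p j r)) as q1. pose proof (a_pos s) as q2.
        pose proof (sqrt_sqrt _ q1) as r1. pose proof (sqrt_sqrt _ q2) as r2.
        set (x := sqrt (a (s - p j r))) in *. set (y := sqrt (a s)) in *.
        set (w := inner (Q j (psi (s - p j r))) (S (psi s))) in *.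
        pose proof (Rle_abs (- (k j r * w))) as q3.
        rewrite Rabs_Ropp, Rabs_mult in q3. fold (ka r) in q3.
        assert (q4 : 0 <= ka r) by apply Rabs_pos.
        assert (q5 : c j * x * y <= c j / 2 * (x * x + y * y)).
        { pose proof (c_nonneg j hj). assert (0 <= (x - y) * (x - y)) by apply Rle_0_sqr. nra. }
        assert (q6 : ka r * Rabs w <= ka r * (c j / 2 * (x * x + y * y))).
        { apply Rmult_le_compat_l; [exact q4|lra]. }
        rewrite <- r1, <- r2. lra.
Qed.

Lemma volterra_form (psi : R -> H) (t : R) :
  (forall s, continuous psi s) -> (forall s, s <= 0 -> S (psi s) = zero) -> 0 <= t ->
  - (1 / 2 * RInt (fun s => inner (psi s) (S (psi s))) 0 t)
  <= RInt (fun s => inner (volterra psi s) (S (psi s))) 0 t.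
Proof.
  intros hc h0 ht.
  set (I := RInt (fun s => inner (psi s) (S (psi s))) 0 t).
  assert (hI : 0 <= I).
  { apply RInt_ge_0; auto. apply ex_RInt_cont_R. intros s.
    apply continuous_inner; auto. now apply continuous_is_linear. }
  assert (e : is_RInt (fun s => inner (volterra psi s) (S (psi s))) 0 t
    (sum_n_m (fun j => RInt (fun s => inner (conv (k j) (p j) (fun s => Q j (psi s)) s)
      (S (psi s))) 0 t) 1 m)).
  { apply is_RInt_ext with (fun s => sum_n_m (fun j =>
      inner (conv (k j) (p j) (fun s => Q j (psi s)) s) (S (psi s))) 1 m).
    - intros s _. symmetry. apply inner_sum_1.
    - apply is_RInt_sum_1. intros j hj. apply RInt_correct_R.
      apply ex_RInt_cont_R. intros s. apply continuous_inner.
      + apply (@continuous_conv H); auto. intros u. apply continuous_is_linear; auto.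
      + apply continuous_is_linear; auto. }
  rewrite (is_RInt_unique _ _ _ _ e).
  apply Rle_trans with (sum_n_m (fun j => c j * RInt (fun r => Rabs (k j r)) 0 1 * (- I)) 1 m).
  - rewrite sum_1_mult_r. pose proof (Rmult_le_compat_r _ _ _ hI small). lra.
  - apply sum_1_le. intros j hj. rewrite Ropp_mult_distr_r_reverse. now apply conv_form.
Qed.

(* Pair the equation with [D]: the memory term absorbs at most half of the
   coercive term [inner phi (S phi)]. *)
Lemma energy_estimate (T lam I : R) (phi D D1 F : R -> H) (rho : R -> R) :
  0 <= lam -> 0 <= T ->
  (forall s, continuous phi s) -> (forall s, continuous D1 s) -> (forall s, continuous F s) ->
  (forall s, continuous rho s) -> (forall s, is_derive D s (D1 s)) ->
  (forall s, s <= 0 -> D s = zero) -> (forall s, s <= T -> S (phi s) = D s) ->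
  (forall s, 0 <= s <= T ->
     plus (plus (plus (D1 s) (scal lam (D s))) (phi s)) (volterra phi s) = F s) ->
  (forall s, 0 <= s <= T -> norm (F s) <= rho s) -> RInt rho 0 T <= I ->
  forall s, s <= T -> norm (D s) <= 2 * I.
Proof.
  intros hlam hT cphi cD1 cF crho dD hD0 hS heq hrho hI.
  assert (cD : forall s, continuous D s)
    by (intros s; exact (continuous_of_is_derive _ _ _ (dD s))).
  assert (cN : forall s, continuous (fun s => norm (D s)) s).
  { intros s. exact (continuous_comp D (fun y : H => norm y) s (cD s)
      (@filterlim_norm R_AbsRing H (D s))). }
  (* The energy identity is integrated up to a time [x] at which [norm (D s)] is maximal. There it
     yields [M ^ 2 <= 2 * M * I], and one power of [M] cancels. *)
  destruct (continuity_ab_maj (fun s => norm (D s)) 0 T hT) as [x [hmax hx]].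
  { intros s _. apply continuity_pt_filterlim, cN. }
  set (M := norm (D x)) in *.
  assert (hM : 0 <= M) by apply hnorm_ge_0.
  assert (exrho : forall u v, ex_RInt rho u v) by (intros; now apply ex_RInt_cont_R).
  assert (rho_pos : forall s, 0 <= s <= T -> 0 <= rho s).
  { intros s hs. exact (Rle_trans _ _ _ (hnorm_ge_0 _) (hrho s hs)). }
  assert (I1 : 0 <= RInt rho 0 x <= I).
  { split.
    - apply RInt_ge_0; try tauto; auto. intros s hs. apply rho_pos. lra.
    - eapply Rle_trans; [|exact hI].
      rewrite <- (@RInt_Chasles R_CompleteNormedModule rho 0 x T) by auto.
      assert (0 <= RInt rho x T).
      { apply RInt_ge_0; try tauto; auto. intros s hs. apply rho_pos. lra. }
      unfold plus; simpl. lra. }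
  assert (bound : M <= 2 * I).
  { set (a := fun s => inner (phi s) (S (phi s))).
    assert (cS : forall s, continuous (fun s => S (phi s)) s)
      by (intros s; now apply continuous_is_linear).
    assert (ca : forall s, continuous a s) by (intros s; now apply continuous_inner).
    assert (cV : forall s, continuous (fun s => inner (volterra phi s) (S (phi s))) s).
    { intros s. apply continuous_inner; auto. now apply continuous_volterra. }
    assert (e := is_RInt_derive (V := R_CompleteNormedModule)
      (fun s => inner (D s) (D s)) (fun s => inner (D1 s) (D s) + inner (D s) (D1 s)) 0 x
      (fun s _ => is_derive_inner D D s _ _ (dD s) (dD s))).
    specialize (e ltac:(intros s _; apply (@continuous_plus _ R_AbsRing R_NormedModule);
      apply continuous_inner; auto)).
    (* This integrand bounds the derivative of [inner (D s) (D s)]: insert the equation for [D1],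
       drop the term in [lam], which has the favourable sign, and bound [norm (D s)] by [M]. *)
    assert (e2 : is_RInt (fun s => 2 * (M * rho s - (a s + inner (volterra phi s) (S (phi s))))) 0 x
      (2 * (M * RInt rho 0 x - (RInt a 0 x + RInt (fun s => inner (volterra phi s) (S (phi s))) 0 x)))).
    { apply (@is_RInt_scal R_NormedModule). apply (@is_RInt_minus R_NormedModule).
      - apply (@is_RInt_scal R_NormedModule). now apply RInt_correct_R.
      - apply (@is_RInt_plus R_NormedModule); apply RInt_correct_R;
          now apply ex_RInt_cont_R. }
    pose proof (is_RInt_le _ _ 0 x _ _ (proj1 hx) e e2) as ineq.
    unfold minus at 1, plus at 1, opp at 1 in ineq; simpl in ineq.
    rewrite (hD0 0 (Rle_refl 0)), inner_zero, inner_norm in ineq. fold M in ineq.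
    assert (vf : - (1 / 2 * RInt a 0 x) <= RInt (fun s => inner (volterra phi s) (S (phi s))) 0 x).
    { apply volterra_form; try tauto; auto. intros s hs. rewrite hS by lra. now apply hD0. }
    assert (a0 : 0 <= RInt a 0 x).
    { apply RInt_ge_0; try tauto; [now apply ex_RInt_cont_R|].
      intros s _. apply S_pos. }
    assert (fin : M ^ 2 + - 0 <= 2 * (M * RInt rho 0 x -
      (RInt a 0 x + RInt (fun s => inner (volterra phi s) (S (phi s))) 0 x))).
    { apply ineq. intros s hs.
      assert (hs' : 0 <= s <= T) by lra.
      assert (hF := f_equal (fun y => inner y (D s)) (heq s hs')). simpl in hF.
      rewrite !inner_plus, inner_scal in hF.
      pose proof (inner_le_norm (F s) (D s)) as h1.
      assert (h2 : norm (F s) * norm (D s) <= rho s * M).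
      { apply Rmult_le_compat; auto using hnorm_ge_0.  }
      assert (h3 : 0 <= inner (D s) (D s)) by (rewrite inner_norm; apply pow2_ge_0).
      unfold a. rewrite (hS s) by lra. rewrite (inner_sym _ (D s) (D1 s)).
      nra. }
    destruct (Req_dec M 0) as [z|z]; [lra|]. nra. }
  intros s hs. destruct (Rle_or_lt s 0) as [l|l].
  - rewrite hD0 by exact l. rewrite hnorm_zero. lra.
  - eapply Rle_trans; [|exact bound]. apply hmax. lra.
Qed.

(** The delays do not depend on time and [psi] is defined on the whole line, so a translation passes
    through the integrals without boundary terms. *)
Lemma volterra_dif (h : R) (psi : R -> H) (t : R) :
  (forall s, continuous psi s) -> volterra (dif h psi) t = dif h (volterra psi) t.
Proof.
  intros hc. unfold dif at 1. rewrite volterra_minus; auto.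
  2: intros s; now apply continuous_shift.
  unfold dif. f_equal. apply sum_n_m_ext. intros j. apply RInt_ext. intros r _.
  now replace (t - p j r - h) with (t - h - p j r) by ring.
Qed.

Lemma bounded_on_past (f : R -> H) (T : R) :
  (forall s, continuous f s) -> (forall s, s <= 0 -> f s = zero) -> 0 <= T ->
  exists M, 0 <= M /\ forall s, s <= T -> norm (f s) <= M.
Proof.
  intros hc h0 hT.
  destruct (continuous_bounded_above (fun s => norm (f s)) 0 T) as [M [hM hb]]; [|exact hT|].
  { intros s. exact (continuous_comp f (fun y : H => norm y) s (hc s)
      (@filterlim_norm R_AbsRing H (f s))). }
  exists M. split; [exact hM|]. intros s hs. destruct (Rle_or_lt s 0) as [l|l].
  - now rewrite h0, hnorm_zero.
  - apply hb. lra.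
Qed.

(* The weak equation is the one for [U] tested against [S v], so that it makes sense before
   [U] is known to take values in the range of [S], i.e. in the domain of the inverse. *)
Lemma strong_of_weak (T lam : R) (U V F : R -> H) : 0 <= T ->
  (forall s, continuous V s) -> (forall s, continuous F s) -> (forall s, is_derive U s (V s)) ->
  (forall s, s <= 0 -> U s = zero) -> (forall s, s <= 0 -> V s = zero) ->
  (forall s, s <= 0 -> F s = zero) ->
  (forall t v, t <= T ->
     inner (V t) (S v) + lam * inner (U t) (S v) + inner (U t) v +
     sum_n_m (fun j => rconv (k j) (p j) (fun s => inner (U s) (Q j v)) t) 1 m
     = inner (F t) (S v)) ->
  exists phi : R -> H, (forall s, continuous phi s) /\
    (exists M, forall s, norm (phi s) <= M) /\
    (forall t, t <= T -> S (phi t) = U t) /\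
    (forall t, t <= T ->
      plus (plus (plus (V t) (scal lam (U t))) (phi t)) (volterra phi t) = F t).
Proof.
  intros hT cV cF dU U0 V0 F0 weak.
  assert (cU : forall s, continuous U s)
    by (intros s; exact (continuous_of_is_derive _ _ _ (dU s))).
  set (G0 := fun t => minus (minus (F t) (V t)) (scal lam (U t))).
  assert (cG0 : forall s, continuous G0 s).
  { intros s. apply (@continuous_minus _ R_AbsRing H).
    - apply (@continuous_minus _ R_AbsRing H); auto.
    - apply (@continuous_scal_r _ R_AbsRing H); auto. }
  destruct (bounded_on_past G0 T cG0) as [M [hM hG0]]; [|exact hT|].
  { intros s hs. unfold G0. rewrite F0, V0, U0 by exact hs. vector_ring. }
  set (G := fun t => G0 (Rmin t T)).
  assert (cG : forall s, continuous G s).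
  { intros s. apply (continuous_comp (fun t => Rmin t T) G0); [|apply cG0].
    apply continuous_Rmin_const. }
  destruct (volterra_fixpoint G M cG) as [phi [cphi [bphi ephi]]].
  { intros t. apply hG0, Rmin_r. }
  assert (cS : forall s, continuous (fun s => S (phi s)) s)
    by (intros s; now apply continuous_is_linear).
  assert (ephi' : forall t, t <= T -> phi t = minus (G0 t) (volterra phi t)).
  { intros t ht. rewrite (ephi t) at 1. unfold G. now rewrite Rmin_left. }
  assert (hS : forall t, t <= T -> S (phi t) = U t).
  { intros t ht. apply eq_of_minus_zero.
    destruct (linear_norm S S_linear) as [MS [hMS bS]].
    destruct (bounded_on_past U T cU U0 hT) as [MU [hMU bU]].
    (* Paired with [S v], the equation of [phi] says that [S phi] satisfies the weak equation of
       [U], so the difference solves the homogeneous one. *)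
    apply (weak_volterra_unique (fun t => minus (S (phi t)) (U t)) T (MS * (2 * M) + MU)); auto.
    - intros s. apply (@continuous_minus _ R_AbsRing H); auto.
    - intros s hs. eapply Rle_trans; [apply hnorm_minus_le|].
      apply Rplus_le_compat; [|now apply bU].
      eapply Rle_trans; [apply bS|]. apply Rmult_le_compat_l; [lra|apply bphi].
    - intros s v hs.
      rewrite (sum_n_m_ext_loc _ (fun j =>
        rconv (k j) (p j) (fun s => inner (S (phi s)) (Q j v)) s -
        rconv (k j) (p j) (fun s => inner (U s) (Q j v)) s)).
      2:{ intros j hj. rewrite <- rconv_minus; auto.
          - apply RInt_ext. intros r _. now rewrite inner_minus.
          - intros u. apply (continuous_inner _ (fun _ => Q j v)); [apply cS|apply continuous_const].
          - intros u. apply (continuous_inner _ (fun _ => Q j v)); [apply cU|apply continuous_const]. }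
      rewrite sum_1_minus, inner_minus, S_sym, (ephi' s hs), inner_minus, inner_volterra by auto.
      unfold G0. rewrite !inner_minus, inner_scal. specialize (weak s v hs). lra. }
  exists phi. split; [exact cphi|]. split; [now exists (2 * M)|]. split; [exact hS|].
  intros t ht. rewrite (ephi' t ht) at 1. unfold G0. vector_ring.
Qed.

(* Energy estimate for second differences of [U]: with one step divided out it says
   that [V = U'] is Lipschitz.  [Th] is a scalar majorant of [F]. *)
Lemma lipschitz_of_second_difference (T lam L : R) (U V F phi : R -> H) (Th : R -> R) :
  0 <= lam -> 0 <= T -> 0 <= L ->
  (forall s, continuous phi s) -> (forall s, continuous V s) -> (forall s, continuous F s) ->
  (forall s, continuous Th s) -> (forall s, is_derive U s (V s)) ->
  (forall s, s <= 0 -> U s = zero) -> (forall s, s <= 0 -> Th s = 0) ->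
  (forall t, t <= T -> S (phi t) = U t) ->
  (forall t, t <= T ->
     plus (plus (plus (V t) (scal lam (U t))) (phi t)) (volterra phi t) = F t) ->
  (forall s h, s <= T -> 0 < h -> Th s - Th (s - h) <= L * h) ->
  (forall s d h, s <= T -> 0 < d -> 0 < h ->
     norm (dif d (dif h F) s) <= (Th s - Th (s - h)) - (Th (s - d) - Th (s - d - h))) ->
  forall t d, t <= T -> 0 < d -> norm (dif d V t) <= 2 * L * d.
Proof.
  intros hlam hT hL cphi cV cF cTh dU U0 Th0 hS heq lipTh hF t d ht hd.
  (* [dif d V] is the derivative of [dif d U] and is bounded through its difference quotients, that
     is, through second differences of [U] with two independent steps [d] and [h]. *)
  apply (norm_derive_le (dif d U) t 1 _ _ (is_derive_dif d U V t dU) Rlt_0_1).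
  { apply Rmult_le_pos; lra. }
  intros h [hh _].
  replace (dif h (dif d U) t) with (dif d (dif h U) t).
  2:{ unfold dif. replace (t - h - d) with (t - d - h) by ring. vector_ring. }
  replace (2 * L * d * h) with (2 * (L * h * d)) by ring.
  set (psi := fun s => Th s - Th (s - h)).
  assert (cpsi : forall s, continuous psi s).
  { intros s. apply (@continuous_minus _ R_AbsRing R_NormedModule); [apply cTh|].
    now apply continuous_shift. }
  apply (energy_estimate T lam (L * h * d) (dif d (dif h phi)) (dif d (dif h U))
    (dif d (dif h V)) (dif d (dif h F)) (fun s => psi s - psi (s - d))); auto.
  - intros s. apply continuous_dif. intros u. now apply continuous_dif.
  - intros s. apply continuous_dif. intros u. now apply continuous_dif.
  - intros s. apply continuous_dif. intros u. now apply continuous_dif.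
  - intros s. apply (@continuous_minus _ R_AbsRing R_NormedModule); [apply cpsi|].
    now apply continuous_shift.
  - intros s. apply is_derive_dif. intros u. now apply is_derive_dif.
  - intros s hs. unfold dif. rewrite !U0 by lra. vector_ring.
  - intros s hs. unfold dif. rewrite !is_linear_minus by exact S_linear.
    now rewrite !hS by lra.
  - intros s hs. rewrite volterra_dif by (intros; now apply continuous_dif).
    assert (e : dif d (volterra (dif h phi)) s = dif d (dif h (volterra phi)) s)
      by exact (f_equal2 minus (volterra_dif h phi s cphi) (volterra_dif h phi (s - d) cphi)).
    rewrite e. unfold dif. rewrite <- !heq by lra. vector_ring.
  - intros s hs. apply hF; lra.
  (* Telescoping: the integral of [psi s - psi (s - d)] over [[0, T]] equals that of [psi] over the
     last window [[T - d, T]], because [psi] vanishes in the past; and [psi <= L * h] there. *)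
  - set (P := fun u => RInt psi 0 u).
    assert (dP : forall s, is_derive P s (psi s)).
    { intros s. apply (is_derive_RInt psi P 0 s); [|apply cpsi].
      apply filter_forall. intros u. apply RInt_correct_R. now apply ex_RInt_cont_R. }
    assert (e : is_RInt (fun s => psi s - psi (s - d)) 0 T
      (minus (P T - P (T - d)) (P 0 - P (0 - d)))).
    { apply (is_RInt_derive (fun s => P s - P (s - d))).
      - intros s _. apply (@is_derive_minus R_AbsRing R_NormedModule); [apply dP|].
        now apply (@is_derive_shift R_NormedModule).
      - intros s _. apply (@continuous_minus _ R_AbsRing R_NormedModule); [apply cpsi|].
        now apply continuous_shift. }
    rewrite (is_RInt_unique _ _ _ _ e).
    assert (past : forall u, u <= 0 -> P u = 0).
    { intros u hu. unfold P. rewrite <- (@opp_RInt_swap R_CompleteNormedModule).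
      2: now apply ex_RInt_cont_R.
      rewrite (RInt_ext psi (fun _ => 0)).
      - rewrite RInt_const_R. unfold opp; simpl. ring.
      - intros s hs. rewrite Rmin_left, Rmax_right in hs by lra.
        unfold psi. rewrite !Th0 by lra. apply Rminus_diag. }
    rewrite (past 0), (past (0 - d)) by lra.
    assert (q : P T - P (T - d) = RInt psi (T - d) T).
    { unfold P. rewrite <- (@RInt_Chasles R_CompleteNormedModule psi 0 (T - d) T)
        by now apply ex_RInt_cont_R.
      unfold plus; simpl. ring. }
    unfold minus, plus, opp; simpl.
    replace (P T - P (T - d) + - (0 - 0)) with (RInt psi (T - d) T) by lra.
    apply Rle_trans with (RInt (fun _ => L * h) (T - d) T);
      [|apply Req_le; rewrite RInt_const_R; ring].
    apply RInt_le; [lra| | |].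
    + now apply ex_RInt_cont_R.
    + apply ex_RInt_const.
    + intros s hs. apply lipTh; lra.
Qed.

(** [phi + volterra phi] equals [F - V - lam U], which is Lipschitz; differences commute with
    [volterra], and [volterra_stable] costs the factor [2]. [Mphi] only starts that iteration, hence
    its absence from the constant. *)
Lemma lipschitz_phi (T lam LF LV B Mphi : R) (U V F phi : R -> H) : 0 <= lam ->
  (forall s, continuous phi s) -> (forall s, norm (phi s) <= Mphi) ->
  (forall t, t <= T ->
     plus (plus (plus (V t) (scal lam (U t))) (phi t)) (volterra phi t) = F t) ->
  (forall t h, t <= T -> 0 < h -> norm (dif h F t) <= LF * h) ->
  (forall t h, t <= T -> 0 < h -> norm (dif h V t) <= LV * h) ->
  (forall t h, t <= T -> 0 < h -> norm (dif h U t) <= B * h) ->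
  forall t h, t <= T -> 0 < h -> norm (dif h phi t) <= 2 * (LF + LV + lam * B) * h.
Proof.
  intros hlam cphi bphi heq hF hV hU t h ht hh.
  rewrite Rmult_assoc.
  apply (volterra_stable (dif h phi) T _ (Mphi + Mphi)); auto.
  - intros s. now apply continuous_dif.
  - intros s hs. eapply Rle_trans; [apply hnorm_minus_le|]. now apply Rplus_le_compat.
  - intros s hs. rewrite volterra_dif by exact cphi.
    replace (plus (dif h phi s) (dif h (volterra phi) s))
      with (minus (minus (dif h F s) (dif h V s)) (scal lam (dif h U s))).
    2:{ unfold dif. rewrite <- !heq by lra. vector_ring. }
    eapply Rle_trans; [apply hnorm_minus_le|].
    eapply Rle_trans; [apply Rplus_le_compat_r, hnorm_minus_le|].
    rewrite hnorm_scal, Rabs_pos_eq by exact hlam.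
    specialize (hF s h hs hh). specialize (hV s h hs hh). specialize (hU s h hs hh).
    assert (lam * norm (dif h U s) <= lam * (B * h)) by now apply Rmult_le_compat_l.
    lra.
Qed.

(** * Primitives in time: the forcing and the integrated equation *)

Lemma is_derive_primitive (f : R -> H) (t : R) :
  (forall s, continuous f s) -> is_derive (fun t => RInt f 0 t) t (f t).
Proof.
  intros hc. apply (@is_derive_RInt H f (fun t => RInt f 0 t) 0 t); [|apply hc].
  apply filter_forall. intros u. apply (@RInt_correct H). now apply (@ex_RInt_cont H).
Qed.

Lemma primitive_past (f : R -> H) (t : R) :
  (forall s, continuous f s) -> (forall s, s <= 0 -> f s = zero) -> t <= 0 -> RInt f 0 t = zero.
Proof.
  intros hc h0 ht. apply inner_ext. intros v.
  rewrite <- (RInt_inner f 0 t v) by now apply (@ex_RInt_cont H).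
  rewrite inner_zero.
  transitivity (RInt (fun _ => 0) 0 t).
  - apply RInt_ext. intros s hs. rewrite Rmin_right, Rmax_left in hs by lra.
    rewrite h0 by lra. apply inner_zero.
  - rewrite RInt_const_R. ring.
Qed.

(* A primitive of the function which is [0] before time [0] and [F0 + F1] after. *)
Definition forcing (F0 : H) (F1 : R -> H) (t : R) : H :=
  plus (scal (Rmax t 0) F0) (RInt F1 0 t).

Lemma continuous_forcing F0 (F1 : R -> H) t :
  (forall s, continuous F1 s) -> continuous (forcing F0 F1) t.
Proof.
  intros hc. apply (@continuous_plus _ R_AbsRing H).
  - apply (@continuous_scal_l _ R_AbsRing H). apply continuous_Rmax_const.
  - exact (continuous_of_is_derive _ _ _ (is_derive_primitive F1 t hc)).
Qed.

Lemma forcing_past F0 (F1 : R -> H) t :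
  (forall s, continuous F1 s) -> (forall s, s <= 0 -> F1 s = zero) -> t <= 0 ->
  forcing F0 F1 t = zero.
Proof.
  intros hc h0 ht. unfold forcing. rewrite primitive_past, Rmax_right by auto. vector_ring.
Qed.

Lemma is_derive_forcing F0 (F1 : R -> H) t :
  (forall s, continuous F1 s) -> 0 < t ->
  is_derive (forcing F0 F1) t (plus F0 (F1 t)).
Proof.
  intros hc ht. apply (@is_derive_plus R_AbsRing H); [|now apply is_derive_primitive].
  apply is_derive_ext_loc with (fun s => scal s F0).
  - exists (mkposreal t ht). intros y hy. change (Rabs (y - t) < t) in hy.
    apply Rabs_def2 in hy. now rewrite Rmax_left by lra.
  - assert (e := @is_derive_scal_l R_AbsRing H (fun s => s) t one F0 (is_derive_id t)).
    now rewrite (@scal_one R_Ring H) in e.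
Qed.

Lemma rconv_past k0 p0 (psi : R -> R) t :
  (forall r, 0 <= p0 r) -> (forall s, s <= 0 -> psi s = 0) -> t <= 0 -> rconv k0 p0 psi t = 0.
Proof.
  intros hp h0 ht. transitivity (RInt (fun _ => 0) 0 1).
  - apply RInt_ext. intros r _. rewrite h0; [apply Rmult_0_r|]. specialize (hp r). lra.
  - rewrite RInt_const_R. ring.
Qed.

(** The difference [Z] of the two sides is continuous, vanishes in the past and has derivative zero
    on [(0, T)]. Differentiability of [V] is required at interior times only, because the function
    to which this is applied may have kinks at [0] and [T]. *)
Lemma integrated_equation (T lam : R) (V F1 : R -> H) (F0 : H) :
  (forall s, continuous V s) -> (forall s, continuous F1 s) ->
  (forall s, s <= 0 -> V s = zero) -> (forall s, s <= 0 -> F1 s = zero) ->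
  (forall t, 0 < t < T -> exists V1, is_derive V t V1 /\ forall v,
     inner V1 (S v) + lam * inner (V t) (S v) + inner (V t) v +
     sum_n_m (fun j => rconv (k j) (p j) (fun s => inner (V s) (Q j v)) t) 1 m
     = inner (plus F0 (F1 t)) (S v)) ->
  forall t v, t <= T ->
     inner (V t) (S v) + lam * inner (RInt V 0 t) (S v) + inner (RInt V 0 t) v +
     sum_n_m (fun j => rconv (k j) (p j) (fun s => inner (RInt V 0 s) (Q j v)) t) 1 m
     = inner (forcing F0 F1 t) (S v).
Proof.
  intros cV cF V0 F10 eqn t v ht.
  set (U := fun t => RInt V 0 t).
  assert (dU : forall s, is_derive U s (V s)) by (intros s; now apply is_derive_primitive).
  assert (cU : forall s, continuous U s)
    by (intros s; exact (continuous_of_is_derive _ _ _ (dU s))).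
  assert (past : forall s, s <= 0 -> inner (V s) (S v) + lam * inner (U s) (S v) + inner (U s) v +
     sum_n_m (fun j => rconv (k j) (p j) (fun s => inner (U s) (Q j v)) s) 1 m
     - inner (forcing F0 F1 s) (S v) = 0).
  { intros s hs. rewrite (forcing_past F0 F1 s cF F10 hs), (V0 s hs).
    assert (hU : forall s, s <= 0 -> U s = zero) by (intros u hu; now apply primitive_past).
    rewrite (hU s hs), !inner_zero.
    rewrite (sum_n_m_ext_loc _ (fun _ => zero)).
    - rewrite (@sum_n_m_const_zero R_AbelianMonoid). unfold zero; simpl. ring.
    - intros j hj. apply rconv_past; auto.
      intros u hu. rewrite (hU u hu). apply inner_zero. }
  destruct (Rle_or_lt t 0) as [l|l].
  { specialize (past t l). fold (U t). lra. }
  assert (dQ : forall j s, is_derive (fun s => inner (U s) (Q j v)) s (inner (V s) (Q j v))).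
  { intros j s. apply is_derive_inner_l, dU. }
  assert (cv : forall (f : R -> H) w s, continuous f s -> continuous (fun s => inner (f s) w) s).
  { intros f w s hf. apply (continuous_inner f (fun _ => w)); [exact hf|apply continuous_const]. }
  set (Z := fun t => inner (V t) (S v) + lam * inner (U t) (S v) + inner (U t) v +
     sum_n_m (fun j => rconv (k j) (p j) (fun s => inner (U s) (Q j v)) t) 1 m
     - inner (forcing F0 F1 t) (S v)).
  destruct (MVT_gen Z 0 t (fun _ => 0)) as [x [_ e]].
  - rewrite Rmin_left, Rmax_right by lra. intros s hs.
    destruct (eqn s ltac:(lra)) as [V1 [dV hV1]].
    replace 0 with (inner V1 (S v) + lam * inner (V s) (S v) + inner (V s) v +
     sum_n_m (fun j => rconv (k j) (p j) (fun s => inner (V s) (Q j v)) s) 1 m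
     - inner (plus F0 (F1 s)) (S v)) by (rewrite hV1; ring).
    apply (@is_derive_minus R_AbsRing R_NormedModule).
    + apply (@is_derive_plus R_AbsRing R_NormedModule);
        [apply (@is_derive_plus R_AbsRing R_NormedModule);
         [apply (@is_derive_plus R_AbsRing R_NormedModule)|]|].
      * now apply is_derive_inner_l.
      * apply is_derive_scal. now apply is_derive_inner_l.
      * now apply is_derive_inner_l.
      * apply (@is_derive_sum_1 R_NormedModule). intros j hj.
        apply is_derive_rconv; auto; try apply dQ.
    + apply is_derive_inner_l, is_derive_forcing; [exact cF|lra].
  - intros s _. apply continuity_pt_filterlim.
    apply (@continuous_minus _ R_AbsRing R_NormedModule).
    + apply (@continuous_plus _ R_AbsRing R_NormedModule);
        [apply (@continuous_plus _ R_AbsRing R_NormedModule);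
         [apply (@continuous_plus _ R_AbsRing R_NormedModule)|]|].
      * now apply cv.
      * apply (continuous_mult (fun _ => lam)); [apply continuous_const|now apply cv].
      * now apply cv.
      * apply (@continuous_sum_1 R_UniformSpace R_NormedModule). intros j hj.
        apply continuous_rconv; auto; intros u; now apply cv.
    + apply cv. now apply continuous_forcing.
  - specialize (past 0 (Rle_refl 0)). fold (Z 0) in past. rewrite past in e.
    assert (z : Z t = 0) by lra. unfold Z in z. fold (U t). lra.
Qed.

(** * A scalar majorant of the forcing *)

Section Majorant.

Variables (F0 : H) (F1 : R -> H) (th : R -> R).
Hypothesis F1_cont : forall s, continuous F1 s.
Hypothesis th_cont : forall s, continuous th s.
Hypothesis F1_past : forall s, s <= 0 -> F1 s = zero.
Hypothesis th_past : forall s, s <= 0 -> th s = 0.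
Hypothesis F1_th : forall s r, r <= s -> norm (minus (F1 s) (F1 r)) <= th s - th r.

(** The scalar copy of [forcing], with [F0] replaced by its norm and [F1] by its modulus [th]. Its
    second differences dominate those of [forcing] and, being scalar, can be integrated by
    telescoping. *)
Definition majorant (t : R) : R := norm F0 * Rmax t 0 + RInt th 0 t.

Lemma th_mono r s : r <= s -> th r <= th s.
Proof. intros h. pose proof (Rle_trans _ _ _ (hnorm_ge_0 _) (F1_th s r h)). lra. Qed.

Lemma is_derive_primitive_th s : is_derive (fun t => RInt th 0 t) s (th s).
Proof.
  apply (is_derive_RInt th (fun t => RInt th 0 t) 0 s); [|apply th_cont].
  apply filter_forall. intros u. apply RInt_correct_R. now apply ex_RInt_cont_R.
Qed.

Lemma continuous_majorant s : continuous majorant s.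
Proof.
  apply (@continuous_plus _ R_AbsRing R_NormedModule).
  - apply (continuous_mult (fun _ => norm F0)); [apply continuous_const|apply continuous_Rmax_const].
  - exact (continuous_of_is_derive _ _ _ (is_derive_primitive_th s)).
Qed.

Lemma majorant_past s : s <= 0 -> majorant s = 0.
Proof.
  intros hs. unfold majorant. rewrite Rmax_right by exact hs.
  rewrite <- (@opp_RInt_swap R_CompleteNormedModule) by now apply ex_RInt_cont_R.
  rewrite (RInt_ext th (fun _ => 0)).
  - rewrite RInt_const_R. unfold opp; simpl. ring.
  - intros r hr. rewrite Rmin_left, Rmax_right in hr by lra. apply th_past. lra.
Qed.

Lemma Rmax_dif s h : 0 < h -> 0 <= Rmax s 0 - Rmax (s - h) 0 <= h.
Proof. intros hh. unfold Rmax. destruct (Rle_dec s 0), (Rle_dec (s - h) 0); lra. Qed.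

(** Convexity of the positive part: the kink that [F0] produces at time [0] enters the second
    differences with a nonnegative weight. *)
Lemma Rmax_dif2 s d h : 0 < h -> 0 < d ->
  0 <= (Rmax s 0 - Rmax (s - h) 0) - (Rmax (s - d) 0 - Rmax (s - d - h) 0).
Proof.
  intros hh hd. unfold Rmax.
  destruct (Rle_dec s 0), (Rle_dec (s - h) 0), (Rle_dec (s - d) 0), (Rle_dec (s - d - h) 0); lra.
Qed.

Lemma is_RInt_th_window s h :
  is_RInt th (s - h) s (RInt th 0 s - RInt th 0 (s - h)).
Proof.
  apply (is_RInt_derive (fun t => RInt th 0 t)).
  - intros u _. apply is_derive_primitive_th.
  - intros u _. apply th_cont.
Qed.

Lemma majorant_dif T s h : s <= T -> 0 < h ->
  majorant s - majorant (s - h) <= (norm F0 + th T) * h.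
Proof.
  intros hs hh. unfold majorant.
  pose proof (Rmax_dif s h hh). pose proof (hnorm_ge_0 F0).
  assert (q : RInt th 0 s - RInt th 0 (s - h) <= th T * h).
  { apply (is_RInt_le th (fun _ => th T) (s - h) s); [lra|apply is_RInt_th_window| |].
    - replace (th T * h) with (scal (s - (s - h)) (th T)) by (unfold scal; simpl; unfold mult; simpl; ring).
      apply (@is_RInt_const R_NormedModule).
    - intros r hr. apply th_mono. lra. }
  nra.
Qed.

Lemma norm_F1_le T r : 0 <= T -> r <= T -> norm (F1 r) <= th T.
Proof.
  intros hT hr. destruct (Rle_or_lt r 0) as [l|l].
  - rewrite F1_past, hnorm_zero by exact l. rewrite <- (th_past 0 (Rle_refl 0)). now apply th_mono.
  - pose proof (F1_th r 0 (Rlt_le _ _ l)) as h. rewrite (th_past 0) in h by lra.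
    pose proof (hnorm_sub (F1 r) (F1 0)) as h2.
    rewrite (F1_past 0 (Rle_refl 0)) in h2 at 2. rewrite hnorm_zero in h2.
    pose proof (th_mono r T hr). lra.
Qed.

Lemma norm_dif_forcing T s h : 0 <= T -> s <= T -> 0 < h ->
  norm (dif h (forcing F0 F1) s) <= (norm F0 + th T) * h.
Proof.
  intros hT hs hh.
  pose proof (Rmax_dif s h hh) as hm. pose proof (hnorm_ge_0 F0).
  set (P := fun t => RInt F1 0 t).
  replace (dif h (forcing F0 F1) s)
    with (plus (scal (Rmax s 0 - Rmax (s - h) 0) F0) (minus (P s) (P (s - h))))
    by (unfold dif, forcing, P; vector_ring).
  eapply Rle_trans; [apply hnorm_triangle|]. rewrite hnorm_scal, Rabs_pos_eq by tauto.
  assert (q : norm (minus (P s) (P (s - h))) <= th T * h).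
  { assert (e : is_RInt F1 (s - h) s (minus (P s) (P (s - h)))).
    { apply (@is_RInt_derive H P).
      - intros u _. now apply is_derive_primitive.
      - intros u _. apply F1_cont. }
    refine (norm_RInt_le F1 (fun _ => th T) (s - h) s _ _ _ _ e _); [lra| |].
    - intros r hr. apply norm_F1_le; lra.
    - replace (th T * h) with (scal (s - (s - h)) (th T)) by (unfold scal; simpl; unfold mult; simpl; ring).
      apply (@is_RInt_const R_NormedModule). }
  nra.
Qed.

(** For the primitive of [F1], differencing with step [h] is integration of [dif d F1] over the
    window [[s - h, s]], where [F1_th] bounds it pointwise by increments of [th]. *)
Lemma norm_dif2_forcing s d h : 0 < d -> 0 < h ->
  norm (dif d (dif h (forcing F0 F1)) s) <=
  (majorant s - majorant (s - h)) - (majorant (s - d) - majorant (s - d - h)).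
Proof.
  intros hd hh.
  pose proof (Rmax_dif2 s d h hh hd) as hm.
  set (P := fun t => RInt F1 0 t). set (p1 := fun t => RInt th 0 t).
  set (w := (Rmax s 0 - Rmax (s - h) 0) - (Rmax (s - d) 0 - Rmax (s - d - h) 0)) in *.
  replace (dif d (dif h (forcing F0 F1)) s)
    with (plus (scal w F0) (minus (dif d P s) (dif d P (s - h)))).
  2:{ unfold dif, forcing, w. fold (P s) (P (s - h)) (P (s - d)) (P (s - d - h)) (P (s - h - d)).
      replace (s - h - d) with (s - d - h) by ring. vector_ring. }
  eapply Rle_trans; [apply hnorm_triangle|]. rewrite hnorm_scal, Rabs_pos_eq by exact hm.
  assert (q : norm (minus (dif d P s) (dif d P (s - h))) <=
    (p1 s - p1 (s - d)) - (p1 (s - h) - p1 (s - h - d))).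
  { assert (e : is_RInt (dif d F1) (s - h) s (minus (dif d P s) (dif d P (s - h)))).
    { apply (@is_RInt_derive H (dif d P)).
      - intros u _. apply is_derive_dif. intros x. now apply is_derive_primitive.
      - intros u _. now apply continuous_dif. }
    assert (e2 : is_RInt (fun r => th r - th (r - d)) (s - h) s
      ((p1 s - p1 (s - d)) - (p1 (s - h) - p1 (s - h - d)))).
    { apply (is_RInt_derive (fun r => p1 r - p1 (r - d))).
      - intros u _. apply (@is_derive_minus R_AbsRing R_NormedModule); [apply is_derive_primitive_th|].
        apply (@is_derive_shift R_NormedModule). apply is_derive_primitive_th.
      - intros u _. apply (@continuous_minus _ R_AbsRing R_NormedModule); [apply th_cont|].
        now apply continuous_shift. }
    refine (norm_RInt_le (dif d F1) _ (s - h) s _ _ _ _ e e2); [lra|].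
    intros r _. apply F1_th. lra. }
  unfold majorant. fold (p1 s) (p1 (s - h)) (p1 (s - d)) (p1 (s - d - h)).
  replace (s - h - d) with (s - d - h) in q by ring. unfold w. lra.
Qed.

(* In the application [S] is the inverse of [A], so that [phi] is [A U] with [U' = V]. *)
Lemma regularity (T lam : R) (V : R -> H) : 0 <= T -> 0 <= lam ->
  (forall s, continuous V s) -> (forall s, s <= 0 -> V s = zero) ->
  (forall t, 0 < t < T -> exists V1, is_derive V t V1 /\ forall v,
     inner V1 (S v) + lam * inner (V t) (S v) + inner (V t) v +
     sum_n_m (fun j => rconv (k j) (p j) (fun s => inner (V s) (Q j v)) t) 1 m
     = inner (plus F0 (F1 t)) (S v)) ->
  (forall t d, t <= T -> 0 < d -> norm (dif d V t) <= 2 * (norm F0 + th T) * d) /\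
  exists (phi : R -> H) (C : R), (forall t, t <= T -> S (phi t) = RInt V 0 t) /\
    (forall t h, t <= T -> 0 < h -> norm (dif h phi t) <= C * h).
Proof.
  intros hT hlam cV V0 eqn.
  set (U := fun t => RInt V 0 t). set (L := norm F0 + th T).
  assert (hL : 0 <= L).
  { apply Rplus_le_le_0_compat; [apply hnorm_ge_0|].
    rewrite <- (th_past 0 (Rle_refl 0)). now apply th_mono. }
  assert (dU : forall s, is_derive U s (V s)) by (intros s; now apply is_derive_primitive).
  assert (U0 : forall s, s <= 0 -> U s = zero) by (intros s hs; now apply primitive_past).
  assert (cF : forall s, continuous (forcing F0 F1) s) by (intros s; now apply continuous_forcing).
  destruct (strong_of_weak T lam U V (forcing F0 F1)) as [phi [cphi [[Mphi bphi] [hS heq]]]]; auto.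
  { intros s hs. now apply forcing_past. }
  { intros t v ht. now apply (integrated_equation T). }
  assert (hV : forall t d, t <= T -> 0 < d -> norm (dif d V t) <= 2 * L * d).
  { apply (lipschitz_of_second_difference T lam L U V (forcing F0 F1) phi majorant); auto.
    - apply continuous_majorant.
    - apply majorant_past.
    - intros s h hs hh. now apply majorant_dif.
    - intros s d h hs hd hh. now apply norm_dif2_forcing. }
  split; [exact hV|].
  destruct (bounded_on_past V T cV V0 hT) as [BV [_ bV]].
  (* Lipschitz constants of the terms of [F - V - lam U]: [L] for the forcing, [2 * L] for [V], and
     for [U] the bound [BV] of its derivative [V]. *)
  exists phi, (2 * (L + 2 * L + lam * BV)). split; [exact hS|].
  apply (lipschitz_phi T lam L (2 * L) BV Mphi U V (forcing F0 F1)); auto.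
  - intros t h ht hh. now apply norm_dif_forcing.
  - intros t h ht hh.
    assert (e : is_RInt V (t - h) t (dif h U t)).
    { apply (@is_RInt_derive H U); intros u _; auto. }
    refine (norm_RInt_le V (fun _ => BV) (t - h) t _ _ _ _ e _); [lra| |].
    + intros r hr. apply bV. lra.
    + replace (BV * h) with (scal (t - (t - h)) BV) by (unfold scal; simpl; unfold mult; simpl; ring).
      apply (@is_RInt_const R_NormedModule).
Qed.

End Majorant.

End VolterraOperator.

(** * Desingularization of the kernel *)

(* [Rpower 0 a] is the junk value [1], hence this extension of [x ^ a] by [0]. *)
Definition pow0 (a x : R) : R := if Rle_dec x 0 then 0 else Rpower x a.

Lemma pow0_neg a x : x <= 0 -> pow0 a x = 0.
Proof. intros h. unfold pow0. destruct (Rle_dec x 0); [easy|lra]. Qed.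

Lemma pow0_pos a x : 0 < x -> pow0 a x = Rpower x a.
Proof. intros h. unfold pow0. destruct (Rle_dec x 0); [lra|easy]. Qed.

Lemma Rpower_gt_0 x a : 0 < Rpower x a.
Proof. apply exp_pos. Qed.

Lemma pow0_nonneg a x : 0 <= pow0 a x.
Proof.
  unfold pow0. destruct (Rle_dec x 0); [lra|]. apply Rlt_le, Rpower_gt_0.
Qed.

Lemma pow0_mono a x y : 0 < a -> x <= y -> pow0 a x <= pow0 a y.
Proof.
  intros ha h. destruct (Rle_or_lt x 0) as [l|l].
  - rewrite (pow0_neg a x l). apply pow0_nonneg.
  - rewrite !pow0_pos by lra. apply Rle_Rpower_l; lra.
Qed.

Lemma is_derive_Rpower a x : 0 < x -> is_derive (fun x => Rpower x a) x (a * Rpower x (a - 1)).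
Proof.
  intros h. apply is_derive_Reals. now apply derivable_pt_lim_power.
Qed.

Lemma continuous_Rpower a x : 0 < x -> continuous (fun x => Rpower x a) x.
Proof.
  intros h. exact (continuous_of_is_derive (V := R_NormedModule) _ _ _ (is_derive_Rpower a x h)).
Qed.

Lemma is_derive_pow0 a x : 0 < x -> is_derive (pow0 a) x (a * Rpower x (a - 1)).
Proof.
  intros h. apply is_derive_ext_loc with (fun x => Rpower x a).
  - exists (mkposreal x h). intros y hy. change (Rabs (y - x) < x) in hy.
    apply Rabs_def2 in hy. now rewrite pow0_pos by lra.
  - now apply is_derive_Rpower.
Qed.

Lemma continuous_pow0 a x : 0 < a -> continuous (pow0 a) x.
Proof.
  intros ha. destruct (Rtotal_order x 0) as [l|[l|l]].
  - apply continuous_ext_loc with (fun _ => 0); [|apply continuous_const].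
    assert (p : 0 < - x) by lra. exists (mkposreal _ p). intros y hy.
    change (Rabs (y - x) < - x) in hy. apply Rabs_def2 in hy. rewrite pow0_neg by lra. easy.
  - subst x. apply (@continuous_of_norm_minus R_UniformSpace R_NormedModule). intros eps he.
    (* The radius is [eps ^ (1 / a)], which [x ^ a] maps to [eps]. *)
    exists (mkposreal _ (Rpower_gt_0 eps (/ a))). intros y hy.
    change (Rabs (y - 0) < Rpower eps (/ a)) in hy.
    change (Rabs (pow0 a y - pow0 a 0) <= eps).
    rewrite (pow0_neg a 0), Rminus_0_r, Rabs_pos_eq by (apply Rle_refl || apply pow0_nonneg).
    destruct (Rle_or_lt y 0) as [q|q]; [rewrite pow0_neg; lra|].
    rewrite Rminus_0_r, Rabs_pos_eq in hy by lra.
    rewrite pow0_pos by exact q.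
    replace eps with (Rpower (Rpower eps (/ a)) a).
    + apply Rle_Rpower_l; lra.
    + rewrite Rpower_mult, Rinv_l by lra. now apply Rpower_1.
  - exact (continuous_of_is_derive _ _ _ (is_derive_pow0 a x l)).
Qed.

Lemma pow0_inv a x : 0 < a -> 0 <= x -> pow0 (/ a) (pow0 a x) = x.
Proof.
  intros ha [h|h].
  - rewrite (pow0_pos a x h), pow0_pos by apply Rpower_gt_0.
    rewrite Rpower_mult, Rinv_r by lra. now apply Rpower_1.
  - rewrite <- h, (pow0_neg a 0), pow0_neg; lra.
Qed.

Lemma filter_prod_ends t : 0 < t ->
  filter_prod (at_right 0) (at_left t) (fun xy => 0 < fst xy < t /\ 0 < snd xy < t).
Proof.
  intros ht. exists (fun x => 0 < x < t) (fun x => 0 < x < t); [| |auto].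
  - exists (mkposreal t ht). intros y hy h. change (Rabs (y - 0) < t) in hy.
    apply Rabs_def2 in hy. lra.
  - exists (mkposreal t ht). intros y hy h. change (Rabs (y - t) < t) in hy.
    apply Rabs_def2 in hy. lra.
Qed.

Section Kernel.

Variables T kap a gam : R.
Hypothesis T_pos : 0 < T.
Hypothesis kap_nonneg : 0 <= kap.
Hypothesis a_pos : 0 < a.

(* The substitution [s = t - lag r] makes the weakly singular kernel continuous. *)
Definition lag (r : R) : R := T * pow0 (/ a) r.

(** What the substitution leaves of the power kernel: in [lag r ^ (a - 1) / gam] times the
    derivative of [lag] the powers of [r] cancel, and the constant is [T ^ a / (a * gam)]. *)
Definition amplitude : R := Rpower T a / a / gam.

Definition kern (r : R) : R := amplitude * exp (- kap * lag r).

(** The inverse of [lag] on nonnegative times: delays up to [t] are those with [r <= phase t], and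
    larger [r] reach back before time [0]. *)
Definition phase (t : R) : R := pow0 a (t / T).

Lemma inv_a_pos : 0 < / a.
Proof. now apply Rinv_0_lt_compat. Qed.

Lemma lag_nonneg r : 0 <= lag r.
Proof. apply Rmult_le_pos; [lra|apply pow0_nonneg]. Qed.

Lemma continuous_lag_fun r : continuous lag r.
Proof.
  apply (continuous_mult (fun _ => T)); [apply continuous_const|].
  apply continuous_pow0, inv_a_pos.
Qed.

Lemma continuous_kern r : continuous kern r.
Proof.
  apply (continuous_mult (fun _ => amplitude)); [apply continuous_const|].
  apply (continuous_comp (fun r => - kap * lag r) exp).
  - apply (continuous_mult (fun _ => - kap)); [apply continuous_const|apply continuous_lag_fun].
  - apply continuous_exp.
Qed.

Lemma lag_phase t : 0 <= t -> lag (phase t) = t.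
Proof.
  intros h. unfold lag, phase. rewrite pow0_inv.
  - field. lra.
  - exact a_pos.
  - apply Rmult_le_pos; [exact h|]. apply Rlt_le, Rinv_0_lt_compat, T_pos.
Qed.

Lemma phase_pos t : 0 < t -> 0 < phase t.
Proof.
  intros h. unfold phase. rewrite pow0_pos by now apply Rdiv_lt_0_compat. apply Rpower_gt_0.
Qed.

Lemma phase_le_1 t : t <= T -> phase t <= 1.
Proof.
  intros h. unfold phase. apply Rle_trans with (pow0 a 1).
  - apply pow0_mono; [exact a_pos|]. apply Rmult_le_reg_r with T; [exact T_pos|]. field_simplify; lra.
  - rewrite pow0_pos by lra. unfold Rpower. rewrite ln_1, Rmult_0_r, exp_0. lra.
Qed.

Lemma continuous_phase t : continuous phase t.
Proof.
  apply (continuous_comp (fun t => t / T) (pow0 a)); [|now apply continuous_pow0].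
  apply (continuous_mult (fun t => t) (fun _ => / T)); [apply continuous_id|apply continuous_const].
Qed.

Lemma phase_mono s t : s <= t -> phase s <= phase t.
Proof.
  intros h. apply pow0_mono; [exact a_pos|]. apply Rmult_le_compat_r; [|exact h].
  apply Rlt_le, Rinv_0_lt_compat, T_pos.
Qed.

Lemma lag_ge r t : 0 <= t -> phase t <= r -> t <= lag r.
Proof.
  intros ht h. rewrite <- (lag_phase t ht) at 1. unfold lag.
  apply Rmult_le_compat_l; [lra|]. apply pow0_mono; [apply inv_a_pos|exact h].
Qed.

Lemma kern_abs_le r : Rabs (kern r) <= Rabs amplitude.
Proof.
  unfold kern. rewrite Rabs_mult, (Rabs_pos_eq (exp _)) by apply Rlt_le, exp_pos.
  rewrite <- (Rmult_1_r (Rabs amplitude)) at 2.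
  apply Rmult_le_compat_l; [apply Rabs_pos|]. rewrite <- exp_0.
  pose proof (lag_nonneg r). destruct (Rmult_le_pos kap (lag r)) as [h|h]; auto.
  - apply Rlt_le, exp_increasing. lra.
  - apply Req_le. f_equal. lra.
Qed.

Lemma is_derive_lag r : 0 < r -> is_derive lag r (T * (/ a * Rpower r (/ a - 1))).
Proof. intros h. apply is_derive_scal. now apply is_derive_pow0. Qed.

Lemma kernel_substitution r : 0 < r ->
  exp (- kap * lag r) * Rpower (lag r) (a - 1) / gam * (T * (/ a * Rpower r (/ a - 1))) = kern r.
Proof.
  intros h. unfold kern, amplitude.
  assert (e : Rpower (lag r) (a - 1) = Rpower T a * / T * Rpower r (1 - / a)).
  { unfold lag. rewrite pow0_pos by exact h.
    rewrite <- Rpower_mult_distr by (exact T_pos || apply Rpower_gt_0).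
    rewrite Rpower_mult. replace (/ a * (a - 1)) with (1 - / a) by (field; lra).
    f_equal. replace (a - 1) with (a + - (1)) by ring. rewrite Rpower_plus, Rpower_Ropp.
    now rewrite Rpower_1 by exact T_pos. }
  rewrite e.
  assert (e2 : Rpower r (1 - / a) * Rpower r (/ a - 1) = 1).
  { rewrite <- Rpower_plus. replace (1 - / a + (/ a - 1)) with 0 by ring. now apply Rpower_O. }
  transitivity (Rpower T a / a / gam * exp (- kap * lag r) *
    (Rpower r (1 - / a) * Rpower r (/ a - 1))).
  - unfold Rdiv. generalize (/ gam). intros g. field. lra.
  - rewrite e2. ring.
Qed.

(** Change of variables between interior points [x] and [y] of [(0, t)], where the integrand is
    continuous, and then the limits [x -> 0] and [y -> t]. The limit is the asserted value because
    the transformed integrand is continuous up to the ends, and improper integrals are unique. *)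
Lemma is_RInt_gen_kernel (psi : R -> R) (t l : R) : (forall s, continuous psi s) -> 0 < t ->
  is_RInt_gen (fun s => exp (- kap * (t - s)) * Rpower (t - s) (a - 1) / gam * psi s)
    (at_right 0) (at_left t) l ->
  l = RInt (fun r => kern r * psi (t - lag r)) 0 (phase t).
Proof.
  intros cpsi ht hl.
  set (f := fun s => exp (- kap * (t - s)) * Rpower (t - s) (a - 1) / gam * psi s) in *.
  set (q := fun r => kern r * psi (t - lag r)).
  assert (cq : forall r, continuous q r).
  { intros r. apply (continuous_mult kern); [apply continuous_kern|].
    apply (continuous_comp (fun r => t - lag r) psi); [|apply cpsi].
    apply (@continuous_minus _ R_AbsRing R_NormedModule);
      [apply continuous_const|apply continuous_lag_fun]. }
  set (P := fun x => RInt q 0 x).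
  assert (cP : forall x, continuous P x).
  { intros x. apply (continuous_of_is_derive (V := R_NormedModule) P x (q x)).
    apply (is_derive_RInt q P 0 x); [|apply cq].
    apply filter_forall. intros u. apply RInt_correct_R. now apply ex_RInt_cont_R. }
  assert (cf : forall s, s < t -> continuous f s).
  { intros s hs. apply (continuous_mult (fun s => exp (- kap * (t - s)) * Rpower (t - s) (a - 1) / gam) psi);
      [|apply cpsi].
    apply (continuous_mult (fun s => exp (- kap * (t - s)) * Rpower (t - s) (a - 1)) (fun _ => / gam));
      [|apply continuous_const].
    assert (cs : continuous (fun s => t - s) s).
    { apply (@continuous_minus _ R_AbsRing R_NormedModule);
        [apply continuous_const|apply continuous_id]. }
    apply (continuous_mult (fun s => exp (- kap * (t - s))) (fun s => Rpower (t - s) (a - 1))).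
    - apply (continuous_comp (fun s => - kap * (t - s)) exp); [|apply continuous_exp].
      apply (continuous_mult (fun _ => - kap)); [apply continuous_const|exact cs].
    - apply (continuous_comp (fun s => t - s) (fun x => Rpower x (a - 1)) s cs).
      apply continuous_Rpower. lra. }
  assert (int : forall x y, 0 < x < t -> 0 < y < t -> is_RInt f x y (P (phase (t - x)) - P (phase (t - y)))).
  { intros x y hx hy.
    assert (px := phase_pos (t - x) ltac:(lra)). assert (py := phase_pos (t - y) ltac:(lra)).
    assert (pm : forall r, Rmin (phase (t - x)) (phase (t - y)) <= r -> 0 < r).
    { intros r hr. eapply Rlt_le_trans; [|exact hr]. now apply Rmin_pos. }
    assert (e := is_RInt_comp (V := R_CompleteNormedModule) f (fun r => t - lag r)
      (fun r => - (T * (/ a * Rpower r (/ a - 1)))) (phase (t - x)) (phase (t - y))).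
    cbv beta in e. rewrite !lag_phase in e by lra.
    replace (t - (t - x)) with x in e by ring. replace (t - (t - y)) with y in e by ring.
    assert (lag_pos : forall r, 0 < r -> 0 < lag r).
    { intros r hr. apply Rmult_lt_0_compat; [exact T_pos|].
      rewrite pow0_pos by exact hr. apply Rpower_gt_0. }
    specialize (e ltac:(intros r hr; apply cf; pose proof (lag_pos r (pm r (proj1 hr))); lra)).
    (* [t - lag r] decreases in [r], whence the sign. *)
    assert (e' : is_RInt (fun r => - q r) (phase (t - x)) (phase (t - y)) (RInt f x y)).
    { eapply is_RInt_ext; [|apply e].
      - intros r hr. assert (hr' : 0 < r) by (apply pm; lra).
        unfold q. rewrite <- (kernel_substitution r hr'). unfold f, scal; simpl. unfold mult; simpl.
        replace (t - (t - lag r)) with (lag r) by ring. ring.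
      - intros r hr. assert (hr' : 0 < r) by (apply pm; tauto). split.
        + replace (- (T * (/ a * Rpower r (/ a - 1)))) with (0 - T * (/ a * Rpower r (/ a - 1))) by ring.
          apply (@is_derive_minus R_AbsRing R_NormedModule); [apply (@is_derive_const R_AbsRing R_NormedModule)|].
          now apply is_derive_lag.
        + apply (@continuous_opp _ R_AbsRing R_NormedModule (fun r => T * (/ a * Rpower r (/ a - 1)))).
          apply (continuous_mult (fun _ => T)); [apply continuous_const|].
          apply (continuous_mult (fun _ => / a)); [apply continuous_const|].
          now apply continuous_Rpower. }
    assert (ef : ex_RInt f x y).
    { apply (@ex_RInt_continuous R_CompleteNormedModule). intros s hs. apply cf.
      apply Rle_lt_trans with (1 := proj2 hs). apply Rmax_lub_lt; lra. }
    assert (e2 : is_RInt (fun r => - q r) (phase (t - x)) (phase (t - y))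
      (- (P (phase (t - y)) - P (phase (t - x))))).
    { apply (@is_RInt_opp R_NormedModule).
      replace (P (phase (t - y)) - P (phase (t - x))) with (RInt q (phase (t - x)) (phase (t - y))).
      - apply RInt_correct_R. now apply ex_RInt_cont_R.
      - pose proof (RInt_Chasles_R q 0 (phase (t - x)) (phase (t - y)) cq). unfold P. lra. }
    assert (e3 : @eq R (RInt f x y) (- (P (phase (t - y)) - P (phase (t - x)))))
      by exact (eq_trans (eq_sym (is_RInt_unique _ _ _ _ e')) (is_RInt_unique _ _ _ _ e2)).
    assert (e4 : @eq R (P (phase (t - x)) - P (phase (t - y))) (RInt f x y)) by (rewrite e3; ring).
    rewrite e4. now apply RInt_correct_R. }
  assert (lim : filterlim (fun xy : R * R => P (phase (t - fst xy)) - P (phase (t - snd xy)))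
    (filter_prod (at_right 0) (at_left t)) (locally (P (phase t) - P (phase 0)))).
  { assert (c : forall u, continuous (fun x => P (phase (t - x))) u).
    { intros u. apply (continuous_comp (fun x => phase (t - x)) P); [|apply cP].
      apply (continuous_comp (fun x => t - x) phase); [|apply continuous_phase].
      apply (@continuous_minus _ R_AbsRing R_NormedModule);
        [apply continuous_const|apply continuous_id]. }
    apply (filterlim_comp_2 (G := locally (P (phase t))) (H := locally (- P (phase 0)))
      (fun xy : R * R => P (phase (t - fst xy))) (fun xy : R * R => - P (phase (t - snd xy))) Rplus).
    - apply (filterlim_comp _ _ _ fst (fun x => P (phase (t - x))) _ (at_right 0)); [apply filterlim_fst|].
      replace (P (phase t)) with (P (phase (t - 0))) by (now rewrite Rminus_0_r).
      eapply filterlim_filter_le_1; [|apply (c 0)]. apply filter_le_within.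
    - apply (filterlim_comp _ _ _ snd (fun x => - P (phase (t - x))) _ (at_left t)); [apply filterlim_snd|].
      replace (P (phase 0)) with (P (phase (t - t))) by (now rewrite Rminus_diag).
      eapply filterlim_filter_le_1; [apply filter_le_within|].
      apply (@continuous_opp _ R_AbsRing R_NormedModule (fun x => P (phase (t - x))) t (c t)).
    - apply (@filterlim_plus R_AbsRing R_NormedModule). }
  (* Here the value [0] of [pow0] at [0] matters: it gives [phase 0 = 0]. *)
  assert (P0 : P (phase 0) = 0).
  { unfold P, phase. rewrite pow0_neg by (unfold Rdiv; lra). apply (@RInt_point R_CompleteNormedModule). }
  rewrite P0, Rminus_0_r in lim.
  assert (g : is_RInt_gen f (at_right 0) (at_left t) (P (phase t))).
  { intros Q hQ. specialize (lim Q hQ). unfold filtermap in lim. unfold filtermapi.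
    generalize (filter_and _ _ (filter_prod_ends t ht) lim). apply filter_imp.
    intros [x y] [[h1 h2] h3]. simpl in *. eexists. split; [now apply int|exact h3]. }
  rewrite <- (is_RInt_gen_unique _ _ hl). exact (is_RInt_gen_unique _ _ g).
Qed.

End Kernel.

(** [[0, 1]] is split at a small [eta]. Below [eta] the kernel is bounded and the interval is short;
    above it all delays are at least [lag T a eta > 0], and the exponential factor is small once
    [kap] is large. This is what makes the shift by [lam] effective. *)
Lemma kernel_mass_small (T a gam eps : R) : 0 < T -> 0 < a -> 0 < eps ->
  exists Lam, 0 <= Lam /\ forall kap, Lam <= kap ->
    RInt (fun r => Rabs (kern T kap a gam r)) 0 1 <= eps.
Proof.
  intros hT ha he.
  (* The summand [1] allows division by [c] whatever the amplitude is. *)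
  set (c := Rabs (amplitude T a gam) + 1).
  assert (hc : 1 <= c) by (pose proof (Rabs_pos (amplitude T a gam)); unfold c; lra).
  set (eta := Rmin (eps / (2 * c)) 1).
  assert (e1 : 0 < eps / (2 * c)) by (apply Rdiv_lt_0_compat; lra).
  assert (h0 : 0 < eta) by (apply Rmin_pos; lra).
  assert (h1 : eta <= 1) by apply Rmin_r.
  assert (h2 : eta <= eps / (2 * c)) by apply Rmin_l.
  set (d := lag T a eta).
  assert (hd : 0 < d).
  { apply Rmult_lt_0_compat; [exact hT|]. rewrite pow0_pos by exact h0. apply Rpower_gt_0. }
  exists (Rmax 0 (- ln (eps / (2 * c)) / d)). split; [apply Rmax_l|]. intros kap hk.
  assert (k0 : 0 <= kap) by (eapply Rle_trans; [apply Rmax_l|exact hk]).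
  assert (k1 : exp (- kap * d) <= eps / (2 * c)).
  { rewrite <- (exp_ln (eps / (2 * c))) by exact e1.
    assert (q : - ln (eps / (2 * c)) <= kap * d).
    { replace (- ln (eps / (2 * c))) with (- ln (eps / (2 * c)) / d * d) by (field; lra).
      apply Rmult_le_compat_r; [lra|]. eapply Rle_trans; [apply Rmax_r|exact hk]. }
    destruct (Rle_lt_or_eq_dec _ _ q) as [q'|q'].
    - apply Rlt_le, exp_increasing. lra.
    - apply Req_le. f_equal. lra. }
  set (k := fun r => Rabs (kern T kap a gam r)).
  assert (ex : forall x y, ex_RInt k x y).
  { intros x y. apply ex_RInt_abs_kernel. intros r. now apply continuous_kern. }
  rewrite <- (@RInt_Chasles R_CompleteNormedModule k 0 eta 1) by apply ex.
  assert (i1 : RInt k 0 eta <= c * eta).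
  { apply Rle_trans with (RInt (fun _ => c) 0 eta);
      [|apply Req_le; rewrite RInt_const_R; ring].
    apply RInt_le; [lra|apply ex|apply ex_RInt_const|]. intros r _.
    pose proof (kern_abs_le T kap a gam hT k0 r). unfold k, c. lra. }
  assert (i2 : RInt k eta 1 <= c * (eps / (2 * c))).
  { apply Rle_trans with (RInt (fun _ => c * (eps / (2 * c))) eta 1).
    - apply RInt_le; [lra|apply ex|apply ex_RInt_const|]. intros r hr. unfold k, kern.
      rewrite Rabs_mult, (Rabs_pos_eq (exp _)) by apply Rlt_le, exp_pos.
      apply Rmult_le_compat; [apply Rabs_pos|apply Rlt_le, exp_pos|unfold c; lra|].
      eapply Rle_trans; [|exact k1].
      assert (q : kap * d <= kap * lag T a r).
      { apply Rmult_le_compat_l; [exact k0|]. apply Rmult_le_compat_l; [lra|].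
        apply pow0_mono; [now apply Rinv_0_lt_compat|lra]. }
      destruct (Rle_lt_or_eq_dec _ _ q) as [q'|q'].
      + apply Rlt_le, exp_increasing. lra.
      + apply Req_le. f_equal. lra.
    - rewrite RInt_const_R.
      assert (0 < c * (eps / (2 * c))) by (apply Rmult_lt_0_compat; lra). nra. }
  assert (i3 : c * (eps / (2 * c)) = eps / 2) by (field; lra).
  unfold plus; simpl. nra.
Qed.

(** * Operators and moduli of continuity *)

Section Operators.

Context {H : Hilbert}.

Lemma symmetric_of_self_adjoint (L : operator H) (v w : H) :
  self_adjoint L -> dom L v -> dom L w -> inner (L w) v = inner w (L v).
Proof. intros [_ h] hv hw. exact (proj1 (h v (L v)) (conj hv eq_refl) w hw). Qed.

Lemma op_zero (L : operator H) : L zero = zero.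
Proof.
  assert (e : L (scal 0 zero) = scal 0 (L zero)) by apply op_scal, dom_zero.
  rewrite (@scal_zero_l R_Ring H) in e.
  exact (eq_trans e (@scal_zero_l R_Ring H (L zero))).
Qed.

(** Images under unbounded operators are tested only against vectors of a dense domain.
    Approximating [x] by such vectors in [inner x x] gives [norm x ^ 2 <= M * norm x]. *)
Lemma norm_le_of_dense (L : operator H) (x : H) (M : R) : densely_defined L -> 0 <= M ->
  (forall v, dom L v -> inner x v <= M * norm v) -> norm x <= M.
Proof.
  intros hd hM h.
  pose proof (hnorm_ge_0 x) as hx.
  assert (q : norm x ^ 2 <= M * norm x).
  { apply le_epsilon. intros eps he.
    assert (p : 0 < eps / (M + norm x + 1)) by (apply Rdiv_lt_0_compat; lra).
    destruct (hd x _ p) as [y [hy hxy]].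
    change (norm (minus y x) < eps / (M + norm x + 1)) in hxy.
    set (d := eps / (M + norm x + 1)) in *.
    rewrite <- inner_norm.
    replace (inner x x) with (inner x y - inner x (minus y x)) by (rewrite inner_minus_r; ring).
    pose proof (h y hy) as h1. pose proof (hnorm_sub y x) as h2.
    pose proof (cauchy_schwarz x (minus y x)) as h3.
    pose proof (Rle_abs (- inner x (minus y x))) as h4. rewrite Rabs_Ropp in h4.
    assert (h5 : norm y <= d + norm x).
    { eapply Rle_trans; [exact h2|]. apply Rplus_le_compat_r, Rlt_le, hxy. }
    assert (h6 : norm x * norm (minus y x) <= norm x * d).
    { apply Rmult_le_compat_l; [exact hx|]. apply Rlt_le, hxy. }
    assert (h7 : M * norm y <= M * (d + norm x)) by now apply Rmult_le_compat_l.
    assert (h8 : (M + norm x + 1) * d = eps) by (unfold d; field; lra).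
    assert (0 < d) by exact p. nra. }
  nra.
Qed.

(** Otherwise the unit ball contains a sequence with [norm (K (x n)) > n], and no subsequence of its
    image converges. Boundedness is the part of [is_linear] that does not follow from algebra. *)
Lemma compact_bounded (K : H -> H) :
  (forall (r : R) x, K (scal r x) = scal r (K x)) -> compact_map K ->
  exists M, 0 < M /\ forall x, norm (K x) <= M * norm x.
Proof.
  intros hs hK.
  destruct (classic (exists M, 0 < M /\ forall x, norm x <= 1 -> norm (K x) <= M)) as [[M [hM hb]]|hn].
  - exists M. split; [exact hM|]. intros x.
    destruct (Req_dec (norm x) 0) as [e|e].
    + assert (x0 : x = zero) by (apply inner_self_zero; rewrite inner_norm, e; ring).
      subst x.
      assert (z : K zero = zero).
      { assert (e0 := hs 0 zero). rewrite (@scal_zero_l R_Ring H) in e0.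
        exact (eq_trans e0 (@scal_zero_l R_Ring H (K zero))). }
      rewrite z, hnorm_zero. lra.
    + pose proof (hnorm_ge_0 x) as hx.
      assert (e1 : norm (scal (/ norm x) x) <= 1).
      { rewrite hnorm_scal, Rabs_pos_eq by (apply Rlt_le, Rinv_0_lt_compat; lra).
        rewrite Rinv_l by exact e. lra. }
      apply hb in e1. rewrite hs, hnorm_scal, Rabs_pos_eq in e1
        by (apply Rlt_le, Rinv_0_lt_compat; lra).
      apply Rmult_le_compat_l with (r := norm x) in e1; [|exact hx].
      rewrite <- Rmult_assoc, Rinv_r, Rmult_1_l in e1 by exact e. lra.
  - exfalso.
    assert (hx : forall n : nat, exists x, norm x <= 1 /\ INR n < norm (K x)).
    { intros n. apply NNPP. intros hx. apply hn. exists (INR n + 1).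
      split; [pose proof (pos_INR n); lra|]. intros x h1.
      apply Rnot_lt_le. intros h2. apply hx. exists x. split; [exact h1|lra]. }
    set (x := fun n => proj1_sig (constructive_indefinite_description _ (hx n))).
    assert (hxs : forall n, norm (x n) <= 1 /\ INR n < norm (K (x n))).
    { intros n. exact (proj2_sig (constructive_indefinite_description _ (hx n))). }
    destruct (hK x 1 (fun n => proj1 (hxs n))) as [phi [y [hphi hlim]]].
    assert (grow : forall n, (n <= phi n)%nat).
    { induction n as [|n IH]; [lia|]. specialize (hphi n). lia. }
    destruct (hlim _ (hlocally_norm_minus y 1 Rlt_0_1)) as [N hN].
    destruct (INR_unbounded (norm y + 1)) as [N' hN'].
    specialize (hN (N + N')%nat ltac:(lia)). cbv beta in hN.
    pose proof (proj2 (hxs (phi (N + N')%nat))) as h1.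
    pose proof (hnorm_sub (K (x (phi (N + N')%nat))) y) as h2.
    assert (h3 : INR N' <= INR (phi (N + N')%nat)).
    { apply le_INR. specialize (grow (N + N')%nat). lia. }
    apply Rlt_le in hN.
    assert (h4 : norm (K (x (phi (N + N')%nat))) <= 1 + norm y).
    { eapply Rle_trans; [exact h2|]. apply Rplus_le_compat_r, hN. }
    lra.
Qed.

(** Linearity, symmetry and positivity pass from [A] to its inverse on writing [x = A (S x)];
    boundedness comes from compactness. *)
Lemma inverse_facts (A : operator H) :
  self_adjoint A -> positive_definite A -> has_compact_inverse A ->
  exists S : H -> H,
    (forall y, dom A (S y) /\ A (S y) = y) /\ (forall x, dom A x -> S (A x) = x) /\
    is_linear S /\ (forall x y, inner (S x) y = inner x (S y)) /\
    (forall x, 0 <= inner x (S x)).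
Proof.
  intros hA hpos [S [h1 [h2 hc]]]. exists S.
  assert (hs : forall (r : R) x, S (scal r x) = scal r (S x)).
  { intros r x. destruct (h1 x) as [dx ex].
    rewrite <- (h2 (scal r (S x))) by now apply dom_scal.
    now rewrite op_scal, ex. }
  destruct (compact_bounded S hs hc) as [M [hM hb]].
  split; [exact h1|]. split; [exact h2|]. split; [|split].
  - split; [|exact hs|now exists M].
    intros x y. destruct (h1 x) as [dx ex], (h1 y) as [dy ey].
    refine (eq_trans _ (h2 (plus (S x) (S y)) (dom_plus H A _ _ dx dy))).
    now rewrite op_plus, ex, ey.
  - intros x y. destruct (h1 x) as [dx ex], (h1 y) as [dy ey].
    rewrite <- ey at 1. rewrite <- ex at 2. symmetry.
    now apply symmetric_of_self_adjoint.
  - intros x. destruct (h1 x) as [dx ex]. rewrite <- ex at 1.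
    destruct (classic (S x = zero)) as [e|e].
    + rewrite e, inner_zero_r. lra.
    + apply Rlt_le. now apply hpos.
Qed.

(** Domination with [theta = 0], [q = 2] bounds [B S] in norm, and with [theta = q = 1] in the form
    of [A]. The constant is [Rabs C] because [dominates] does not fix the sign of [C]. *)
Lemma dominated_facts (A B : operator H) (S : H -> H) :
  self_adjoint A -> self_adjoint B -> (forall x, dom A x -> dom B x) -> dominates A B ->
  (forall y, dom A (S y) /\ A (S y) = y) -> is_linear S ->
  exists c, 0 <= c /\ is_linear (fun x => B (S x)) /\
    (forall x, norm (B (S x)) <= c * norm x) /\
    (forall x y, inner (B (S x)) (S y) = inner (S x) (B (S y))) /\
    (forall x y, Rabs (inner (B (S x)) (S y)) <=
       c * sqrt (inner x (S x)) * sqrt (inner y (S y))).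
Proof.
  intros hA hB hdom [C hC] hS lin. exists (Rabs C).
  assert (hn : forall x, norm (B (S x)) <= Rabs C * norm x).
  { intros x. destruct (hS x) as [dx ex].
    apply (norm_le_of_dense A); [apply hA| |].
    - apply Rmult_le_pos; [apply Rabs_pos|apply hnorm_ge_0].
    - intros v hv. specialize (hC 0%nat 2%nat eq_refl (S x) v dx hv).
      unfold norm_q in hC. simpl in hC. rewrite ex in hC.
      eapply Rle_trans; [apply Rle_abs|]. eapply Rle_trans; [exact hC|].
      apply Rmult_le_compat_r; [apply hnorm_ge_0|].
      apply Rmult_le_compat_r; [apply hnorm_ge_0|]. apply Rle_abs. }
  split; [apply Rabs_pos|]. split; [|split; [exact hn|split]].
  - destruct lin as [lp ls _]. split.
    + intros x y. rewrite lp. apply op_plus; apply hdom, hS.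
    + intros r x. rewrite ls. apply op_scal, hdom, hS.
    + exists (Rabs C + 1). split; [pose proof (Rabs_pos C); lra|]. intros x.
      eapply Rle_trans; [apply hn|]. apply Rmult_le_compat_r; [apply hnorm_ge_0|]. lra.
  - intros x y. apply symmetric_of_self_adjoint; [exact hB| |]; apply hdom, hS.
  - intros x y. destruct (hS x) as [dx ex], (hS y) as [dy ey].
    specialize (hC 1%nat 1%nat eq_refl (S x) (S y) dx dy).
    unfold norm_q in hC. simpl in hC. rewrite ex, ey in hC.
    eapply Rle_trans; [exact hC|].
    apply Rmult_le_compat_r; [apply sqrt_pos|].
    apply Rmult_le_compat_r; [apply sqrt_pos|]. apply Rle_abs.
Qed.

End Operators.

Section Modulus.

Context {H : Hilbert}.
Variable T : R.
Hypothesis T_pos : 0 < T.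

(** Bounded variation on [(0, T]], with a continuous majorant of the variation. The restriction
    [0 < r] leaves a jump at [0] free, and a derivative that blows up like [t ^ (alpha - 1)] is
    allowed, since only a primitive of its bound enters. *)
Definition has_modulus (F : R -> H) : Prop :=
  exists th : R -> R, (forall s, continuous th s) /\ (forall s, s <= 0 -> th s = 0) /\
    forall r s, 0 < r -> r <= s -> s <= T -> norm (minus (F s) (F r)) <= th s - th r.

Lemma has_modulus_const (v : H) : has_modulus (fun _ => v).
Proof.
  exists (fun _ => 0). split; [intros s; apply continuous_const|]. split; [easy|].
  intros r s _ _ _. replace (minus v v) with (zero : H) by vector_ring.
  rewrite hnorm_zero. lra.
Qed.

Lemma has_modulus_minus (F G : R -> H) :
  has_modulus F -> has_modulus G -> has_modulus (fun t => minus (F t) (G t)).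
Proof.
  intros [a [ca [a0 ha]]] [b [cb [b0 hb]]]. exists (fun s => a s + b s). split; [|split].
  - intros s. apply (@continuous_plus _ R_AbsRing R_NormedModule); auto.
  - intros s hs. rewrite a0, b0 by exact hs. ring.
  - intros r s h1 h2 h3.
    replace (minus (minus (F s) (G s)) (minus (F r) (G r)))
      with (minus (minus (F s) (F r)) (minus (G s) (G r))) by vector_ring.
    eapply Rle_trans; [apply hnorm_minus_le|].
    specialize (ha r s h1 h2 h3). specialize (hb r s h1 h2 h3). lra.
Qed.

Lemma has_modulus_plus (F G : R -> H) :
  has_modulus F -> has_modulus G -> has_modulus (fun t => plus (F t) (G t)).
Proof.
  intros [a [ca [a0 ha]]] [b [cb [b0 hb]]]. exists (fun s => a s + b s). split; [|split].
  - intros s. apply (@continuous_plus _ R_AbsRing R_NormedModule); auto.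
  - intros s hs. rewrite a0, b0 by exact hs. ring.
  - intros r s h1 h2 h3.
    replace (minus (plus (F s) (G s)) (plus (F r) (G r)))
      with (plus (minus (F s) (F r)) (minus (G s) (G r))) by vector_ring.
    eapply Rle_trans; [apply hnorm_triangle|].
    specialize (ha r s h1 h2 h3). specialize (hb r s h1 h2 h3). lra.
Qed.

Lemma has_modulus_sum (F : nat -> R -> H) (m : nat) :
  (forall j, (1 <= j <= m)%nat -> has_modulus (F j)) ->
  has_modulus (fun t => sum_n_m (fun j => F j t) 1 m).
Proof.
  induction m as [|m IH]; intros h.
  - destruct (has_modulus_const zero) as [a [ca [a0 ha]]].
    exists a. split; [exact ca|]. split; [exact a0|]. intros r s.
    rewrite !sum_1_0. apply ha.
  - destruct (has_modulus_plus (fun t => sum_n_m (fun j => F j t) 1 m) (F (S m))) as [a [ca [a0 ha]]].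
    + apply IH. intros j hj. apply h. lia.
    + apply h. lia.
    + exists a. split; [exact ca|]. split; [exact a0|]. intros r s.
      rewrite !sum_1_S. apply ha.
Qed.

Lemma has_modulus_scal (b th : R -> R) (v : H) :
  (forall s, continuous th s) -> (forall s, s <= 0 -> th s = 0) ->
  (forall r s, 0 < r -> r <= s -> s <= T -> Rabs (b s - b r) <= th s - th r) ->
  has_modulus (fun t => scal (b t) v).
Proof.
  intros cth th0 hb. exists (fun s => norm v * th s). split; [|split].
  - intros s. apply (continuous_mult (fun _ => norm v)); [apply continuous_const|apply cth].
  - intros s hs. rewrite th0 by exact hs. ring.
  - intros r s h1 h2 h3.
    match goal with |- norm ?z <= _ => replace z with (scal (b s - b r) v) by vector_ring end.
    rewrite hnorm_scal. pose proof (hnorm_ge_0 v). specialize (hb r s h1 h2 h3). nra.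
Qed.

Lemma has_modulus_derive (F F' : R -> H) (th dth : R -> R) :
  (forall s, continuous th s) -> (forall s, s <= 0 -> th s = 0) ->
  (forall s, 0 < s <= T -> is_derive F s (F' s)) ->
  (forall s, 0 < s <= T -> is_derive th s (dth s)) ->
  (forall s, 0 < s <= T -> norm (F' s) <= dth s) -> has_modulus F.
Proof.
  intros cth th0 dF dt hF. exists th. split; [exact cth|]. split; [exact th0|].
  (* Mean value inequality for vectors: the scalar [norm v * th x - inner (F x) v] has nonnegative
     derivative, and for this [v] its increment is [norm v * (th s - th r) - norm v ^ 2]. *)
  intros r s h1 h2 h3. set (v := minus (F s) (F r)).
  assert (dh : forall x, 0 < x <= T ->
    is_derive (fun x => norm v * th x - inner (F x) v) x (norm v * dth x - inner (F' x) v)).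
  { intros x hx. apply (@is_derive_minus R_AbsRing R_NormedModule).
    - now apply is_derive_scal, dt.
    - now apply is_derive_inner_l, dF. }
  destruct (MVT_gen (fun x => norm v * th x - inner (F x) v) r s
    (fun x => norm v * dth x - inner (F' x) v)) as [x [hx e]].
  - rewrite Rmin_left, Rmax_right by lra. intros x hx. apply dh. lra.
  - rewrite Rmin_left, Rmax_right by lra. intros x hx.
    apply continuity_pt_filterlim, (continuous_of_is_derive (V := R_NormedModule) _ _ _ (dh x ltac:(lra))).
  - rewrite Rmin_left, Rmax_right in hx by lra.
    pose proof (inner_le_norm (F' x) v) as q1.
    pose proof (hF x ltac:(lra)) as q2. pose proof (hnorm_ge_0 v) as q3.
    assert (q4 : norm (F' x) * norm v <= dth x * norm v) by now apply Rmult_le_compat_r.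
    assert (q5 : 0 <= (norm v * dth x - inner (F' x) v) * (s - r)) by (apply Rmult_le_pos; lra).
    assert (q6 : inner v v = inner (F s) v - inner (F r) v) by (unfold v at 1; apply inner_minus).
    rewrite inner_norm in q6.
    destruct (Rle_or_lt (norm v) (th s - th r)) as [l|l]; [exact l|].
    (* When [norm v] is zero it cannot be divided out, and [th r <= th s] is obtained from the sign
       of [dth]. *)
    destruct (Req_dec (norm v) 0) as [z|z].
    + exfalso. destruct (MVT_gen th r s dth) as [y [hy e2]].
      * rewrite Rmin_left, Rmax_right by lra. intros y hy. apply dt. lra.
      * rewrite Rmin_left, Rmax_right by lra. intros y hy.
        apply continuity_pt_filterlim, (continuous_of_is_derive (V := R_NormedModule) _ _ _ (dt y ltac:(lra))).
      * rewrite Rmin_left, Rmax_right in hy by lra.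
        pose proof (Rle_trans _ _ _ (hnorm_ge_0 _) (hF y ltac:(lra))).
        assert (0 <= dth y * (s - r)) by (apply Rmult_le_pos; lra). lra.
    + nra.
Qed.

(** The modulus makes [F] Cauchy at [0], so it has a limit [F0] there. Subtracting it splits the
    zero extension of [F] into a jump [F0] at time [0] and a continuous part [F1], frozen after [T]:
    the shape that [forcing] integrates. *)
Lemma has_modulus_extension (F : R -> H) : has_modulus F ->
  exists (F0 : H) (F1 : R -> H) (th : R -> R),
    (forall s, continuous F1 s) /\ (forall s, continuous th s) /\
    (forall s, s <= 0 -> F1 s = zero) /\ (forall s, s <= 0 -> th s = 0) /\
    (forall s r, r <= s -> norm (minus (F1 s) (F1 r)) <= th s - th r) /\
    (forall t, 0 < t <= T -> F t = plus F0 (F1 t)).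
Proof.
  intros [a [ca [a0 ha]]].
  assert (lim : exists F0 : H, filterlim F (at_right 0) (locally F0)).
  { apply (filterlim_locally_cauchy (U := H)). intros eps.
    assert (h2 : 0 < eps / 2) by (pose proof (cond_pos eps); lra).
    assert (c0 : continuous (a : R -> R_NormedModule) 0) by apply ca.
    destruct (continuous_norm_minus (V := R_NormedModule) a 0 (eps / 2) c0 h2) as [d hd].
    assert (hm : 0 < Rmin d T) by (apply Rmin_pos; [apply cond_pos|exact T_pos]).
    exists (fun x => 0 < x < Rmin d T). split.
    - exists (mkposreal _ hm). intros y hy h. change (Rabs (y - 0) < Rmin d T) in hy.
      apply Rabs_def2 in hy. lra.
    - assert (key : forall x, 0 < x < Rmin d T -> Rabs (a x) < eps / 2).
      { intros x hx. pose proof (Rmin_l d T).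
        assert (b : ball 0 d x) by (change (Rabs (x - 0) < d); rewrite Rabs_pos_eq; lra).
        specialize (hd x b). change (Rabs (a x - a 0) < eps / 2) in hd.
        now rewrite (a0 0 (Rle_refl 0)), Rminus_0_r in hd. }
      assert (ord : forall x y, 0 < x < Rmin d T -> 0 < y < Rmin d T -> x <= y ->
                norm (minus (F y) (F x)) < eps).
      { intros x y hx hy hxy. pose proof (Rmin_r d T).
        eapply Rle_lt_trans; [apply ha; lra|].
        pose proof (key x hx) as k1. pose proof (key y hy) as k2.
        apply Rabs_def2 in k1. apply Rabs_def2 in k2. lra. }
      intros x y hx hy. destruct (Rle_or_lt x y) as [l|l].
      + apply hnorm_compat1. now apply ord.
      + apply ball_sym, hnorm_compat1. apply ord; auto. lra. }
  destruct lim as [F0 lim].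
  (* The modulus inequality with its left end sent to [0]. *)
  assert (near : forall s, 0 < s <= T -> norm (minus (F s) F0) <= a s).
  { intros s hs. apply le_epsilon. intros eps he.
    assert (he2 : 0 < eps / 2) by lra.
    assert (c0 : continuous (a : R -> R_NormedModule) 0) by apply ca.
    destruct (continuous_norm_minus (V := R_NormedModule) a 0 (eps / 2) c0 he2) as [d hd].
    destruct (lim _ (hlocally_norm_minus F0 (eps / 2) he2)) as [d' hd'].
    assert (hm : 0 < Rmin s (Rmin d d')).
    { apply Rmin_pos; [lra|]. apply Rmin_pos; apply cond_pos. }
    set (x := Rmin s (Rmin d d') / 2).
    pose proof (Rmin_l s (Rmin d d')). pose proof (Rmin_r s (Rmin d d')).
    pose proof (Rmin_l d d'). pose proof (Rmin_r d d').
    assert (hx : Rabs (x - 0) = x) by (rewrite Rminus_0_r; apply Rabs_pos_eq; unfold x; lra).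
    assert (b1 : ball 0 d x) by (change (Rabs (x - 0) < d); rewrite hx; unfold x; lra).
    assert (b2 : ball 0 d' x) by (change (Rabs (x - 0) < d'); rewrite hx; unfold x; lra).
    specialize (hd x b1). specialize (hd' x b2 ltac:(unfold x; lra)).
    change (Rabs (a x - a 0) < eps / 2) in hd. rewrite (a0 0 (Rle_refl 0)), Rminus_0_r in hd.
    apply Rabs_def2 in hd.
    change (norm (minus (F x) F0) < eps / 2) in hd'.
    replace (minus (F s) F0) with (plus (minus (F s) (F x)) (minus (F x) F0)) by vector_ring.
    eapply Rle_trans; [apply hnorm_triangle|].
    pose proof (ha x s ltac:(unfold x; lra) ltac:(unfold x; lra) ltac:(lra)). lra. }
  set (th := fun s => a (Rmin s T)).
  set (F1 := (fun t => if Rle_dec t 0 then zero else minus (F (Rmin t T)) F0) : R -> H).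
  assert (cth : forall s, continuous th s).
  { intros s. apply (continuous_comp (fun s => Rmin s T) a); [apply continuous_Rmin_const|apply ca]. }
  assert (F1_0 : forall s, s <= 0 -> F1 s = zero).
  { intros s hs. unfold F1. destruct (Rle_dec s 0); [easy|lra]. }
  assert (F1_1 : forall s, 0 < s -> F1 s = minus (F (Rmin s T)) F0).
  { intros s hs. unfold F1. destruct (Rle_dec s 0); [lra|easy]. }
  assert (th0 : forall s, s <= 0 -> th s = 0).
  { intros s hs. unfold th. rewrite Rmin_left by lra. now apply a0. }
  assert (hth : forall s r, r <= s -> norm (minus (F1 s) (F1 r)) <= th s - th r).
  { intros s r hrs. destruct (Rle_or_lt s 0) as [l|l].
    - rewrite !F1_0, !th0 by lra.
      match goal with |- norm ?z <= _ => replace z with (zero : H) by vector_ring end.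
      rewrite hnorm_zero. lra.
    - assert (ms : 0 < Rmin s T <= T) by (split; [apply Rmin_pos; lra|apply Rmin_r]).
      rewrite (F1_1 s l). destruct (Rle_or_lt r 0) as [l'|l'].
      + rewrite (F1_0 r l'), (th0 r l').
        match goal with |- norm ?z <= _ =>
          replace z with (minus (F (Rmin s T)) F0) by vector_ring end.
        pose proof (near _ ms). unfold th. lra.
      + rewrite (F1_1 r l').
        replace (minus (minus (F (Rmin s T)) F0) (minus (F (Rmin r T)) F0))
          with (minus (F (Rmin s T)) (F (Rmin r T))) by vector_ring.
        apply ha; [apply Rmin_pos; lra| |apply Rmin_r].
        now apply Rle_min_compat_r. }
  exists F0, F1, th. split.
  { intros t. apply (hcontinuous_of_norm_minus F1 t). intros eps he.
    assert (ct : continuous (th : R -> R_NormedModule) t) by apply cth.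
    generalize (continuous_norm_minus (V := R_NormedModule) th t eps ct he).
    apply filter_imp. intros y hy. change (Rabs (th y - th t) < eps) in hy.
    apply Rabs_def2 in hy. destruct (Rle_or_lt t y) as [l|l].
    - eapply Rle_trans; [now apply hth|]. lra.
    - replace (minus (F1 y) (F1 t)) with (opp (minus (F1 t) (F1 y))) by vector_ring.
      rewrite hnorm_opp. eapply Rle_trans; [apply hth; lra|]. lra. }
  split; [exact cth|]. split; [exact F1_0|]. split; [exact th0|]. split; [exact hth|].
  intros t ht. rewrite F1_1, Rmin_left by lra. vector_ring.
Qed.

End Modulus.

(** * From the classical solution to the weak equation *)

Section Solution.

Context {H : Hilbert}.
Variable m : nat.
Variables kappa T lam : R.
Variable alpha : nat -> R.
Variable A : operator H.
Variable B : nat -> operator H.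
Variables f u u1 : R -> H.
Variable u0 : H.
Variable S : H -> H.
Variable c : nat -> R.
Hypothesis T_pos : 0 < T.
Hypothesis lam_nonneg : 0 <= lam.
Hypothesis alpha_pos : forall j, (1 <= j <= m)%nat -> 0 < alpha j.
Hypothesis A_sa : self_adjoint A.
Hypothesis AS : forall y, dom A (S y) /\ A (S y) = y.
Hypothesis SA : forall x, dom A x -> S (A x) = x.
Hypothesis S_linear : is_linear S.
Hypothesis S_sym : forall x y, inner (S x) y = inner x (S y).
Hypothesis S_pos : forall x, 0 <= inner x (S x).
Hypothesis B_sa : forall j, (1 <= j <= m)%nat -> self_adjoint (B j).
Hypothesis B_dom : forall j, (1 <= j <= m)%nat -> forall x, dom A x -> dom (B j) x.
Hypothesis c_nonneg : forall j, (1 <= j <= m)%nat -> 0 <= c j.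
Hypothesis Q_linear : forall j, (1 <= j <= m)%nat -> is_linear (fun x => B j (S x)).
Hypothesis Q_norm : forall j, (1 <= j <= m)%nat ->
  forall x, norm (B j (S x)) <= c j * norm x.
Hypothesis Q_sym : forall j, (1 <= j <= m)%nat ->
  forall x y, inner (B j (S x)) (S y) = inner (S x) (B j (S y)).
Hypothesis Q_form : forall j, (1 <= j <= m)%nat -> forall x y,
  Rabs (inner (B j (S x)) (S y)) <= c j * sqrt (inner x (S x)) * sqrt (inner y (S y)).

Let ker (j : nat) : R -> R := kern T (kappa + lam) (alpha j) (Gamma (alpha j)).
Let del (j : nat) : R -> R := lag T (alpha j).
Let mass (j : nat) (t : R) : R := RInt (ker j) 0 (phase T (alpha j) t).

Hypothesis small :
  sum_n_m (fun j => c j * RInt (fun r => Rabs (ker j r)) 0 1) 1 m <= 1 / 2.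
Hypothesis hu0 : dom A u0.
Hypothesis hu : is_solution A m B kappa alpha f u0 u u1.

Definition scaled (t : R) : H := minus (scal (exp (- lam * t)) (u t)) u0.

(** Zero before time [0], so that delays reaching back that far contribute nothing; frozen after
    [T], since only [(0, T]] matters. The subtraction of [u0] in [scaled] makes it continuous at
    [0]. *)
Definition scaled_ext (t : R) : H :=
  if Rle_dec t 0 then zero else scaled (Rmin t T).

Definition scaled' (t : R) : H :=
  scal (exp (- lam * t)) (minus (u1 t) (scal lam (u t))).

(** The right side left after multiplying the equation by [exp (- lam * t)] and writing the new
    unknown as [scaled t + u0]. The factor [mass j t] of [B j u0] is the integral of the shifted
    kernel over [(0, t)]. *)
Definition source (t : R) : H :=
  minus (minus (minus (scal (exp (- lam * t)) (f t)) (scal lam u0)) (A u0))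
    (sum_n_m (fun j => scal (mass j t) (B j u0) : H) 1 m).

Lemma ker_cont j : (1 <= j <= m)%nat -> forall r, continuous (ker j) r.
Proof. intros hj r. apply continuous_kern. now apply alpha_pos. Qed.

Lemma del_cont j : (1 <= j <= m)%nat -> forall r, continuous (del j) r.
Proof. intros hj r. apply continuous_lag_fun. now apply alpha_pos. Qed.

Lemma del_nonneg j : forall r, 0 <= del j r.
Proof. intros r. now apply lag_nonneg. Qed.

Lemma scaled_ext_past t : t <= 0 -> scaled_ext t = zero.
Proof. intros h. unfold scaled_ext. destruct (Rle_dec t 0); [easy|lra]. Qed.

Lemma scaled_ext_eq t : 0 < t <= T -> scaled_ext t = scaled t.
Proof.
  intros h. unfold scaled_ext. destruct (Rle_dec t 0); [lra|]. now rewrite Rmin_left by lra.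
Qed.

Lemma is_derive_scaled t : 0 < t -> is_derive scaled t (scaled' t).
Proof.
  intros h.
  assert (e : is_derive (fun t => exp (- lam * t)) t (- lam * exp (- lam * t))).
  { auto_derive; [easy|ring]. }
  replace (scaled' t) with (minus (plus (scal (- lam * exp (- lam * t)) (u t))
    (scal (exp (- lam * t)) (u1 t))) zero) by (unfold scaled'; vector_ring).
  apply (@is_derive_minus R_AbsRing H).
  - apply (is_derive_scal_fun (fun t => exp (- lam * t)) u); [exact e|]. exact (sol_derive _ _ _ _ _ _ _ _ _ hu t h).
  - apply (@is_derive_const R_AbsRing H).
Qed.

Lemma continuous_scaled_ext t : continuous scaled_ext t.
Proof.
  destruct (Rtotal_order t 0) as [l|[l|l]].
  - apply (continuous_ext_loc _ (fun _ => zero : H)); [|apply (@continuous_const _ H)].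
    assert (p : 0 < - t) by lra. exists (mkposreal _ p). intros y hy.
    change (Rabs (y - t) < - t) in hy. apply Rabs_def2 in hy. rewrite scaled_ext_past by lra. easy.
  - subst t. apply (hcontinuous_of_norm_minus scaled_ext 0). intros eps he.
    rewrite (scaled_ext_past 0 (Rle_refl 0)).
    assert (lim : filterlim scaled (at_right 0) (locally (minus (scal (exp (- lam * 0)) u0) u0))).
    { assert (ce : filterlim (fun t => exp (- lam * t)) (at_right 0) (locally (exp (- lam * 0)))).
      { eapply filterlim_filter_le_1; [apply filter_le_within|].
        apply (continuous_comp (fun t => - lam * t) exp).
        - apply (continuous_mult (fun _ => - lam)); [apply continuous_const|apply continuous_id].
        - apply continuous_exp. }
      apply (filterlim_comp_2 (G := locally (scal (exp (- lam * 0)) u0)) (H := locally (opp u0))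
        (fun t => scal (exp (- lam * t)) (u t)) (fun _ => opp u0) plus).
      - apply (filterlim_comp_2 (G := locally (exp (- lam * 0))) (H := locally u0)
          (fun t => exp (- lam * t)) u scal); [exact ce|exact (sol_cont0 _ _ _ _ _ _ _ _ _ hu)|].
        apply (@filterlim_scal R_AbsRing H).
      - apply filterlim_const.
      - apply (@filterlim_plus R_AbsRing H). }
    destruct (lim _ (hlocally_norm_minus _ eps he)) as [d hd].
    assert (hm : 0 < Rmin d T) by (apply Rmin_pos; [apply cond_pos|exact T_pos]).
    pose proof (Rmin_l d T). pose proof (Rmin_r d T).
    exists (mkposreal _ hm). intros y hy. change (Rabs (y - 0) < Rmin d T) in hy.
    destruct (Rle_or_lt y 0) as [q|q].
    + rewrite scaled_ext_past by exact q.
      match goal with |- norm ?z <= _ => replace z with (zero : H) by vector_ring end.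
      rewrite hnorm_zero. lra.
    + specialize (hd y). apply Rabs_def2 in hy. rewrite scaled_ext_eq by lra.
      apply Rlt_le. eapply Rle_lt_trans; [|apply hd; [|exact q]].
      * apply Req_le, (f_equal (@norm R_AbsRing H)). rewrite Rmult_0_r, exp_0. vector_ring.
      * change (Rabs (y - 0) < d). apply Rabs_def1; lra.
  - apply (continuous_ext_loc _ (fun s => scaled (Rmin s T))).
    + exists (mkposreal t l). intros y hy. change (Rabs (y - t) < t) in hy.
      apply Rabs_def2 in hy. unfold scaled_ext. destruct (Rle_dec y 0); [lra|easy].
    + apply (continuous_comp (fun s => Rmin s T) scaled); [apply continuous_Rmin_const|].
      apply (continuous_of_is_derive scaled _ _ (is_derive_scaled _ (Rmin_pos _ _ l T_pos))).
Qed.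

(** Self-adjointness moves [B j] onto [S v], so the integrand is the singular kernel times a
    continuous scalar, however [B j (u s)] behaves as [s -> 0]. The constant [u0] split off from the
    unknown produces the term with [mass]. *)
Lemma memory_term j t v : (1 <= j <= m)%nat -> 0 < t <= T ->
  exp (- lam * t) *
    inner (RInt_gen (memory kappa (alpha j) (B j) u t) (at_right 0) (at_left t)) (S v) =
  rconv (ker j) (del j) (fun s => inner (scaled_ext s) (B j (S v))) t +
  mass j t * inner (B j u0) (S v).
Proof.
  intros hj ht.
  pose proof (RInt_gen_correct (Fa := at_right 0) (Fb := at_left t) _
    (sol_memory _ _ _ _ _ _ _ _ _ hu t j (proj1 ht) hj)) as g.
  apply (is_RInt_gen_inner _ _ _ _ (S v)) in g.
  apply (is_RInt_gen_scal (V := R_NormedModule) _ (exp (- lam * t))) in g.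
  set (w := B j (S v)) in *.
  set (psi := fun s => inner (plus (scaled_ext s) u0) w).
  assert (cpsi : forall s, continuous psi s).
  { intros s. apply (continuous_inner (fun s => plus (scaled_ext s) u0) (fun _ => w)).
    - apply (@continuous_plus _ R_AbsRing H); [apply continuous_scaled_ext|].
      apply (@continuous_const _ H).
    - apply (@continuous_const _ H). }
  assert (g2 : is_RInt_gen (fun s => exp (- (kappa + lam) * (t - s)) * Rpower (t - s) (alpha j - 1)
     / Gamma (alpha j) * psi s) (at_right 0) (at_left t)
     (exp (- lam * t) * inner (RInt_gen (memory kappa (alpha j) (B j) u t) (at_right 0) (at_left t)) (S v))).
  { eapply is_RInt_gen_ext; [|exact g].
    generalize (filter_prod_ends t (proj1 ht)). apply filter_imp.
    intros [x y] [hx hy] s hs. simpl in hx, hy, hs.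
    assert (hs' : 0 < s < t).
    { split.
      - eapply Rlt_trans; [|exact (proj1 hs)]. apply Rmin_pos; lra.
      - eapply Rlt_trans; [exact (proj2 hs)|]. apply Rmax_lub_lt; lra. }
    assert (hdom := sol_dom _ _ _ _ _ _ _ _ _ hu s (proj1 hs')).
    unfold psi. rewrite scaled_ext_eq by lra.
    replace (inner (plus (scaled s) u0) w) with (exp (- lam * s) * inner (u s) w)
      by (unfold scaled; fold_vector_ops; repeat progress inner_simpl; ring).
    unfold memory, beta. rewrite inner_scal.
    rewrite (symmetric_of_self_adjoint (B j) (S v) (u s)); [|auto|apply B_dom; auto; apply AS|auto].
    fold w. change (exp (- lam * t) *
      (exp (- kappa * (t - s)) * Rpower (t - s) (alpha j - 1) / Gamma (alpha j) * inner (u s) w) =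
      exp (- (kappa + lam) * (t - s)) * Rpower (t - s) (alpha j - 1) / Gamma (alpha j) *
        (exp (- lam * s) * inner (u s) w)).
    (* The weight at [t] is shared between the kernel and the unknown at [s], which turns [kappa]
       into [kappa + lam]. *)
    assert (e : exp (- lam * t) * exp (- kappa * (t - s)) =
      exp (- (kappa + lam) * (t - s)) * exp (- lam * s)).
    { rewrite <- !exp_plus. f_equal. ring. }
    unfold Rdiv.
    transitivity (exp (- lam * t) * exp (- kappa * (t - s)) *
      (Rpower (t - s) (alpha j - 1) * / Gamma (alpha j) * inner (u s) w)); [ring|].
    rewrite e. ring. }
  pose proof (alpha_pos j hj) as ha.
  rewrite (is_RInt_gen_kernel T _ _ _ T_pos ha psi t _ cpsi (proj1 ht) g2). fold (ker j) (del j).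
  set (X := fun s => inner (scaled_ext s) w).
  assert (cX : forall s, continuous X s).
  { intros s. apply (continuous_inner scaled_ext (fun _ => w)); [apply continuous_scaled_ext|].
    apply (@continuous_const _ H). }
  assert (exX : forall a b, ex_RInt (fun r => ker j r * X (t - del j r)) a b).
  { intros a b. apply ex_rconv; auto using ker_cont, del_cont. }
  assert (exk : forall a b, ex_RInt (ker j) a b).
  { intros a b. apply ex_RInt_cont_R. now apply ker_cont. }
  set (p := phase T (alpha j) t).
  assert (hp : 0 <= p <= 1).
  { split; [apply pow0_nonneg|apply phase_le_1; lra]. }
  (* For [r > phase t] the delayed time is at most [0], where [scaled_ext] vanishes, so integrating
     up to [phase t] or up to [1] is the same. *)
  assert (tail : rconv (ker j) (del j) X t = RInt (fun r => ker j r * X (t - del j r)) 0 p).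
  { unfold rconv. rewrite <- (@RInt_Chasles R_CompleteNormedModule _ 0 p 1) by apply exX.
    rewrite (RInt_ext (fun r => ker j r * X (t - del j r)) (fun _ => 0) p 1).
    - rewrite RInt_const_R, Rmult_0_r. apply Rplus_0_r.
    - intros r hr. rewrite Rmin_left, Rmax_right in hr by lra.
      unfold X. rewrite scaled_ext_past.
      + rewrite inner_zero. apply Rmult_0_r.
      + assert (t <= del j r); [|lra].
        apply lag_ge; try lra. fold p. lra. }
  rewrite tail.
  assert (e0 : inner (B j u0) (S v) = inner u0 w).
  { apply symmetric_of_self_adjoint; auto. apply B_dom; auto. apply AS. }
  rewrite e0. apply is_RInt_unique.
  apply (is_RInt_ext (fun r => plus (ker j r * X (t - del j r)) (scal (inner u0 w) (ker j r)))).
  - intros r _. unfold psi. rewrite inner_plus. fold (X (t - del j r)).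
    unfold plus, scal; simpl. unfold mult; simpl. rewrite Rmult_plus_distr_l.
    f_equal. apply Rmult_comm.
  - apply (@is_RInt_plus R_NormedModule).
    + apply RInt_correct_R, exX.
    + rewrite Rmult_comm. apply (@is_RInt_scal R_NormedModule). apply RInt_correct_R, exk.
Qed.

(** Symmetry gives [inner (A x) (S v) = inner x v] on the domain, which removes [A] altogether. *)
Lemma weak_equation t v : 0 < t <= T ->
  inner (scaled' t) (S v) + lam * inner (scaled_ext t) (S v) + inner (scaled_ext t) v +
  sum_n_m (fun j => rconv (ker j) (del j)
    (fun s => inner (scaled_ext s) (B j (S v))) t) 1 m
  = inner (source t) (S v).
Proof.
  intros ht.
  pose proof (f_equal (fun x => exp (- lam * t) * inner x (S v))
    (sol_eq _ _ _ _ _ _ _ _ _ hu t (proj1 ht))) as e.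
  cbv beta in e. rewrite !inner_plus, inner_sum_1 in e.
  assert (hdom := sol_dom _ _ _ _ _ _ _ _ _ hu t (proj1 ht)).
  assert (eA : forall x, dom A x -> inner (A x) (S v) = inner x v).
  { intros x hx. destruct (AS v) as [dv ev].
    rewrite <- ev at 2. now apply symmetric_of_self_adjoint. }
  rewrite (eA _ hdom) in e.
  rewrite !scaled_ext_eq by exact ht.
  rewrite (sum_n_m_ext_loc (fun j => rconv (ker j) (del j)
    (fun s => inner (scaled_ext s) (B j (S v))) t)
    (fun j => inner (RInt_gen (memory kappa (alpha j) (B j) u t) (at_right 0) (at_left t)) (S v) *
      exp (- lam * t) - mass j t * inner (B j u0) (S v))).
  2:{ intros j hj. pose proof (memory_term j t v hj ht) as q.
      match goal with |- ?a = ?b => change (@eq R a b) end. lra. }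
  rewrite sum_1_minus, sum_1_mult_r.
  unfold scaled', source, scaled. fold_vector_ops. rewrite !inner_scal, !inner_minus, inner_sum_1.
  rewrite (sum_n_m_ext (fun j => inner (scal (mass j t) (B j u0)) (S v))
    (fun j => mass j t * inner (B j u0) (S v)) 1 m) by (intros j; apply inner_scal).
  rewrite !inner_scal, (eA _ hu0). lra.
Qed.

Lemma dom_scaled t : 0 < t -> dom A (scaled t).
Proof.
  intros ht.
  replace (scaled t) with (plus (scal (exp (- lam * t)) (u t)) (scal (-1) u0))
    by (unfold scaled; vector_ring).
  apply dom_plus; apply dom_scal; [|exact hu0].
  exact (sol_dom _ _ _ _ _ _ _ _ _ hu t ht).
Qed.

(** The Lipschitz bounds of [regularity] become pointwise ones. The first two constants are explicit
    so that they can be seen to vanish with the source; then [scaled] is zero and so is its image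
    under [A]. *)
Lemma solution_bounds (F0 : H) (F1 : R -> H) (th : R -> R) :
  (forall s, continuous F1 s) -> (forall s, continuous th s) ->
  (forall s, s <= 0 -> F1 s = zero) -> (forall s, s <= 0 -> th s = 0) ->
  (forall s r, r <= s -> norm (minus (F1 s) (F1 r)) <= th s - th r) ->
  (forall t, 0 < t <= T -> source t = plus F0 (F1 t)) ->
  (forall t, 0 < t <= T -> norm (scaled' t) <= 2 * (norm F0 + th T)) /\
  (forall t, 0 < t <= T -> norm (scaled t) <= 2 * (norm F0 + th T) * t) /\
  exists C, forall t, 0 < t <= T -> norm (A (scaled t)) <= C.
Proof.
  intros cF1 cth F10 th0 hth hF.
  assert (L0 : 0 <= norm F0 + th T).
  { apply Rplus_le_le_0_compat; [apply hnorm_ge_0|].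
    pose proof (Rle_trans _ _ _ (hnorm_ge_0 _) (hth T 0 (Rlt_le _ _ T_pos))) as q.
    rewrite (th0 0) in q by lra. lra. }
  destruct (regularity S m (fun j x => B j (S x)) ker del c S_linear S_sym S_pos
    ker_cont del_cont (fun j _ => del_nonneg j) c_nonneg Q_linear Q_norm Q_sym Q_form small
    F0 F1 th cF1 cth F10 th0 hth T lam scaled_ext (Rlt_le _ _ T_pos) lam_nonneg
    continuous_scaled_ext scaled_ext_past) as [hlip [phi [C [hS hphi]]]].
  { intros t ht. exists (scaled' t). split.
    - apply (is_derive_ext_loc scaled); [|apply is_derive_scaled; lra].
      assert (p : 0 < Rmin t (T - t)) by (apply Rmin_pos; lra).
      exists (mkposreal _ p). intros y hy. change (Rabs (y - t) < Rmin t (T - t)) in hy.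
      apply Rabs_def2 in hy. pose proof (Rmin_l t (T - t)). pose proof (Rmin_r t (T - t)).
      symmetry. apply scaled_ext_eq. lra.
    - intros v. rewrite <- hF by lra. apply weak_equation. lra. }
  split; [|split].
  (* Steps [h < t] keep both points in [(0, T]], where [scaled_ext] agrees with [scaled]. *)
  - intros t ht. apply (norm_derive_le scaled t t); [now apply is_derive_scaled|lra|lra|].
    intros h hh. pose proof (hlip t h (proj2 ht) (proj1 hh)) as q.
    unfold dif in q. rewrite !scaled_ext_eq in q by lra. exact q.
  (* The step [h = t] compares with the value [zero] at time [0]. *)
  - intros t ht. pose proof (hlip t t (proj2 ht) (proj1 ht)) as q.
    unfold dif in q. rewrite scaled_ext_eq, Rminus_diag, (scaled_ext_past 0) in q by lra.
    eapply Rle_trans; [|exact q]. apply Req_le, (f_equal (@norm R_AbsRing H)). vector_ring.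
  - exists C. intros t ht.
    assert (C0 : 0 <= C).
    { pose proof (Rle_trans _ _ _ (hnorm_ge_0 _) (hphi t 1 (proj2 ht) Rlt_0_1)). lra. }
    pose proof (dom_scaled t (proj1 ht)) as hdom.
    apply (norm_le_of_dense A); [apply A_sa|exact C0|].
    intros x hx. rewrite (symmetric_of_self_adjoint A x (scaled t) A_sa hx hdom).
    rewrite <- scaled_ext_eq by exact ht.
    eapply Rle_trans; [apply Rle_abs|].
    (* With [RInt scaled_ext 0 s = S (phi s)] this function equals [inner (phi s) x], which is
       Lipschitz with constant [C * norm x]. Its derivative at [t] is [inner (scaled_ext t) (A x)],
       so [phi] need not be differentiable. *)
    apply (Rabs_derive_le (fun s => inner (RInt scaled_ext 0 s) (A x)) t 1).
    + apply is_derive_inner_l, is_derive_primitive. apply continuous_scaled_ext.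
    + lra.
    + intros h hh. rewrite <- !hS by lra.
      rewrite !S_sym, (SA x hx), <- inner_minus.
      eapply Rle_trans; [apply cauchy_schwarz|].
      pose proof (hphi t h (proj2 ht) (proj1 hh)) as q. unfold dif in q.
      pose proof (hnorm_ge_0 x). nra.
Qed.

Lemma u_of_scaled t : u t = scal (exp (lam * t)) (plus (scaled t) u0).
Proof.
  assert (e : exp (lam * t) * exp (- lam * t) = 1).
  { rewrite <- exp_plus, <- exp_0. f_equal. ring. }
  apply inner_ext. intros v. unfold scaled. fold_vector_ops. repeat progress inner_simpl.
  transitivity (exp (lam * t) * exp (- lam * t) * inner (u t) v); [rewrite e|]; ring.
Qed.

Lemma u1_of_scaled t : u1 t = plus (scal (exp (lam * t)) (scaled' t)) (scal lam (u t)).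
Proof.
  assert (e : exp (lam * t) * exp (- lam * t) = 1).
  { rewrite <- exp_plus, <- exp_0. f_equal. ring. }
  apply inner_ext. intros v. unfold scaled'. fold_vector_ops. repeat progress inner_simpl.
  transitivity (exp (lam * t) * exp (- lam * t) * (inner (u1 t) v - lam * inner (u t) v) +
    lam * inner (u t) v); [rewrite e|]; ring.
Qed.

Lemma op_u_of_scaled t : 0 < t -> A (u t) = scal (exp (lam * t)) (plus (A (scaled t)) (A u0)).
Proof.
  intros ht. pose proof (dom_scaled t ht) as hd.
  rewrite u_of_scaled. rewrite op_scal by now apply dom_plus. now rewrite op_plus.
Qed.

Lemma unscaled_bound N1 N2 N3 t : 0 < t <= T -> norm (scaled' t) <= N1 ->
  norm (scaled t) <= N2 -> norm (A (scaled t)) <= N3 ->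
  norm (u1 t) + norm (A (u t)) <=
  exp (lam * T) * (N1 + lam * (N2 + norm u0) + (N3 + norm (A u0))).
Proof.
  intros ht h1 h2 h3.
  assert (e : 0 < exp (lam * t) <= exp (lam * T)).
  { split; [apply exp_pos|]. destruct (Rmult_le_compat_l lam t T lam_nonneg (proj2 ht)) as [q|q].
    - now apply Rlt_le, exp_increasing.
    - rewrite q. apply Rle_refl. }
  assert (nu : norm (u t) <= exp (lam * T) * (N2 + norm u0)).
  { rewrite u_of_scaled, hnorm_scal, Rabs_pos_eq by lra.
    apply Rmult_le_compat; [lra|apply hnorm_ge_0|lra|].
    eapply Rle_trans; [apply hnorm_triangle|lra]. }
  assert (nu1 : norm (u1 t) <= exp (lam * T) * N1 + lam * (exp (lam * T) * (N2 + norm u0))).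
  { rewrite u1_of_scaled. eapply Rle_trans; [apply hnorm_triangle|].
    rewrite !hnorm_scal, !Rabs_pos_eq by lra. apply Rplus_le_compat.
    - apply Rmult_le_compat; [lra|apply hnorm_ge_0|lra|exact h1].
    - now apply Rmult_le_compat_l. }
  assert (nA : norm (A (u t)) <= exp (lam * T) * (N3 + norm (A u0))).
  { rewrite op_u_of_scaled, hnorm_scal, Rabs_pos_eq by lra.
    apply Rmult_le_compat; [lra|apply hnorm_ge_0|lra|].
    eapply Rle_trans; [apply hnorm_triangle|lra]. }
  lra.
Qed.

End Solution.

(** * Moduli of the terms of the source, and the conclusion *)

Lemma kernel_mass_dif (T kap a gam r s : R) : 0 < T -> 0 <= kap -> 0 < a -> r <= s ->
  Rabs (RInt (kern T kap a gam) 0 (phase T a s) - RInt (kern T kap a gam) 0 (phase T a r))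
  <= Rabs (amplitude T a gam) * phase T a s - Rabs (amplitude T a gam) * phase T a r.
Proof.
  intros hT hk ha hrs.
  set (k := kern T kap a gam).
  assert (ck : forall r, continuous k r) by (intros x; now apply continuous_kern).
  assert (hp : phase T a r <= phase T a s) by now apply phase_mono.
  assert (e0 : @eq R (RInt k 0 (phase T a s) - RInt k 0 (phase T a r))
    (RInt k (phase T a r) (phase T a s))).
  { pose proof (RInt_Chasles_R k 0 (phase T a r) (phase T a s) ck). lra. }
  rewrite e0.
  assert (e : is_RInt (fun _ => Rabs (amplitude T a gam)) (phase T a r) (phase T a s)
    ((phase T a s - phase T a r) * Rabs (amplitude T a gam)))
    by apply (@is_RInt_const R_NormedModule).
  refine (Rle_trans _ _ _ (norm_RInt_le (V := R_NormedModule) k _ _ _ _ _ hp _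
    (RInt_correct_R _ _ _ (ex_RInt_cont_R k _ _ ck)) e) _).
  - intros x _. now apply kern_abs_le.
  - lra.
Qed.

Lemma has_modulus_ext {H : Hilbert} (T : R) (F G : R -> H) :
  (forall t, 0 < t <= T -> F t = G t) -> has_modulus T F -> has_modulus T G.
Proof.
  intros e [a [ca [a0 ha]]]. exists a. split; [exact ca|]. split; [exact a0|].
  intros r s h1 h2 h3. rewrite <- !e by lra. now apply ha.
Qed.

(** By the product rule the derivative is at most [kap * K + K * t ^ (a - 1)]. Its primitive
    [kap * K * t + K / a * t ^ a] is continuous at [0] because [a > 0], and serves as the modulus;
    [Rmax t 0] and [pow0] extend it by zero. *)
Lemma has_modulus_weighted {H : Hilbert} (T kap K a : R) (g g1 : R -> H) :
  0 < T -> 0 <= kap -> 0 < a ->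
  (forall t, 0 < t <= T -> is_derive g t (g1 t)) ->
  (forall t, 0 < t <= T -> norm (g t) <= K) ->
  (forall t, 0 < t <= T -> norm (g1 t) <= K * Rpower t (a - 1)) ->
  has_modulus T (fun t => scal (exp (- kap * t)) (g t)).
Proof.
  intros hT hk ha dg hg hg1.
  assert (K0 : 0 <= K) by exact (Rle_trans _ _ _ (hnorm_ge_0 _) (hg T ltac:(lra))).
  apply (has_modulus_derive T _
    (fun t => plus (scal (- kap * exp (- kap * t)) (g t)) (scal (exp (- kap * t)) (g1 t)))
    (fun t => kap * K * Rmax t 0 + K / a * pow0 a t)
    (fun t => kap * K * 1 + K / a * (a * Rpower t (a - 1)))).
  - intros s. apply (@continuous_plus _ R_AbsRing R_NormedModule).
    + apply (continuous_mult (fun _ => kap * K)); [apply continuous_const|apply continuous_Rmax_const].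
    + apply (continuous_mult (fun _ => K / a)); [apply continuous_const|now apply continuous_pow0].
  - intros s hs. rewrite Rmax_right, pow0_neg by exact hs. ring.
  - intros s hs. apply (is_derive_scal_fun (fun t => exp (- kap * t)) g); [|now apply dg].
    auto_derive; [easy|ring].
  - intros s hs. apply (@is_derive_plus R_AbsRing R_NormedModule); apply is_derive_scal.
    + apply (is_derive_ext_loc (fun t => t)).
      * exists (mkposreal s (proj1 hs)). intros y hy. change (Rabs (y - s) < s) in hy.
        apply Rabs_def2 in hy. now rewrite Rmax_left by lra.
      * apply (@is_derive_id R_AbsRing).
    + now apply is_derive_pow0.
  - intros s hs. eapply Rle_trans; [apply hnorm_triangle|].
    rewrite !hnorm_scal, Rabs_mult, Rabs_Ropp, !(Rabs_pos_eq (exp _)), (Rabs_pos_eq kap)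
      by (exact hk || apply Rlt_le, exp_pos).
    assert (e1 : exp (- kap * s) <= 1).
    { rewrite <- exp_0. destruct (Rmult_le_pos kap s hk (Rlt_le _ _ (proj1 hs))) as [q|q].
      - apply Rlt_le, exp_increasing. lra.
      - apply Req_le. f_equal. lra. }
    pose proof (exp_pos (- kap * s)) as e0.
    pose proof (hg s hs) as q1. pose proof (hg1 s hs) as q2.
    pose proof (hnorm_ge_0 (g s)) as q3. pose proof (hnorm_ge_0 (g1 s)) as q4.
    assert (b1 : kap * exp (- kap * s) * norm (g s) <= kap * K).
    { rewrite Rmult_assoc. apply Rmult_le_compat_l; [exact hk|].
      rewrite <- (Rmult_1_l K). apply Rmult_le_compat; lra. }
    assert (b2 : exp (- kap * s) * norm (g1 s) <= K * Rpower s (a - 1)).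
    { rewrite <- (Rmult_1_l (K * _)). apply Rmult_le_compat; lra. }
    replace (K / a * (a * Rpower s (a - 1))) with (K * Rpower s (a - 1)) by (field; lra).
    lra.
Qed.

Lemma uniform_threshold (m : nat) (P : nat -> R -> Prop) :
  (forall j, (1 <= j <= m)%nat -> exists L, 0 <= L /\ forall x, L <= x -> P j x) ->
  exists L, 0 <= L /\ forall x, L <= x -> forall j, (1 <= j <= m)%nat -> P j x.
Proof.
  induction m as [|m IH]; intros h.
  - exists 0. split; [lra|]. intros x _ j hj. lia.
  - destruct IH as [L1 [h1 p1]]; [intros j hj; apply h; lia|].
    destruct (h (S m) ltac:(lia)) as [L2 [h2 p2]].
    exists (L1 + L2). split; [lra|]. intros x hx j hj.
    destruct (Nat.eq_dec j (S m)) as [e|e].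
    + subst j. apply p2. lra.
    + apply p1; [lra|lia].
Qed.

(* [hdata]: the estimate forces f = 0 on (0, T] when u0 = 0. *)
Theorem theorem3 (H : Hilbert) (m : nat) (kappa T : R) (alpha : nat -> R)
    (A : operator H) (B : nat -> operator H) (E : R -> H -> H)
    (f g g1 g2 : R -> H) (u0 : H) (u u1 w1 : R -> H) (K : R)
    (hm : (1 <= m)%nat)
    (hkappa : 0 <= kappa)
    (halpha : forall j, (1 <= j <= m)%nat -> 0 < alpha j < 1)
    (hT : 0 < T)
    (hA : self_adjoint A)
    (hApos : positive_definite A)
    (hAinv : has_compact_inverse A)
    (hB : forall j, (1 <= j <= m)%nat ->
       self_adjoint (B j) /\
       (forall x, dom A x -> dom (B j) x) /\
       dominates A (B j))
    (hE : exp_semigroup A E)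
    (hu0 : dom A u0)
    (hu : is_solution A m B kappa alpha f u0 u u1)
    (hg : forall t, 0 <= t -> g t = scal (exp (kappa * t)) (f t))
    (hg1 : forall t, 0 < t <= T -> is_derive g t (g1 t))
    (hg2 : forall t, 0 < t <= T -> is_derive g1 t (g2 t))
    (hw1 : forall t, 0 < t <= T ->
       is_derive (fun s => E s (minus (A u0) (g 0))) t (w1 t))
    (hK : 0 < K)
    (hbound0 : forall t, 0 < t <= T ->
       norm (minus (A u0) (g 0)) + norm (g t) <= K)
    (hbound1 : forall t, 0 < t <= T ->
       norm (w1 t) + norm (g1 t) + t * norm (g2 t)
         <= K * Rpower t (alpha_min alpha m - 1))
    (hdata : u0 = zero -> forall t, 0 < t <= T -> f t = zero) :
  exists C : R, 0 < C /\
    forall t, 0 < t <= T ->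
      norm (u1 t) + norm (A (u t)) <= C * exp (- kappa * t) * norm u0.
Proof.
  destruct (inverse_facts A hA hApos hAinv) as [S [AS [SA [S_linear [S_sym S_pos]]]]].
  assert (hc : forall j, exists c, (1 <= j <= m)%nat ->
    0 <= c /\ is_linear (fun x => B j (S x)) /\
    (forall x, norm (B j (S x)) <= c * norm x) /\
    (forall x y, inner (B j (S x)) (S y) = inner (S x) (B j (S y))) /\
    (forall x y, Rabs (inner (B j (S x)) (S y)) <=
       c * sqrt (inner x (S x)) * sqrt (inner y (S y)))).
  { intros j. destruct (classic (1 <= j <= m)%nat) as [hj|hj]; [|now exists 0].
    destruct (hB j hj) as [b1 [b2 b3]].
    destruct (dominated_facts A (B j) S hA b1 b2 b3 AS S_linear) as [c h]. now exists c. }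
  set (c := fun j => proj1_sig (constructive_indefinite_description _ (hc j))).
  assert (c_spec := fun j => proj2_sig (constructive_indefinite_description _ (hc j))).
  fold c in c_spec. cbv beta in c_spec.
  assert (mpos : 1 <= INR m) by (apply (le_INR 1); exact hm).
  (* Each of the [m] memory terms gets the share [1 / (2 m)] of the total [1 / 2], for all exponents
     beyond a common threshold [lam], hence for [kappa + lam]. *)
  destruct (uniform_threshold m (fun j kap =>
    c j * RInt (fun r => Rabs (kern T kap (alpha j) (Gamma (alpha j)) r)) 0 1 <= / (2 * INR m)))
    as [lam [lam0 hlam]].
  { intros j hj. destruct (c_spec j hj) as [c0 _]. fold (c j) in c0.
    (* Division by [c j + 1], since [c j] may be zero. *)
    destruct (kernel_mass_small T (alpha j) (Gamma (alpha j)) (/ (2 * INR m) / (c j + 1)) hT)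
      as [L [hL hk]].
    - now apply halpha.
    - apply Rdiv_lt_0_compat; [apply Rinv_0_lt_compat|]; lra.
    - exists L. split; [exact hL|]. intros kap hkap. specialize (hk kap hkap).
      apply Rle_trans with (c j * (/ (2 * INR m) / (c j + 1))).
      + now apply Rmult_le_compat_l.
      + assert (q : 0 < / (2 * INR m)) by (apply Rinv_0_lt_compat; lra).
        apply Rmult_le_reg_r with (c j + 1); [lra|].
        replace (c j * (/ (2 * INR m) / (c j + 1)) * (c j + 1)) with (c j * / (2 * INR m))
          by (field; lra).
        nra. }
  assert (small : sum_n_m (fun j => c j * RInt (fun r =>
    Rabs (kern T (kappa + lam) (alpha j) (Gamma (alpha j)) r)) 0 1) 1 m <= 1 / 2).
  { apply Rle_trans with (sum_n_m (fun _ => / (2 * INR m)) 1 m).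
    - apply sum_1_le. intros j hj. apply hlam; [lra|exact hj].
    - rewrite sum_n_m_const. replace (Datatypes.S m - 1)%nat with m by lia.
      apply Req_le. field. lra. }
  assert (bounds := solution_bounds m kappa T lam alpha A B f u u1 u0 S c hT lam0
    (fun j hj => proj1 (halpha j hj)) hA AS SA S_linear S_sym S_pos
    (fun j hj => proj1 (hB j hj)) (fun j hj => proj1 (proj2 (hB j hj)))
    (fun j hj => proj1 (c_spec j hj)) (fun j hj => proj1 (proj2 (c_spec j hj)))
    (fun j hj => proj1 (proj2 (proj2 (c_spec j hj))))
    (fun j hj => proj1 (proj2 (proj2 (proj2 (c_spec j hj)))))
    (fun j hj => proj2 (proj2 (proj2 (proj2 (c_spec j hj))))) small hu0 hu).
  assert (al0 : 0 < alpha_min alpha m).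
  { apply MinRlist_P2. intros y hy. apply in_map_iff in hy. destruct hy as [j [e hj]].
    apply in_seq in hj. subst y. apply halpha. lia. }
  assert (ub := unscaled_bound m kappa T lam alpha A B f u u1 u0 lam0 hu0 hu).
  (* The right side of the estimate is proportional to [norm u0]. For [u0 = zero] both terms on the
     left must be shown to vanish; otherwise any bound independent of [t] can be divided by
     [norm u0]. *)
  destruct (classic (u0 = zero)) as [z|nz].
  - exists 1. split; [lra|]. intros t ht.
    destruct (bounds zero (fun _ => zero) (fun _ => 0)) as [b1 [b2 _]].
    + intros s. apply (@continuous_const _ H).
    + intros s. apply continuous_const.
    + easy.
    + easy.
    + intros s r _.
      match goal with |- norm ?x <= _ => replace x with (zero : H) by vector_ring end.
      rewrite hnorm_zero. lra.
    + intros s hs. unfold source. rewrite (hdata z s hs), z, op_zero.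
      apply inner_ext. intros v. fold_vector_ops. repeat progress inner_simpl.
      rewrite inner_sum_1, (sum_n_m_ext_loc _ (fun _ => zero)).
      * rewrite (@sum_n_m_const_zero R_AbelianMonoid). unfold zero; simpl. ring.
      * intros j _. rewrite op_zero, inner_scal, inner_zero. apply Rmult_0_r.
    + rewrite hnorm_zero in b1, b2. specialize (b1 t ht). specialize (b2 t ht).
      assert (s0 : scaled lam u u0 t = zero).
      { apply inner_self_zero. rewrite inner_norm.
        pose proof (hnorm_ge_0 (scaled lam u u0 t)). nra. }
      assert (b3 : norm (A (scaled lam u u0 t)) <= 0) by (rewrite s0, op_zero, hnorm_zero; lra).
      eapply Rle_trans; [apply (ub (2 * (0 + 0)) (2 * (0 + 0) * t) 0 t ht b1 b2 b3)|].
      rewrite z, op_zero, hnorm_zero. lra.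
  - assert (nu : 0 < norm u0).
    { destruct (hnorm_ge_0 u0) as [h|h]; [exact h|]. exfalso. apply nz, inner_self_zero.
      rewrite inner_norm, <- h. ring. }
    destruct (has_modulus_extension T hT (source m kappa T lam alpha A B f u0))
      as [F0 [F1 [th [cF1 [cth [F10 [th0 [hth hF]]]]]]]].
    { apply has_modulus_minus; [apply has_modulus_minus; [apply has_modulus_minus|]|].
      (* The hypotheses bound [g = exp (kappa * t) f], so the weighted source is expressed through
         [g]. *)
      - apply has_modulus_ext with (fun t => scal (exp (- (kappa + lam) * t)) (g t)).
        + intros t ht. rewrite (hg t) by lra. apply inner_ext. intros v. rewrite !inner_scal.
          rewrite <- Rmult_assoc, <- exp_plus. f_equal. f_equal. ring.
        + apply (has_modulus_weighted T (kappa + lam) K (alpha_min alpha m) g g1); auto.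
          * lra.
          * intros t ht. pose proof (hbound0 t ht). pose proof (hnorm_ge_0 (minus (A u0) (g 0))). lra.
          * intros t ht. pose proof (hbound1 t ht). pose proof (hnorm_ge_0 (w1 t)).
            assert (0 <= t * norm (g2 t)) by (apply Rmult_le_pos; [lra|apply hnorm_ge_0]). lra.
      - apply has_modulus_const.
      - apply has_modulus_const.
      - apply (has_modulus_sum T (fun j t => scal (RInt (kern T (kappa + lam) (alpha j) (Gamma (alpha j))) 0 (phase T (alpha j) t)) (B j u0))).
        intros j hj. destruct (halpha j hj) as [a0 _].
        apply (has_modulus_scal T _ (fun t => Rabs (amplitude T (alpha j) (Gamma (alpha j))) * phase T (alpha j) t)).
        + intros s. apply (continuous_mult (fun _ => Rabs (amplitude T (alpha j) (Gamma (alpha j)))));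
            [apply continuous_const|now apply continuous_phase].
        + intros s hs. unfold phase. rewrite pow0_neg; [ring|].
          assert (0 < / T) by now apply Rinv_0_lt_compat. unfold Rdiv. nra.
        + intros r s h1 h2 h3. apply kernel_mass_dif; lra. }
    destruct (bounds F0 F1 th cF1 cth F10 th0 hth hF) as [b1 [b2 [C b3]]].
    set (L := 2 * (norm F0 + th T)) in *.
    set (M := exp (lam * T) * (L + lam * (L * T + norm u0) + (C + norm (A u0)))).
    assert (L0 : 0 <= L) by exact (Rle_trans _ _ _ (hnorm_ge_0 _) (b1 T ltac:(lra))).
    assert (hM : forall t, 0 < t <= T -> norm (u1 t) + norm (A (u t)) <= M).
    { intros t ht. apply (ub L (L * T) C t ht); auto.
      eapply Rle_trans; [now apply b2|]. apply Rmult_le_compat_l; lra. }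
    assert (M0 : 0 <= M).
    { pose proof (hM T ltac:(lra)). pose proof (hnorm_ge_0 (u1 T)).
      pose proof (hnorm_ge_0 (A (u T))). lra. }
    (* The division creates the factor [norm u0], [exp (kappa * T)] pays for [exp (- kappa * t)] on
       [(0, T]], and [M + 1] is positive even if [M] is zero. *)
    exists ((M + 1) * exp (kappa * T) / norm u0). split.
    + apply Rdiv_lt_0_compat; [|exact nu]. apply Rmult_lt_0_compat; [lra|apply exp_pos].
    + intros t ht. eapply Rle_trans; [now apply hM|].
      replace ((M + 1) * exp (kappa * T) / norm u0 * exp (- kappa * t) * norm u0)
        with ((M + 1) * (exp (kappa * T) * exp (- kappa * t))) by (field; lra).
      rewrite <- exp_plus.
      assert (e : 1 <= exp (kappa * T + - kappa * t)).
      { pose proof (exp_ineq1_le (kappa * T + - kappa * t)).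
        assert (0 <= kappa * (T - t)) by (apply Rmult_le_pos; lra). lra. }
      nra.
Qed.
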